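(* Let $\mu\in\Omega$ and $\beta\in[0,1)$. For each fixed $z\in\Delta$ we have (i) $$\left\{\frac{1-z}{f(z)^{1/\mu}}:\ f\in G(\mu,\beta)\right\}=\left\{(1+\lambda z)^{1-\beta}:\ \lambda\in\mathbb{C},\ |\lambda|\le 1\right\}$$ and (ii) $$\left\{\frac{f'(z)}{\mu f(z)}+\frac{1}{1-z}:\ f\in G(\mu,\beta)\right\}=\left\{w\in\mathbb{C}:\ \left|w-\frac{(1-\beta)\bar z}{1-|z|^2}\right|\le\frac{1-\beta}{1-|z|^2}\right\}.$$ Furthermore, if $f\in G(\mu,\beta)$ and $z\in\Delta$, $z\ne 0$, then either one of the relations $$\frac{1-z}{f(z)^{1/\mu}}\in\left\{(1+\lambda z)^{1-\beta}:\ |\lambda|=1\right\}$$ and $$\frac{f'(z)}{\mu f(z)}+\frac{1}{1-z}\in\left\{w:\ \left|w-\frac{(1-\beta)\bar z}{1-|z|^2}\right|=\frac{1-\beta}{1-|z|^2}\right\}$$ holds only if there is $\xi\in\partial\Delta$ such that $f$ is the function $$f(\zeta)=\frac{(1-\zeta)^\mu}{(1-\zeta\bar\xi)^{(1-\beta)\mu}},\quad \zeta\in\Delta.$$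
   Context: $\Delta$ is the open unit disk in $\mathbb{C}$ and $\mathrm{Hol}(\Delta,\mathbb{C})$ is the set of holomorphic functions $\Delta\to\mathbb{C}$. Let $\Omega=\{\lambda\in\mathbb{C}: |\lambda-1|\le 1,\ \lambda\ne 0\}$. For $\mu\in\Omega$ and $\beta\in[0,1)$, the class $G(\mu,\beta)$ ($\mu$-spirallike functions of order $\beta$ with respect to a boundary point) consists of all univalent (injective holomorphic) functions $f\in\mathrm{Hol}(\Delta,\mathbb{C})$ with $f(0)=1$ such that $$\mathrm{Re}\left(\frac{2}{\mu}\cdot\frac{zf'(z)}{f(z)}+\frac{1+z}{1-z}\right)>\beta,\quad z\in\Delta.$$ (Such $f$ have no zeros in $\Delta$.) Complex powers of nonvanishing holomorphic functions on $\Delta$ taking value $1$ at $0$ are taken with the branch equal to $1$ at $0$; $(1+\lambda z)^{1-\beta}$ is the principal branch.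
   Formalization: The class G(μ,β) is taken to contain also the constant function 1 (a member only when β=0); with univalent functions alone the equalities fail for β=0, e.g. in (ii) at z=0 the value w=1 would need f'(0)=0. *)

(* Defs.v *)
From Stdlib Require Import Reals Lra ClassicalEpsilon.
From Coquelicot Require Import Coquelicot.

Open Scope R_scope.
Open Scope C_scope.

Definition disk (z : C) : Prop := (Cmod z < 1)%R.

(* Functions on the disk are represented by total functions [C -> C]; only
   their values on [disk] are ever constrained.  The scalars have to be given
   explicitly: over [C_AbsRing], [ex_derive] is complex differentiability. *)
Definition holomorphic (f : C -> C) : Prop :=
  forall z, disk z -> ex_derive (K := C_AbsRing) (V := C_NormedModule) f z.

Definition univalent (f : C -> C) : Prop :=
  holomorphic f /\
  forall z w, disk z -> disk w -> f z = f w -> z = w.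

Definition Cexp (z : C) : C :=
  (exp (Re z) * cos (Im z), exp (Re z) * sin (Im z))%R.

(* Principal argument in (-PI, PI]; meaningful for w <> 0 only. *)
Definition Carg (w : C) : R :=
  if Rle_dec 0 (Im w) then acos (Re w / Cmod w) else (- acos (Re w / Cmod w))%R.

Definition Clog (w : C) : C := (ln (Cmod w), Carg w).

Definition princ_pow (w a : C) : C := Cexp (a * Clog w).

Definition is_log_branch (f L : C -> C) : Prop :=
  holomorphic L /\ L 0 = 0 /\ forall z, disk z -> Cexp (L z) = f z.

(* When f is holomorphic and zero-free on the disk with f 0 = 1, the function L
   with [is_log_branch f L] exists and is unique on the disk; [log_branch f] is
   junk for other f. *)
Definition log_branch (f : C -> C) : C -> C :=
  epsilon (inhabits (fun _ : C => RtoC 0)) (is_log_branch f).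

(* The branch of f^a that takes the value 1 at 0. *)
Definition pow_branch (f : C -> C) (a : C) (z : C) : C :=
  Cexp (a * log_branch f z).

Definition Omega (mu : C) : Prop := (Cmod (mu - 1) <= 1)%R /\ mu <> 0.

(* mu-spirallike functions of order beta with respect to a boundary point.
   - [f z <> 0] is what gives the quotient f'/f its meaning.
   - As in Robertson's definition of this kind of class, the constant 1 is
     admitted next to the univalent functions.  It satisfies the inequality only
     for beta = 0, so for 0 < beta every member is univalent.  For beta = 0 it
     is the member (1 - z)^mu / (1 - z * Cconj xi)^mu with xi = 1, and it cannot
     be left out: at z = 0 the value w = 1 of f'(z) / (mu f(z)) + 1 / (1 - z)
     requires f'(0) = 0, which no univalent f satisfies. *)
Definition G (mu : C) (beta : R) (f : C -> C) : Prop :=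
  (univalent f \/ forall z, disk z -> f z = 1) /\
  f 0 = 1 /\
  forall z, disk z ->
    f z <> 0 /\
    (Re (2 / mu * (z * C_derive f z / f z) + (1 + z) / (1 - z)) > beta)%R.

Definition quotient_value (mu : C) (f : C -> C) (z : C) : C :=
  (1 - z) / pow_branch f (1 / mu) z.

Definition derivative_value (mu : C) (f : C -> C) (z : C) : C :=
  C_derive f z / (mu * f z) + 1 / (1 - z).

Definition center (beta : R) (z : C) : C :=
  RtoC (1 - beta) * Cconj z / RtoC (1 - Cmod z ^ 2).

Definition radius (beta : R) (z : C) : R :=
  ((1 - beta) / (1 - Cmod z ^ 2))%R.

(* Main.v *)
Require Import Defs.
From Stdlib Require Import Reals Lra Lia ClassicalEpsilon.
From Coquelicot Require Import Coquelicot.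

(** Let f be in the class, L the branch of log f that vanishes at 0, and
    F = (L / mu - log (1 - z)) / (1 - beta). Then the second functional is
    (1 - beta) F', the first one is exp (-(1 - beta) F), and the inequality that
    defines the class says that Re (z F') > -1/2, with F 0 = 0
    ([G_normal_form]). So everything is a statement about such functions F.

    For the derivative, w = z F' satisfies |w| <= |1 + w|, so w / (1 + w) is a
    Schwarz function z phi(z) with |phi| <= 1, and F' = phi / (1 - z phi)
    ([derivative_representation]). For fixed z, the image of the closed unit disc
    under q |-> q / (1 - z q) is the disc with centre conj z / (1 - |z|^2) and
    radius 1 / (1 - |z|^2), and its boundary comes from |q| = 1.

    For the quotient, s = 1 - exp (-F) satisfies |s(z)| <= |z|
    ([subordination_log]). Otherwise |s| reaches 1 somewhere; at a first such
    point z0, Schwarz's lemma on |z| < |z0| forces z0 s'(z0) = k s(z0) with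
    k >= 1, hence z0 F'(z0) = k u / (1 - u) with |u| = 1, of real part
    -k/2 <= -1/2. So exp (-F) = 1 - s takes values 1 + lambda z, |lambda| <= 1.

    Equality in either estimate at one point z <> 0 is equality in Schwarz's lemma
    or in the maximum principle; it leaves only F = -log (1 - c z) with |c| = 1,
    which is the stated f with conj xi = c.

    Conversely, for |c| <= 1 the function F = -log (1 - c z) comes from
    f = (1 - z)^mu / (1 - c z)^((1 - beta) mu), and these f attain all claimed
    values. The point is that they are univalent ([extremal_fun_univalent]). With
    u = 1 / (1 - z) and v = u + c / (1 - c), both in the right half-plane, the
    exponent log f / mu is -(beta log u + (1 - beta) log v) up to a constant. It is
    injective because 1 / u and 1 / v have positive real part, and the imaginary
    parts of two of its values differ by less than pi, while the periods
    2 pi i k / mu of exp (mu _) have imaginary part at least pi in modulus for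
    k <> 0: this is the role of |mu - 1| <= 1, that is, Re (1 / mu) >= 1/2.

    The complex analysis is developed from differentiability alone. Goursat's
    theorem on rectangles, applied to g (exp w), gives the mean value property on
    circles and Cauchy's formula for the derivative; hence derivatives of
    holomorphic functions are holomorphic ([derivative_holomorphic]), f(z) / z is
    holomorphic when f 0 = 0, and Schwarz's lemma follows by averaging f(z) / z
    over circles moved by automorphisms of the disc ([schwarz]). Logarithms of
    zero-free functions are sums of principal logarithms of the ratios
    f ((k + 1) z / n) / f (k z / n) ([log_branch_exists]). *)

Open Scope R_scope.
Open Scope C_scope.

(** * Complex differentiation *)

Definition is_Cderive (f : C -> C) (z l : C) : Prop :=
  is_derive (K := C_AbsRing) (V := C_NormedModule) f z l.

(** Only moduli of complex numbers occur in this form, so the differentiation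
    rules below become estimates with the triangle inequality. *)
Lemma is_Cderive_eps (f : C -> C) (z l : C) :
  is_Cderive f z l <->
  forall eps : R, (0 < eps)%R -> exists d : R, (0 < d)%R /\
    forall w : C, (Cmod (w - z) < d)%R ->
      (Cmod (f w - f z - l * (w - z)) <= eps * Cmod (w - z))%R.
Proof.
  split.
  - intros [_ H] eps He.
    destruct (H z (fun P HP => HP) (mkposreal eps He)) as [d Hd].
    exists d; split; [apply cond_pos|].
    intros w Hw.
    assert (E := Hd w Hw).
    replace (f w - f z - l * (w - z)) with
      (f w + - f z + - ((w + - z) * l)) by ring.
    exact E.
  - intros H; split; [apply is_linear_scal_l|].
    intros x Hx.
    assert (E : z = x).
    { apply (@is_filter_lim_locally_unique C_AbsRing
               (AbsRing_NormedModule C_AbsRing)); exact Hx. }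
    subst x. intros eps.
    destruct (H eps (cond_pos eps)) as [d [Hd H']].
    exists (mkposreal _ Hd). intros w Hw.
    assert (E := H' w Hw).
    replace (f w - f z - l * (w - z)) with
      (f w + - f z + - ((w + - z) * l)) in E by ring.
    exact E.
Qed.

Lemma is_Cderive_continuous (f : C -> C) (z l : C) :
  is_Cderive f z l ->
  forall eps : R, (0 < eps)%R -> exists d : R, (0 < d)%R /\
    forall w : C, (Cmod (w - z) < d)%R -> (Cmod (f w - f z) < eps)%R.
Proof.
  intros H eps He.
  destruct (proj1 (is_Cderive_eps f z l) H 1%R Rlt_0_1) as [d [Hd H']].
  assert (P := Cmod_ge_0 l).
  assert (Q : (0 < eps / (Cmod l + 1))%R) by (apply Rdiv_lt_0_compat; lra).
  exists (Rmin d (eps / (Cmod l + 1))). split; [apply Rmin_pos; auto|].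
  intros w Hw.
  assert (W1 := Rlt_le_trans _ _ _ Hw (Rmin_l _ _)).
  assert (W2 := Rlt_le_trans _ _ _ Hw (Rmin_r _ _)).
  specialize (H' w W1).
  replace (f w - f z) with ((f w - f z - l * (w - z)) + l * (w - z)) by ring.
  eapply Rle_lt_trans; [apply Cmod_triangle|].
  rewrite Cmod_mult.
  apply Rle_lt_trans with ((Cmod l + 1) * Cmod (w - z))%R; [lra|].
  replace eps with ((Cmod l + 1) * (eps / (Cmod l + 1)))%R by (field; lra).
  apply Rmult_lt_compat_l; lra.
Qed.

Lemma is_Cderive_unique (f : C -> C) (z l l' : C) :
  is_Cderive f z l -> is_Cderive f z l' -> l = l'.
Proof.
  intros H H'. rewrite <- (is_C_derive_unique _ _ _ H).
  apply is_C_derive_unique; exact H'.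
Qed.

Lemma is_Cderive_ext_near (f g : C -> C) (z l : C) (d : R) :
  (0 < d)%R -> (forall w, (Cmod (w - z) < d)%R -> f w = g w) ->
  is_Cderive f z l -> is_Cderive g z l.
Proof.
  intros Hd E H. apply is_Cderive_eps. intros eps He.
  destruct (proj1 (is_Cderive_eps f z l) H eps He) as [d' [Hd' H']].
  exists (Rmin d d'); split; [apply Rmin_pos; auto|].
  intros w Hw.
  rewrite <- !E; [apply H'; apply (Rlt_le_trans _ _ _ Hw (Rmin_r _ _))| |].
  - replace (z - z) with (RtoC 0) by ring. rewrite Cmod_0; exact Hd.
  - apply (Rlt_le_trans _ _ _ Hw (Rmin_l _ _)).
Qed.

Lemma disk_open (z : C) : disk z ->
  exists d : R, (0 < d)%R /\ forall w, (Cmod (w - z) < d)%R -> disk w.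
Proof.
  intros Hz. unfold disk in *. exists (1 - Cmod z)%R. split; [lra|].
  intros w Hw. replace w with ((w - z) + z) by ring.
  eapply Rle_lt_trans; [apply Cmod_triangle|]. lra.
Qed.

Lemma is_Cderive_ext_disk (f g : C -> C) (z l : C) :
  disk z -> (forall w, disk w -> f w = g w) ->
  is_Cderive f z l -> is_Cderive g z l.
Proof.
  intros Hz E H. destruct (disk_open z Hz) as [d [Hd Hw]].
  apply is_Cderive_ext_near with f d; auto.
Qed.

Lemma is_Cderive_const (c z : C) : is_Cderive (fun _ => c) z 0.
Proof. exact (is_derive_const c z). Qed.

Lemma is_Cderive_id (z : C) : is_Cderive (fun w => w) z 1.
Proof.
  apply is_Cderive_eps. intros eps He. exists 1%R. split; [lra|].
  intros w _. replace (w - z - 1 * (w - z)) with (RtoC 0) by ring.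
  rewrite Cmod_0. apply Rmult_le_pos; [lra|apply Cmod_ge_0].
Qed.

Lemma is_Cderive_plus (f g : C -> C) (z a b : C) :
  is_Cderive f z a -> is_Cderive g z b ->
  is_Cderive (fun w => f w + g w) z (a + b).
Proof. exact (is_derive_plus f g z a b). Qed.

Lemma is_Cderive_opp (f : C -> C) (z a : C) :
  is_Cderive f z a -> is_Cderive (fun w => - f w) z (- a).
Proof. exact (is_derive_opp f z a). Qed.

Lemma is_Cderive_minus (f g : C -> C) (z a b : C) :
  is_Cderive f z a -> is_Cderive g z b ->
  is_Cderive (fun w => f w - g w) z (a - b).
Proof. exact (is_derive_minus f g z a b). Qed.

Lemma is_Cderive_mult (f g : C -> C) (z a b : C) :
  is_Cderive f z a -> is_Cderive g z b ->
  is_Cderive (fun w => f w * g w) z (a * g z + f z * b).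
Proof.
  intros Ha Hb.
  apply is_Cderive_eps. intros eps He.
  destruct (is_Cderive_continuous g z b Hb (eps / 3 / (Cmod a + 1))%R)
    as [d0 [Hd0 H0]].
  { assert (P := Cmod_ge_0 a). apply Rdiv_lt_0_compat; lra. }
  destruct (is_Cderive_continuous g z b Hb 1 Rlt_0_1) as [d3 [Hd3 H3]].
  assert (Pg := Cmod_ge_0 (g z)). assert (Pf := Cmod_ge_0 (f z)).
  assert (Pa := Cmod_ge_0 a).
  destruct (proj1 (is_Cderive_eps f z a) Ha (eps / 3 / (Cmod (g z) + 1))%R)
    as [d1 [Hd1 H1]]. { apply Rdiv_lt_0_compat; lra. }
  destruct (proj1 (is_Cderive_eps g z b) Hb (eps / 3 / (Cmod (f z) + 1))%R)
    as [d2 [Hd2 H2]]. { apply Rdiv_lt_0_compat; lra. }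
  exists (Rmin (Rmin d0 d3) (Rmin d1 d2)).
  split; [repeat apply Rmin_pos; auto|].
  intros w Hw.
  assert (W1 := Rlt_le_trans _ _ _ Hw (Rmin_l _ _)).
  assert (W2 := Rlt_le_trans _ _ _ Hw (Rmin_r _ _)).
  assert (W0 := Rlt_le_trans _ _ _ W1 (Rmin_l _ _)).
  assert (W3 := Rlt_le_trans _ _ _ W1 (Rmin_r _ _)).
  assert (W4 := Rlt_le_trans _ _ _ W2 (Rmin_l _ _)).
  assert (W5 := Rlt_le_trans _ _ _ W2 (Rmin_r _ _)).
  specialize (H0 w W0). specialize (H1 w W4). specialize (H2 w W5).
  specialize (H3 w W3).
  replace (f w * g w - f z * g z - (a * g z + f z * b) * (w - z)) with
    ((f w - f z - a * (w - z)) * g w + (a * (w - z)) * (g w - g z)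
     + f z * (g w - g z - b * (w - z))) by ring.
  assert (Gw : (Cmod (g w) <= Cmod (g z) + 1)%R).
  { replace (g w) with (g z + (g w - g z)) by ring.
    eapply Rle_trans; [apply Cmod_triangle|]. lra. }
  eapply Rle_trans; [apply Cmod_triangle|].
  eapply Rle_trans; [apply Rplus_le_compat_r, Cmod_triangle|].
  rewrite !Cmod_mult.
  set (t := Cmod (w - z)) in *. assert (0 <= t)%R by apply Cmod_ge_0.
  replace (eps * t)%R with (eps / 3 / (Cmod (g z) + 1) * t * (Cmod (g z) + 1)
    + (Cmod a + 1) * t * (eps / 3 / (Cmod a + 1))%R
    + (Cmod (f z) + 1) * (eps / 3 / (Cmod (f z) + 1) * t))%R
    by (field; repeat split; lra).
  apply Rplus_le_compat; [apply Rplus_le_compat|].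
  - apply Rmult_le_compat; auto using Cmod_ge_0.
  - apply Rmult_le_compat; auto using Cmod_ge_0.
    + apply Rmult_le_pos; auto.
    + apply Rmult_le_compat_r; lra.
    + lra.
  - apply Rmult_le_compat; auto using Cmod_ge_0. lra.
Qed.

Lemma is_Cderive_scal (f : C -> C) (c z a : C) :
  is_Cderive f z a -> is_Cderive (fun w => c * f w) z (c * a).
Proof.
  intros H. replace (c * a) with (0 * f z + c * a) by ring.
  apply (is_Cderive_mult (fun _ => c)); [apply is_Cderive_const|exact H].
Qed.

Lemma is_Cderive_comp (f g : C -> C) (z a b : C) :
  is_Cderive f (g z) a -> is_Cderive g z b ->
  is_Cderive (fun w => f (g w)) z (b * a).
Proof.
  intros Ha Hb. apply is_Cderive_eps. intros eps He.
  assert (Pa := Cmod_ge_0 a). assert (Pb := Cmod_ge_0 b).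
  destruct (proj1 (is_Cderive_eps f _ a) Ha (eps / 2 / (Cmod b + 1))%R)
    as [d1 [Hd1 H1]]. { apply Rdiv_lt_0_compat; lra. }
  destruct (proj1 (is_Cderive_eps g z b) Hb (Rmin 1 (eps / 2 / (Cmod a + 1))%R))
    as [d2 [Hd2 H2]].
  { apply Rmin_pos; [lra|]. apply Rdiv_lt_0_compat; lra. }
  destruct (is_Cderive_continuous g z b Hb d1 Hd1) as [d3 [Hd3 H3]].
  exists (Rmin d2 d3). split; [apply Rmin_pos; auto|].
  intros w Hw.
  specialize (H2 w (Rlt_le_trans _ _ _ Hw (Rmin_l _ _))).
  specialize (H3 w (Rlt_le_trans _ _ _ Hw (Rmin_r _ _))).
  specialize (H1 (g w) H3).
  set (t := Cmod (w - z)) in *. assert (Pt : (0 <= t)%R) by apply Cmod_ge_0.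
  assert (A1 : (Cmod (g w - g z - b * (w - z)) <= t)%R).
  { eapply Rle_trans; [exact H2|]. rewrite <- (Rmult_1_l t) at 2.
    apply Rmult_le_compat_r; [auto|apply Rmin_l]. }
  assert (A2 : (Cmod (g w - g z - b * (w - z)) <= eps / 2 / (Cmod a + 1) * t)%R).
  { eapply Rle_trans; [exact H2|].
    apply Rmult_le_compat_r; [auto|apply Rmin_r]. }
  assert (A3 : (Cmod (g w - g z) <= (Cmod b + 1) * t)%R).
  { replace (g w - g z) with ((g w - g z - b * (w - z)) + b * (w - z)) by ring.
    eapply Rle_trans; [apply Cmod_triangle|]. rewrite Cmod_mult. fold t. lra. }
  replace (f (g w) - f (g z) - b * a * (w - z)) with
    ((f (g w) - f (g z) - a * (g w - g z)) + a * (g w - g z - b * (w - z)))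
    by ring.
  eapply Rle_trans; [apply Cmod_triangle|]. rewrite Cmod_mult.
  replace (eps * t)%R with (eps / 2 / (Cmod b + 1) * ((Cmod b + 1) * t) +
    (Cmod a + 1) * (eps / 2 / (Cmod a + 1) * t))%R by (field; lra).
  apply Rplus_le_compat.
  - eapply Rle_trans; [exact H1|]. apply Rmult_le_compat_l; auto.
    apply Rlt_le, Rdiv_lt_0_compat; lra.
  - apply Rmult_le_compat; auto using Cmod_ge_0. lra.
Qed.

Lemma is_Cderive_inv_pt (z : C) : z <> 0 -> is_Cderive (fun w => / w) z (- / (z * z)).
Proof.
  intros Hz. apply is_Cderive_eps. intros eps He.
  assert (P : (0 < Cmod z)%R) by (apply Cmod_gt_0; auto).
  exists (Rmin (Cmod z / 2) (eps * Cmod z ^ 3 / 2)). split.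
  { apply Rmin_pos; [lra|]. apply Rdiv_lt_0_compat; [|lra].
    apply Rmult_lt_0_compat; [lra|]. apply pow_lt; lra. }
  intros w Hw.
  assert (W1 := Rlt_le_trans _ _ _ Hw (Rmin_l _ _)).
  assert (W2 := Rlt_le_trans _ _ _ Hw (Rmin_r _ _)).
  assert (Q : (Cmod z / 2 <= Cmod w)%R).
  { assert (T := Cmod_triangle w (z - w)).
    replace (w + (z - w)) with z in T by ring.
    replace (z - w) with (- (w - z)) in T by ring. rewrite Cmod_opp in T. lra. }
  assert (Hw0 : w <> 0) by (apply Cmod_gt_0; lra).
  replace (/ w - / z - - / (z * z) * (w - z)) with
    ((w - z) * (w - z) / (z * z * w)) by (field; auto).
  rewrite Cmod_div by (repeat apply Cmult_neq_0; auto).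
  rewrite !Cmod_mult.
  set (t := Cmod (w - z)) in *. assert (Pt : (0 <= t)%R) by apply Cmod_ge_0.
  set (m := Cmod z) in *. set (n := Cmod w) in *.
  apply Rle_div_l; [repeat apply Rmult_lt_0_compat; lra|].
  replace (eps * t * (m * m * n))%R with (t * (eps * m * m * n))%R by ring.
  apply Rmult_le_compat_l; auto.
  assert (0 < eps * m * m)%R by nra.
  assert (eps * m * m * (m / 2) <= eps * m * m * n)%R
    by (apply Rmult_le_compat_l; lra).
  simpl in W2. lra.
Qed.

Lemma is_Cderive_inv (f : C -> C) (z a : C) :
  f z <> 0 -> is_Cderive f z a ->
  is_Cderive (fun w => / f w) z (- a / (f z * f z)).
Proof.
  intros Hz H. replace (- a / (f z * f z)) with (a * (- / (f z * f z)))
    by (field; auto).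
  apply (is_Cderive_comp (fun w => / w)); auto using is_Cderive_inv_pt.
Qed.

Lemma is_Cderive_div (f g : C -> C) (z a b : C) :
  g z <> 0 -> is_Cderive f z a -> is_Cderive g z b ->
  is_Cderive (fun w => f w / g w) z ((a * g z - f z * b) / (g z * g z)).
Proof.
  intros Hz Ha Hb.
  replace ((a * g z - f z * b) / (g z * g z)) with
    (a * / g z + f z * (- b / (g z * g z))) by (field; auto).
  apply (is_Cderive_mult f (fun w => / g w)); auto using is_Cderive_inv.
Qed.

Lemma is_Cderive_eq (f : C -> C) (z a b : C) :
  a = b -> is_Cderive f z a -> is_Cderive f z b.
Proof. intros <-; auto. Qed.

Lemma ex_Cderive_C_derive (f : C -> C) (z : C) :
  ex_derive (K := C_AbsRing) (V := C_NormedModule) f z ->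
  is_Cderive f z (C_derive f z).
Proof. apply C_derive_correct; exact z. Qed.

Lemma C_ext (z w : C) : Re z = Re w -> Im z = Im w -> z = w.
Proof. destruct z, w; simpl; congruence. Qed.

Lemma Cmod_le_Rabs (z : C) : (Cmod z <= Rabs (Re z) + Rabs (Im z))%R.
Proof.
  assert (P1 := Rabs_pos (Re z)). assert (P2 := Rabs_pos (Im z)).
  apply Rsqr_incr_0; [|apply Cmod_ge_0|lra].
  rewrite !Rsqr_pow2, Cmod2_alt, <- (pow2_abs (Re z)), <- (pow2_abs (Im z)). nra.
Qed.

Lemma im_le_Cmod (z : C) : (Rabs (Im z) <= Cmod z)%R.
Proof. eapply Rle_trans; [apply Rmax_r|apply Rmax_Cmod]. Qed.

(** * The complex exponential *)

Lemma Cexp_plus (z w : C) : Cexp (z + w) = Cexp z * Cexp w.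
Proof.
  destruct z as [a b], w as [c d]. apply C_ext; unfold Cexp; simpl;
  rewrite exp_plus, ?cos_plus, ?sin_plus; ring.
Qed.

Lemma Cexp_0 : Cexp 0 = 1.
Proof. apply C_ext; unfold Cexp; simpl; rewrite exp_0, ?cos_0, ?sin_0; ring. Qed.

Lemma Cmod_Cexp (z : C) : Cmod (Cexp z) = exp (Re z).
Proof.
  assert (P := exp_pos (Re z)).
  apply Rsqr_inj; [apply Cmod_ge_0|lra|].
  rewrite !Rsqr_pow2, Cmod2_alt. unfold Cexp; simpl.
  assert (T := sin2_cos2 (Im z)). unfold Rsqr in T. unfold Im in *. nra.
Qed.

Lemma Cexp_neq_0 (z : C) : Cexp z <> 0.
Proof. apply Cmod_gt_0. rewrite Cmod_Cexp. apply exp_pos. Qed.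

Lemma Cexp_opp (z : C) : Cexp (- z) = / Cexp z.
Proof.
  assert (N := Cexp_neq_0 z).
  assert (H : Cexp (- z) * Cexp z = 1).
  { rewrite <- Cexp_plus. replace (- z + z) with (RtoC 0) by ring.
    apply Cexp_0. }
  rewrite <- (Cmult_1_l (/ Cexp z)), <- H. field. exact N.
Qed.

Lemma Cexp_minus (z w : C) : Cexp (z - w) = Cexp z / Cexp w.
Proof. unfold Cminus. rewrite Cexp_plus, Cexp_opp. reflexivity. Qed.

Lemma Cexp_eq_1 (z : C) :
  Cexp z = 1 -> exists k : Z, Re z = 0%R /\ Im z = (2 * IZR k * PI)%R.
Proof.
  intros H.
  assert (M : exp (Re z) = 1%R) by (rewrite <- Cmod_Cexp, H; apply Cmod_1).
  assert (R0 : Re z = 0%R).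
  { apply exp_inv. rewrite M, exp_0. reflexivity. }
  assert (Hc : cos (Im z) = 1%R).
  { apply (f_equal Re) in H. unfold Cexp in H; simpl in H.
    unfold Re in M; simpl in M. unfold Re in H. rewrite M in H. lra. }
  assert (S : sin (Im z / 2) = 0%R).
  { replace (Im z) with (2 * (Im z / 2))%R in Hc by field.
    rewrite cos_2a_sin in Hc. nra. }
  destruct (sin_eq_0_0 _ S) as [k Hk]. exists k. split; [exact R0|lra].
Qed.

Lemma derivable_pt_lim_0_le (f : R -> R) (l eps : R) :
  derivable_pt_lim f 0 l -> (0 < eps)%R -> exists d : R, (0 < d)%R /\
    forall h, (Rabs h < d)%R -> (Rabs (f h - f 0 - l * h) <= eps * Rabs h)%R.
Proof.
  intros H He. destruct (H eps He) as [d Hd]. exists d.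
  split; [apply cond_pos|]. intros h Hh.
  destruct (Req_dec h 0) as [->|N].
  - replace (f 0 - f 0 - l * 0)%R with 0%R by ring. rewrite Rabs_R0. lra.
  - specialize (Hd h N Hh). rewrite Rplus_0_l in Hd.
    replace (f h - f 0 - l * h)%R with (((f h - f 0) / h - l) * h)%R
      by (field; auto).
    rewrite Rabs_mult. apply Rmult_le_compat_r; [apply Rabs_pos|lra].
Qed.

Lemma is_Cderive_Cexp_0 : is_Cderive Cexp 0 1.
Proof.
  apply is_Cderive_eps. intros eps He.
  set (e := Rmin 1 (eps / 8)).
  assert (Pe : (0 < e)%R) by (apply Rmin_pos; lra).
  assert (E1 : (e <= 1)%R) by apply Rmin_l.
  assert (E2 : (e <= eps / 8)%R) by apply Rmin_r. clearbody e.
  destruct (derivable_pt_lim_0_le exp 1 e derivable_pt_lim_exp_0 Pe)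
    as [d1 [Hd1 H1]].
  destruct (derivable_pt_lim_0_le sin 1 e derivable_pt_lim_sin_0 Pe)
    as [d2 [Hd2 H2]].
  destruct (derivable_pt_lim_0_le cos 0 e derivable_pt_lim_cos_0 Pe)
    as [d3 [Hd3 H3]].
  exists (Rmin (Rmin d1 d2) (Rmin d3 e)).
  split; [repeat apply Rmin_pos; auto|].
  intros w. replace (w - 0) with w by ring. destruct w as [x y]. intros Hw.
  assert (Hx := re_le_Cmod (x, y)). assert (Hy := im_le_Cmod (x, y)).
  simpl in Hx, Hy. set (t := Cmod (x, y)) in *.
  assert (W1 := Rlt_le_trans _ _ _ Hw (Rmin_l _ _)).
  assert (W2 := Rlt_le_trans _ _ _ Hw (Rmin_r _ _)).
  assert (W3 := Rlt_le_trans _ _ _ W1 (Rmin_l _ _)).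
  assert (W4 := Rlt_le_trans _ _ _ W1 (Rmin_r _ _)).
  assert (W5 := Rlt_le_trans _ _ _ W2 (Rmin_l _ _)).
  assert (W6 := Rlt_le_trans _ _ _ W2 (Rmin_r _ _)).
  assert (K1 : (Rabs (exp x - exp 0 - 1 * x) <= e * Rabs x)%R) by (apply H1; lra).
  assert (K2 : (Rabs (sin y - sin 0 - 1 * y) <= e * Rabs y)%R) by (apply H2; lra).
  assert (K3 : (Rabs (cos y - cos 0 - 0 * y) <= e * Rabs y)%R) by (apply H3; lra).
  rewrite exp_0 in K1. rewrite sin_0 in K2. rewrite cos_0 in K3.
  assert (Px := Rabs_pos x). assert (Py := Rabs_pos y).
  rewrite Cexp_0.
  eapply Rle_trans; [apply Cmod_le_Rabs|].
  unfold Cexp; simpl. 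
  (* Both components are rewritten so that only the remainders of exp, sin and
     cos at 0 and products of two small terms are left. *)
  replace (exp x * cos y + - (1) + - (1 * x - 0 * y))%R with
    ((exp x - 1 - 1 * x) * cos y + (1 + x) * (cos y - 1 - 0 * y))%R by ring.
  replace (exp x * sin y + - 0 + - (1 * y + 0 * x))%R with
    ((exp x - 1) * sin y + (sin y - 0 - 1 * y))%R by ring.
  assert (B1 : (Rabs ((exp x - 1 - 1 * x) * cos y) <= e * t)%R).
  { rewrite Rabs_mult. assert (C1 := COS_bound y).
    assert (Rabs (cos y) <= 1)%R by (apply Rabs_le; lra).
    assert (Q := Rabs_pos (cos y)). assert (Q' := Rabs_pos (exp x - 1 - 1 * x)).
    nra. }
  assert (B2 : (Rabs ((1 + x) * (cos y - 1 - 0 * y)) <= 2 * (e * t))%R).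
  { rewrite Rabs_mult.
    assert (Rabs (1 + x) <= 2)%R.
    { eapply Rle_trans; [apply Rabs_triang|]. rewrite Rabs_R1. lra. }
    assert (Q := Rabs_pos (1 + x)).
    apply Rmult_le_compat; auto using Rabs_pos. nra. }
  assert (B3 : (Rabs ((exp x - 1) * sin y) <= 4 * (e * t))%R).
  { rewrite Rabs_mult.
    assert (Rabs (exp x - 1) <= 2 * e)%R.
    { replace (exp x - 1)%R with ((exp x - 1 - 1 * x) + x)%R by ring.
      eapply Rle_trans; [apply Rabs_triang|]. nra. }
    assert (Rabs (sin y) <= 2 * t)%R.
    { replace (sin y) with ((sin y - 0 - 1 * y) + y)%R by ring.
      eapply Rle_trans; [apply Rabs_triang|]. nra. }
    replace (4 * (e * t))%R with ((2 * e) * (2 * t))%R by ring.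
    apply Rmult_le_compat; auto using Rabs_pos. }
  assert (B4 : (Rabs (sin y - 0 - 1 * y) <= e * t)%R) by nra.
  assert (T1 := Rabs_triang ((exp x - 1 - 1 * x) * cos y) ((1 + x) * (cos y - 1 - 0 * y))).
  assert (T2 := Rabs_triang ((exp x - 1) * sin y) (sin y - 0 - 1 * y)).
  assert (8 * (e * t) <= eps * t)%R by (assert (0 <= t)%R by apply Cmod_ge_0; nra).
  lra.
Qed.

Lemma is_Cderive_Cexp (z : C) : is_Cderive Cexp z (Cexp z).
Proof.
  apply is_Cderive_ext_near with (fun w => Cexp z * Cexp (w - z)) 1%R.
  - lra.
  - intros w _. rewrite <- Cexp_plus. f_equal; ring.
  - apply is_Cderive_eq with (Cexp z * ((1 - 0) * 1)); [ring|].
    apply is_Cderive_scal.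
    apply (is_Cderive_comp Cexp (fun w => w - z)).
    + replace (z - z) with (RtoC 0) by ring. apply is_Cderive_Cexp_0.
    + apply is_Cderive_minus; [apply is_Cderive_id|apply is_Cderive_const].
Qed.

Lemma is_Cderive_Cexp_comp (f : C -> C) (z a : C) :
  is_Cderive f z a -> is_Cderive (fun w => Cexp (f w)) z (a * Cexp (f z)).
Proof. apply is_Cderive_comp, is_Cderive_Cexp. Qed.

(** * The principal logarithm on the right half-plane *)

Lemma Re_div_Cmod_bound (w : C) : w <> 0 -> (-1 <= Re w / Cmod w <= 1)%R.
Proof.
  intros H. assert (P : (0 < Cmod w)%R) by (apply Cmod_gt_0; auto).
  assert (Q := re_le_Cmod w). apply Rabs_le_between in Q.
  split.
  - apply Rle_div_r; lra.
  - apply Rle_div_l; lra.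
Qed.

Lemma cos_Carg (w : C) : w <> 0 -> cos (Carg w) = (Re w / Cmod w)%R.
Proof.
  intros H. unfold Carg. destruct Rle_dec; rewrite ?cos_neg;
  apply cos_acos, Re_div_Cmod_bound; auto.
Qed.

Lemma sin_Carg (w : C) : w <> 0 -> sin (Carg w) = (Im w / Cmod w)%R.
Proof.
  intros H. assert (P : (0 < Cmod w)%R) by (apply Cmod_gt_0; auto).
  assert (B := Re_div_Cmod_bound w H).
  assert (S : sin (acos (Re w / Cmod w)) = (Rabs (Im w) / Cmod w)%R).
  { rewrite sin_acos by exact B.
    replace (1 - (Re w / Cmod w)²)%R with ((Im w / Cmod w)²)%R.
    - rewrite sqrt_Rsqr_abs. unfold Rdiv. rewrite Rabs_mult.
      rewrite (Rabs_right (/ Cmod w)); [reflexivity|].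
      apply Rle_ge, Rlt_le, Rinv_0_lt_compat; auto.
    - assert (E := Cmod2_alt w).
      apply Rmult_eq_reg_r with (Cmod w ^ 2)%R; [|apply pow_nonzero; lra].
      unfold Rsqr. field_simplify; lra. }
  unfold Carg. destruct Rle_dec as [L|L].
  - rewrite S, Rabs_right; [reflexivity|lra].
  - rewrite sin_neg, S, Rabs_left; [field|]; lra.
Qed.

Lemma Cexp_Clog (w : C) : w <> 0 -> Cexp (Clog w) = w.
Proof.
  intros H. assert (P : (0 < Cmod w)%R) by (apply Cmod_gt_0; auto).
  apply C_ext; unfold Cexp, Clog; simpl; rewrite exp_ln by auto.
  - rewrite cos_Carg by auto. field; lra.
  - rewrite sin_Carg by auto. field; lra.
Qed.

Lemma Re_pos_neq_0 (w : C) : (0 < Re w)%R -> w <> 0.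
Proof. intros H E. rewrite E in H. simpl in H. lra. Qed.

Lemma Carg_right_half_plane (w : C) :
  (0 < Re w)%R -> (- (PI / 2) < Carg w < PI / 2)%R.
Proof.
  intros H. assert (N := Re_pos_neq_0 w H).
  assert (P : (0 < Cmod w)%R) by (apply Cmod_gt_0; auto).
  assert (B := Re_div_Cmod_bound w N).
  assert (Q : (0 < Re w / Cmod w)%R) by (apply Rdiv_lt_0_compat; auto).
  assert (A := acos_bound (Re w / Cmod w)).
  assert (L : (acos (Re w / Cmod w) < PI / 2)%R).
  { apply Rnot_le_lt. intros L.
    apply cos_decr_1 in L; try (assert (PP := PI_RGT_0); lra).
    rewrite cos_acos, cos_PI2 in L; lra. }
  assert (PP := PI_RGT_0).
  unfold Carg. destruct Rle_dec; lra.
Qed.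

Lemma Clog_Cexp (z : C) : (- PI < Im z < PI)%R -> Clog (Cexp z) = z.
Proof.
  intros H. assert (P := exp_pos (Re z)).
  apply C_ext; unfold Clog; simpl.
  - rewrite Cmod_Cexp. apply ln_exp.
  - unfold Carg. rewrite Cmod_Cexp.
    replace (Re (Cexp z) / exp (Re z))%R with (cos (Im z))
      by (unfold Cexp; simpl; field; apply Rgt_not_eq, exp_pos).
    destruct Rle_dec as [L|L].
    + apply acos_cos. split; [|lra].
      destruct (Rle_lt_dec 0 (Im z)) as [|Hn]; [auto|exfalso].
      assert (S : (sin (Im z) < 0)%R) by (apply sin_lt_0_var; lra).
      unfold Cexp in L; simpl in L. unfold Re in P. unfold Im in *; simpl in *.
      unfold Re in L. nra.
    + destruct (Rle_lt_dec (Im z) 0) as [Hn|Hn].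
      * rewrite <- cos_neg, acos_cos; lra.
      * exfalso. assert (S : (0 < sin (Im z))%R) by (apply sin_gt_0; lra).
        apply L. unfold Cexp; simpl. unfold Re in *. unfold Im in *.
        nra.
Qed.

Lemma Clog_1 : Clog 1 = 0.
Proof.
  rewrite <- Cexp_0. apply Clog_Cexp. simpl. assert (P := PI_RGT_0). lra.
Qed.

Lemma Im_Clog_right_half_plane (w : C) :
  (0 < Re w)%R -> (- (PI / 2) < Im (Clog w) < PI / 2)%R.
Proof. apply Carg_right_half_plane. Qed.

(** The two arguments lie in (-pi/2, pi/2), so their sum does not leave the range
    of the principal argument. *)
Lemma Clog_mult (a b : C) :
  (0 < Re a)%R -> (0 < Re b)%R -> Clog (a * b) = Clog a + Clog b.
Proof.
  intros Ha Hb.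
  rewrite <- (Cexp_Clog a) at 1 by (apply Re_pos_neq_0; auto).
  rewrite <- (Cexp_Clog b) at 1 by (apply Re_pos_neq_0; auto).
  rewrite <- Cexp_plus. apply Clog_Cexp.
  assert (A := Im_Clog_right_half_plane a Ha).
  assert (B := Im_Clog_right_half_plane b Hb).
  rewrite im_plus. lra.
Qed.

(** The modulus controls the real part of Clog w. For the imaginary part, cos
    (Carg w) = Re w / |w| is close to 1, and the cosine decreases away from 0. *)
Lemma Clog_continuous_1 (eps : R) : (0 < eps)%R -> exists d : R, (0 < d)%R /\
  forall w, (Cmod (w - 1) < d)%R -> (Cmod (Clog w) < eps)%R.
Proof.
  intros He. set (e := Rmin (eps / 2) 1).
  assert (Pe : (0 < e)%R) by (apply Rmin_pos; lra).
  assert (E1 : (e <= eps / 2)%R) by apply Rmin_l.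
  assert (E2 : (e <= 1)%R) by apply Rmin_r.
  clearbody e. assert (PP := PI2_1).
  assert (Hc : (cos e < 1)%R).
  { rewrite <- cos_0. apply cos_decreasing_1; lra. }
  assert (Hp : (0 <= cos e)%R) by (apply cos_ge_0; lra).
  assert (X1 : (1 < exp e)%R).
  { rewrite <- exp_0. apply exp_increasing; auto. }
  assert (X2 : (exp (- e) < 1)%R).
  { rewrite <- exp_0. apply exp_increasing; lra. }
  exists (Rmin ((1 - cos e) / 2) (Rmin (exp e - 1) (1 - exp (- e)))).
  split; [repeat apply Rmin_pos; lra|].
  intros w Hw.
  assert (W1 := Rlt_le_trans _ _ _ Hw (Rmin_l _ _)).
  assert (W2 := Rlt_le_trans _ _ _ Hw (Rmin_r _ _)).
  assert (W3 := Rlt_le_trans _ _ _ W2 (Rmin_l _ _)).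
  assert (W4 := Rlt_le_trans _ _ _ W2 (Rmin_r _ _)).
  assert (Hr := re_le_Cmod (w - 1)).
  assert (Er : Re (w - 1) = (Re w - 1)%R) by (unfold Cminus; rewrite re_plus, re_opp; simpl; ring).
  rewrite Er in Hr. apply Rabs_le_between in Hr.
  assert (T1 : (Cmod w <= 1 + Cmod (w - 1))%R).
  { replace w with (1 + (w - 1)) at 1 by ring.
    eapply Rle_trans; [apply Cmod_triangle|]. rewrite Cmod_1. lra. }
  assert (T2 : (1 <= Cmod w + Cmod (w - 1))%R).
  { assert (T := Cmod_triangle w (- (w - 1))).
    replace (w + - (w - 1)) with (RtoC 1) in T by ring.
    rewrite Cmod_opp, Cmod_1 in T. exact T. }
  assert (Rp : (0 < Re w)%R) by lra.
  assert (N := Re_pos_neq_0 w Rp).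
  assert (P : (0 < Cmod w)%R) by (apply Cmod_gt_0; auto).
  assert (A1 : (Rabs (Re (Clog w)) < e)%R).
  { unfold Clog; simpl. apply Rabs_lt_between. split.
    - rewrite <- (ln_exp (- e)). apply ln_increasing; [apply exp_pos|lra].
    - rewrite <- (ln_exp e). apply ln_increasing; lra. }
  assert (A2 : (Rabs (Im (Clog w)) < e)%R).
  { assert (B := Im_Clog_right_half_plane w Rp).
    assert (Cc : cos (Im (Clog w)) = (Re w / Cmod w)%R) by (apply cos_Carg; auto).
    apply Rnot_le_lt. intros L.
    assert (Ca : cos (Rabs (Im (Clog w))) = (Re w / Cmod w)%R).
    { rewrite <- Cc. unfold Rabs. destruct Rcase_abs; rewrite ?cos_neg; auto. }
    assert (U : (Rabs (Im (Clog w)) < PI / 2)%R) by (apply Rabs_lt_between; lra).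
    assert (K : (cos (Rabs (Im (Clog w))) <= cos e)%R).
    { apply cos_decr_1; lra. }
    rewrite Ca in K. apply Rle_div_l in K; [|lra]. nra. }
  eapply Rle_lt_trans; [apply Cmod_le_Rabs|]. lra.
Qed.

(** The logarithm inverts the exponential: L = Clog w satisfies
    w - 1 = L + o(L), and L is small by continuity, so L = (w - 1) + o(w - 1). *)
Lemma is_Cderive_Clog_1 : is_Cderive Clog 1 1.
Proof.
  apply is_Cderive_eps. intros eps He.
  set (e := Rmin (1 / 2) (eps / 2)).
  assert (Pe : (0 < e)%R) by (apply Rmin_pos; lra).
  assert (E1 : (e <= 1 / 2)%R) by apply Rmin_l.
  assert (E2 : (e <= eps / 2)%R) by apply Rmin_r.
  destruct (proj1 (is_Cderive_eps _ _ _) is_Cderive_Cexp_0 e Pe) as [d1 [Hd1 H1]].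
  destruct (Clog_continuous_1 d1 Hd1) as [d2 [Hd2 H2]].
  exists (Rmin d2 1). split; [apply Rmin_pos; lra|].
  intros w Hw.
  assert (W1 := Rlt_le_trans _ _ _ Hw (Rmin_l _ _)).
  assert (W2 := Rlt_le_trans _ _ _ Hw (Rmin_r _ _)).
  assert (N : w <> 0).
  { intros ->. replace (0 - 1) with (- (1)) in W2 by ring.
    rewrite Cmod_opp, Cmod_1 in W2. lra. }
  specialize (H1 (Clog w)). replace (Clog w - 0) with (Clog w) in H1 by ring.
  specialize (H1 (H2 w W1)).
  rewrite Cexp_Clog, Cexp_0 in H1 by auto. rewrite Clog_1.
  set (L := Clog w) in *.
  assert (K : (Cmod L <= 2 * Cmod (w - 1))%R).
  { assert (T := Cmod_triangle (w - 1) (- (w - 1 - 1 * L))).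
    replace (w - 1 + - (w - 1 - 1 * L)) with L in T by ring.
    rewrite Cmod_opp in T. assert (Q := Cmod_ge_0 L). nra. }
  replace (L - 0 - 1 * (w - 1)) with (- (w - 1 - 1 * L)) by ring.
  rewrite Cmod_opp. assert (Q := Cmod_ge_0 L). nra.
Qed.

(** On the right half-plane Clog w = Clog z + Clog (w / z) for w near z, which
    reduces the claim to the point 1. *)
Lemma is_Cderive_Clog (z : C) : (0 < Re z)%R -> is_Cderive Clog z (/ z).
Proof.
  intros Hz. assert (N := Re_pos_neq_0 z Hz).
  assert (P : (0 < Cmod z)%R) by (apply Cmod_gt_0; auto).
  apply is_Cderive_ext_near with (fun w => Clog z + Clog (/ z * w)) (Cmod z).
  - exact P.
  - intros w Hw. rewrite <- Clog_mult; [f_equal; field; auto|auto|].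
    assert (T : (Cmod (/ z * w - 1) < 1)%R).
    { replace (/ z * w - 1) with ((w - z) / z) by (field; auto).
      rewrite Cmod_div by auto. apply Rlt_div_l; lra. }
    assert (Hr := re_le_Cmod (/ z * w - 1)). unfold Cminus in Hr.
    rewrite re_plus, re_opp in Hr. simpl (Re 1) in Hr.
    apply Rabs_le_between in Hr. unfold Cminus in T. lra.
  - apply is_Cderive_eq with (0 + (/ z * 1) * 1); [ring|].
    apply is_Cderive_plus; [apply is_Cderive_const|].
    apply (is_Cderive_comp Clog (fun w => / z * w)).
    + replace (/ z * z) with (RtoC 1) by (field; auto). apply is_Cderive_Clog_1.
    + apply is_Cderive_scal, is_Cderive_id.
Qed.

Close Scope C_scope.

(** * Goursat's theorem on rectangles *)

Lemma dependent_choice (A : Type) (I : nat -> A -> Prop)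
  (Next : nat -> A -> A -> Prop) (a0 : A) :
  I 0%nat a0 ->
  (forall n a, I n a -> exists b, I (S n) b /\ Next n a b) ->
  exists s : nat -> A, s 0%nat = a0 /\
    forall n, I n (s n) /\ Next n (s n) (s (S n)).
Proof.
  intros H0 HS.
  set (next := fun n (p : {a | I n a}) =>
    constructive_indefinite_description _ (HS n (proj1_sig p) (proj2_sig p))).
  set (t := fix t n : {a | I n a} := match n with
    | O => exist _ a0 H0
    | S n => exist _ (proj1_sig (next n (t n)))
                     (proj1 (proj2_sig (next n (t n))))
    end).
  exists (fun n => proj1_sig (t n)). split; [reflexivity|].
  intros n. split; [exact (proj2_sig (t n))|].
  exact (proj2 (proj2_sig (next n (t n)))).
Qed.

(** The left endpoints increase and the right endpoints x n + w / 2 ^ n decrease,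
    so the supremum of the left endpoints lies in every interval. *)
Lemma nested_halving_point (x : nat -> R) (w : R) :
  (forall n, x n <= x (S n) <= x n + w / 2 ^ S n) ->
  exists l, forall n, x n <= l <= x n + w / 2 ^ n.
Proof.
  intros H.
  assert (H2 : forall n, w / 2 ^ n = 2 * (w / 2 ^ S n)).
  { intros n. assert (P := pow_lt 2 n Rlt_0_2). simpl. field. lra. }
  assert (Hw : forall n, 0 <= w / 2 ^ n).
  { intros n. specialize (H n). specialize (H2 n). lra. }
  assert (Up : forall n k, x n <= x (n + k)%nat /\
             x (n + k)%nat + w / 2 ^ (n + k) <= x n + w / 2 ^ n).
  { intros n k. induction k as [|k IH].
    - rewrite Nat.add_0_r. lra.
    - rewrite Nat.add_succ_r. specialize (H (n + k)%nat).
      specialize (H2 (n + k)%nat). lra. }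
  destruct (completeness (fun r => exists n, r = x n)) as [l [Hl1 Hl2]].
  - exists (x 0%nat + w / 2 ^ 0). intros r [n ->].
    destruct (Up 0%nat n) as [_ U]. simpl in U. specialize (Hw n). simpl. lra.
  - exists (x 0%nat), 0%nat. reflexivity.
  - exists l. intros n. split.
    + apply Hl1. exists n. reflexivity.
    + apply Hl2. intros r [m ->].
      destruct (Nat.le_ge_cases n m) as [L|L].
      * destruct (Up n (m - n)%nat) as [_ U].
        replace (n + (m - n))%nat with m in U by lia. specialize (Hw m). lra.
      * destruct (Up m (n - m)%nat) as [U _].
        replace (m + (n - m))%nat with n in U by lia. specialize (Hw n). lra.
Qed.

(** The integral of P dx + Q dy along the boundary, counterclockwise. *)
Definition rect_integral (P Q : R -> R -> R) (a b c d : R) : R :=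
  RInt (fun x => P x c) a b - RInt (fun x => P x d) a b +
  (RInt (fun y => Q b y) c d - RInt (fun y => Q a y) c d).

(** P dx + Q dy has dP/dy = dQ/dx at the point. The partial derivatives are not
    required to be continuous: this is what lets the theory start from mere
    complex differentiability. *)
Definition closed_form_at (P Q : R -> R -> R) (x y : R) : Prop :=
  exists p k q, differentiable_pt_lim P x y p k /\
                differentiable_pt_lim Q x y k q.

Definition closed_form_on (P Q : R -> R -> R) (a b c d : R) : Prop :=
  forall x y, a <= x <= b -> c <= y <= d -> closed_form_at P Q x y.

Lemma differentiable_continuous_x (P : R -> R -> R) (x y p q : R) :
  differentiable_pt_lim P x y p q -> continuous (fun u => P u y) x.
Proof.
  intros H. apply continuity_pt_filterlim, derivable_continuous_pt.
  exists (p * 1 + q * 0).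
  apply (derivable_pt_lim_comp_2d P (fun u => u) (fun _ => y)); auto.
  - apply derivable_pt_lim_id.
  - apply derivable_pt_lim_const.
Qed.

Lemma differentiable_continuous_y (P : R -> R -> R) (x y p q : R) :
  differentiable_pt_lim P x y p q -> continuous (fun v => P x v) y.
Proof.
  intros H. apply continuity_pt_filterlim, derivable_continuous_pt.
  exists (p * 0 + q * 1).
  apply (derivable_pt_lim_comp_2d P (fun _ => x) (fun v => v)); auto.
  - apply derivable_pt_lim_const.
  - apply derivable_pt_lim_id.
Qed.

Lemma closed_form_ex_RInt_x (P Q : R -> R -> R) (a b c d a' b' y : R) :
  closed_form_on P Q a b c d -> a <= a' -> a' <= b' -> b' <= b -> c <= y <= d ->
  ex_RInt (fun x => P x y) a' b'.
Proof.
  intros H H1 H2 H3 Hy. apply (ex_RInt_continuous (V := R_CompleteNormedModule)).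
  intros x Hx. rewrite Rmin_left, Rmax_right in Hx by auto.
  destruct (H x y) as [p [k [q [HP _]]]]; [lra|lra|].
  apply (differentiable_continuous_x _ _ _ _ _ HP).
Qed.

Lemma closed_form_ex_RInt_y (P Q : R -> R -> R) (a b c d c' d' x : R) :
  closed_form_on P Q a b c d -> c <= c' -> c' <= d' -> d' <= d -> a <= x <= b ->
  ex_RInt (fun y => Q x y) c' d'.
Proof.
  intros H H1 H2 H3 Hx. apply (ex_RInt_continuous (V := R_CompleteNormedModule)).
  intros y Hy. rewrite Rmin_left, Rmax_right in Hy by auto.
  destruct (H x y) as [p [k [q [_ HQ]]]]; [lra|lra|].
  apply (differentiable_continuous_y _ _ _ _ _ HQ).
Qed.

Lemma RInt_Chasles_R (f : R -> R) (a b c : R) :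
  ex_RInt f a b -> ex_RInt f b c -> RInt f a b + RInt f b c = RInt f a c.
Proof. exact (RInt_Chasles f a b c). Qed.

Lemma rect_integral_split (P Q : R -> R -> R) (a b c d m n : R) :
  closed_form_on P Q a b c d -> a <= m <= b -> c <= n <= d ->
  rect_integral P Q a b c d =
  rect_integral P Q a m c n + rect_integral P Q m b c n +
  (rect_integral P Q a m n d + rect_integral P Q m b n d).
Proof.
  intros H Hm Hn.
  assert (HX : forall y, c <= y <= d ->
    RInt (fun x => P x y) a b = RInt (fun x => P x y) a m + RInt (fun x => P x y) m b).
  { intros y Hy. symmetry. apply RInt_Chasles_R;
    apply (closed_form_ex_RInt_x P Q a b c d); auto; lra. }
  assert (HY : forall x, a <= x <= b ->
    RInt (fun y => Q x y) c d = RInt (fun y => Q x y) c n + RInt (fun y => Q x y) n d).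
  { intros x Hx. symmetry. apply RInt_Chasles_R;
    apply (closed_form_ex_RInt_y P Q a b c d); auto; lra. }
  unfold rect_integral.
  rewrite (HX c), (HX d), (HY a), (HY b) by lra. ring.
Qed.

Lemma RInt_near_const (f : R -> R) (a b k e : R) :
  a <= b -> ex_RInt f a b -> (forall x, a <= x <= b -> Rabs (f x - k) <= e) ->
  Rabs (RInt f a b - k * (b - a)) <= e * (b - a).
Proof.
  intros Hab Hf H.
  replace (RInt f a b - k * (b - a)) with (RInt (fun x => f x - k) a b).
  - rewrite Rmult_comm.
    apply (abs_RInt_le_const (fun x => f x - k)); auto.
    apply (ex_RInt_minus (V := R_NormedModule)); auto. apply ex_RInt_const.
  - rewrite (RInt_minus (V := R_CompleteNormedModule) f (fun _ => k));
      [|auto|apply ex_RInt_const].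
    rewrite RInt_const. unfold minus, plus, opp, scal; simpl.
    unfold mult; simpl. ring.
Qed.

(** Over a small rectangle around the point, the linear parts of P and Q
    contribute (dQ/dx - dP/dy) times the area, which is 0; the remainders are
    o(diameter) and are integrated over the perimeter. *)
Lemma rect_integral_small (P Q : R -> R -> R) (x y eps : R) :
  closed_form_at P Q x y -> 0 < eps -> exists delta, 0 < delta /\
  forall a b c d, closed_form_on P Q a b c d ->
    a <= x <= b -> c <= y <= d -> b - a < delta -> d - c < delta ->
    Rabs (rect_integral P Q a b c d) <= eps * ((b - a) + (d - c)) ^ 2.
Proof.
  intros [p [k [q [HP HQ]]]] He.
  assert (He2 : 0 < eps / 2) by lra.
  destruct (HP (mkposreal _ He2)) as [d1 H1].
  destruct (HQ (mkposreal _ He2)) as [d2 H2]. simpl in H1, H2.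
  exists (Rmin d1 d2). split; [apply Rmin_pos; apply cond_pos|].
  intros a b c d H Hx Hy Hab Hcd.
  assert (L1 := Rmin_l d1 d2). assert (L2 := Rmin_r d1 d2).
  set (m := (b - a) + (d - c)).
  assert (B : forall u v, a <= u <= b -> c <= v <= d ->
    Rabs (P u v - P x y - (p * (u - x) + k * (v - y))) <= eps / 2 * m /\
    Rabs (Q u v - Q x y - (k * (u - x) + q * (v - y))) <= eps / 2 * m).
  { intros u v Hu Hv.
    assert (U : Rabs (u - x) <= b - a) by (apply Rabs_le; lra).
    assert (V : Rabs (v - y) <= d - c) by (apply Rabs_le; lra).
    assert (M : Rmax (Rabs (u - x)) (Rabs (v - y)) <= m)
      by (apply Rmax_lub; unfold m; lra).
    split; eapply Rle_trans.
    - apply H1; lra.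
    - apply Rmult_le_compat_l; lra.
    - apply H2; lra.
    - apply Rmult_le_compat_l; lra. }
  assert (EP : forall v, c <= v <= d -> ex_RInt (fun u => P u v) a b)
    by (intros; apply (closed_form_ex_RInt_x P Q a b c d); auto; lra).
  assert (EQ : forall u, a <= u <= b -> ex_RInt (fun v => Q u v) c d)
    by (intros; apply (closed_form_ex_RInt_y P Q a b c d); auto; lra).
  assert (IP : Rabs (RInt (fun u => P u c - P u d) a b - k * (c - d) * (b - a))
               <= eps * m * (b - a)).
  { apply RInt_near_const; [lra| |].
    - apply (ex_RInt_minus (V := R_NormedModule)); apply EP; lra.
    - intros u Hu. destruct (B u c) as [B1 _]; try lra.
      destruct (B u d) as [B2 _]; try lra.
      apply Rabs_le_between in B1. apply Rabs_le_between in B2.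
      apply Rabs_le. lra. }
  assert (IQ : Rabs (RInt (fun v => Q b v - Q a v) c d - k * (b - a) * (d - c))
               <= eps * m * (d - c)).
  { apply RInt_near_const; [lra| |].
    - apply (ex_RInt_minus (V := R_NormedModule)); apply EQ; lra.
    - intros v Hv. destruct (B a v) as [_ B1]; try lra.
      destruct (B b v) as [_ B2]; try lra.
      apply Rabs_le_between in B1. apply Rabs_le_between in B2.
      apply Rabs_le. lra. }
  rewrite (RInt_minus (V := R_CompleteNormedModule) (fun u => P u c)) in IP by (apply EP; lra).
  rewrite (RInt_minus (V := R_CompleteNormedModule) (fun v => Q b v)) in IQ by (apply EQ; lra).
  unfold minus, plus, opp in IP, IQ; simpl in IP, IQ.
  change (RInt (Q a) c d) with (RInt (fun v => Q a v) c d) in IQ.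
  apply Rabs_le_between in IP. apply Rabs_le_between in IQ.
  unfold rect_integral. apply Rabs_le.
  assert (E : eps * m ^ 2 = eps * m * (b - a) + eps * m * (d - c))
    by (unfold m; ring).
  rewrite E. clearbody m. clear E B H1 H2. lra.
Qed.

(** One of the four quarters of a rectangle carries at least a quarter of the
    integral. Quartering again and again leads to a point around which the
    integral over the n-th rectangle is at least |W| / 4^n, while
    [rect_integral_small] bounds it by an arbitrarily small multiple of 1 / 4^n. *)
Theorem goursat (P Q : R -> R -> R) (a b c d : R) :
  a <= b -> c <= d -> closed_form_on P Q a b c d -> rect_integral P Q a b c d = 0.
Proof.
  intros Hab Hcd H.
  set (w := b - a). set (h := d - c).
  set (W := fun (s : R * R) n =>
    rect_integral P Q (fst s) (fst s + w / 2 ^ n) (snd s) (snd s + h / 2 ^ n)).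
  set (I := fun n (s : R * R) =>
    a <= fst s /\ fst s + w / 2 ^ n <= b /\ c <= snd s /\ snd s + h / 2 ^ n <= d /\
    Rabs (rect_integral P Q a b c d) <= 4 ^ n * Rabs (W s n)).
  set (Next := fun n (s t : R * R) =>
    fst s <= fst t <= fst s + w / 2 ^ S n /\ snd s <= snd t <= snd s + h / 2 ^ S n).
  assert (Half : forall r n, r / 2 ^ n = 2 * (r / 2 ^ S n)).
  { intros r n. assert (T := pow_lt 2 n Rlt_0_2). simpl. field. lra. }
  assert (Pos : forall r n, 0 <= r -> 0 <= r / 2 ^ n).
  { intros r n Hr. apply Rdiv_le_0_compat; [auto|]. apply pow_lt, Rlt_0_2. }
  assert (Hw : 0 <= w) by (unfold w; lra).
  assert (Hh : 0 <= h) by (unfold h; lra).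
  destruct (dependent_choice (R * R) I Next (a, c)) as [s [Hs0 Hs]].
  - unfold I, W; simpl. replace (a + w / 1) with b by (unfold w; field).
    replace (c + h / 1) with d by (unfold h; field). lra.
  - intros n [x y] [I1 [I2 [I3 [I4 I5]]]]. unfold W in I5.
    simpl fst in *; simpl snd in *.
    assert (P4 : 0 < 4 ^ n) by (apply pow_lt; lra).
    assert (Pw := Pos w (S n) Hw). assert (Ph := Pos h (S n) Hh).
    rewrite (Half w n) in *. rewrite (Half h n) in *.
    set (w' := w / 2 ^ S n) in *. set (h' := h / 2 ^ S n) in *.
    rewrite (rect_integral_split P Q x (x + 2 * w') y (y + 2 * h') (x + w') (y + h')) in I5;
      [|intros u v Hu Hv; apply H; lra|lra|lra].
    replace (x + 2 * w') with (x + w' + w') in * by ring.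
    replace (y + 2 * h') with (y + h' + h') in * by ring.
    set (W1 := rect_integral P Q x (x + w') y (y + h')) in *.
    set (W2 := rect_integral P Q (x + w') (x + w' + w') y (y + h')) in *.
    set (W3 := rect_integral P Q x (x + w') (y + h') (y + h' + h')) in *.
    set (W4 := rect_integral P Q (x + w') (x + w' + w') (y + h') (y + h' + h')) in *.
    set (W0 := Rabs (rect_integral P Q a b c d)) in *.
    assert (T : Rabs (W1 + W2 + (W3 + W4)) <= Rabs W1 + Rabs W2 + (Rabs W3 + Rabs W4)).
    { eapply Rle_trans; [apply Rabs_triang|].
      apply Rplus_le_compat; apply Rabs_triang. }
    assert (K : W0 <= 4 ^ S n * Rabs W1 \/ W0 <= 4 ^ S n * Rabs W2 \/
                W0 <= 4 ^ S n * Rabs W3 \/ W0 <= 4 ^ S n * Rabs W4).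
    { simpl. destruct (Rle_dec W0 (4 * 4 ^ n * Rabs W1)); auto.
      destruct (Rle_dec W0 (4 * 4 ^ n * Rabs W2)); auto.
      destruct (Rle_dec W0 (4 * 4 ^ n * Rabs W3)); auto.
      destruct (Rle_dec W0 (4 * 4 ^ n * Rabs W4)); auto.
      exfalso. apply (Rmult_le_compat_l (4 ^ n)) in T; lra. }
    unfold I, Next, W; destruct K as [K|[K|[K|K]]];
      [exists (x, y)|exists (x + w', y)|exists (x, y + h')|exists (x + w', y + h')];
      simpl fst; simpl snd; fold w' h'; repeat split; first [lra | exact K].
  - destruct (nested_halving_point (fun n => fst (s n)) w) as [x Hx].
    { intros n. apply (proj1 (proj2 (Hs n))). }
    destruct (nested_halving_point (fun n => snd (s n)) h) as [y Hy].
    { intros n. apply (proj2 (proj2 (Hs n))). }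
    assert (Hxy : a <= x <= b /\ c <= y <= d).
    { assert (X := Hx 0%nat). assert (Y := Hy 0%nat). rewrite Hs0 in X, Y.
      simpl in X, Y. unfold w, h in X, Y. lra. }
    destruct (Req_dec (rect_integral P Q a b c d) 0) as [E|NE]; [exact E|exfalso].
    apply Rabs_pos_lt in NE. set (W0 := Rabs (rect_integral P Q a b c d)) in *.
    set (e := W0 / (2 * ((w + h) ^ 2 + 1))).
    assert (Pe : 0 < e).
    { apply Rdiv_lt_0_compat; [auto|]. assert (0 <= (w + h) ^ 2) by apply pow2_ge_0. lra. }
    destruct (rect_integral_small P Q x y e) as [dl [Pd Hd]]; [apply H; lra|auto|].
    destruct (pow_lt_1_zero (1 / 2)) with (y := dl / (w + h + 1)) as [N HN].
    { rewrite Rabs_right; lra. }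
    { apply Rdiv_lt_0_compat; lra. }
    specialize (HN N (le_n N)).
    rewrite Rabs_right in HN by (apply Rle_ge, pow_le; lra).
    assert (PN := pow_lt 2 N Rlt_0_2).
    assert (E2 : (1 / 2) ^ N = / 2 ^ N).
    { unfold Rdiv. rewrite Rmult_1_l. apply pow_inv. }
    rewrite E2 in HN. apply Rlt_div_r in HN; [|lra].
    destruct (Hs N) as [[I1 [I2 [I3 [I4 I5]]]] _].
    assert (PI := Rinv_0_lt_compat _ PN).
    assert (Sw : w / 2 ^ N < dl) by (unfold Rdiv; nra).
    assert (Sh : h / 2 ^ N < dl) by (unfold Rdiv; nra).
    assert (Pw := Pos w N Hw). assert (Ph := Pos h N Hh).
    specialize (Hx N). specialize (Hy N).
    assert (B : Rabs (W (s N) N) <= e * (w / 2 ^ N + h / 2 ^ N) ^ 2).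
    { unfold W. eapply Rle_trans; [apply Hd; try lra|].
      - intros u v Hu Hv. apply H; lra.
      - apply Req_le. f_equal. f_equal. ring. }
    fold W0 in I5.
    assert (E3 : 4 ^ N * (e * (w / 2 ^ N + h / 2 ^ N) ^ 2) = e * (w + h) ^ 2).
    { replace 4 with (2 * 2) by ring. rewrite Rpow_mult_distr. field. lra. }
    apply (Rmult_le_compat_l (4 ^ N)) in B; [|apply pow_le; lra].
    rewrite E3 in B.
    assert (Q0 : 0 <= (w + h) ^ 2) by apply pow2_ge_0.
    assert (F : e * ((w + h) ^ 2 + 1) = W0 / 2) by (unfold e; field; lra).
    nra.
Qed.

(** * Mean values on circles *)

Lemma is_Cderive_differentiable (f : C -> C) (z l : C) :
  is_Cderive f z l ->
  differentiable_pt_lim (fun x y => Re (f (x, y))) (Re z) (Im z) (Re l) (- Im l) /\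
  differentiable_pt_lim (fun x y => Im (f (x, y))) (Re z) (Im z) (Im l) (Re l).
Proof.
  intros H.
  assert (B : forall eps : posreal, exists delta : posreal, forall u v,
    Rabs (u - Re z) < delta -> Rabs (v - Im z) < delta ->
    (Cmod (f (u, v) - f (Re z, Im z) - l * ((u, v) - (Re z, Im z)))%C <=
     eps * Rmax (Rabs (u - Re z)) (Rabs (v - Im z)))%R).
  { intros eps.
    destruct (proj1 (is_Cderive_eps f z l) H (eps / 2)) as [d [Hd H']].
    { assert (P := cond_pos eps). lra. }
    assert (Hd2 : 0 < d / 2) by lra.
    exists (mkposreal _ Hd2). simpl. intros u v Hu Hv.
    assert (Ez : (Re z, Im z) = z) by (destruct z; reflexivity).
    rewrite Ez.
    assert (N : Cmod ((u, v) - z)%C <= Rabs (u - Re z) + Rabs (v - Im z)).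
    { eapply Rle_trans; [apply Cmod_le_Rabs|]. apply Req_le.
      destruct z; simpl. unfold Rminus. reflexivity. }
    assert (K : Cmod ((u, v) - z)%C < d) by lra.
    specialize (H' (u, v) K). eapply Rle_trans; [exact H'|].
    assert (M1 := Rmax_l (Rabs (u - Re z)) (Rabs (v - Im z))).
    assert (M2 := Rmax_r (Rabs (u - Re z)) (Rabs (v - Im z))).
    assert (P := cond_pos eps). nra. }
  split; intros eps; destruct (B eps) as [d Hd]; exists d; intros u v Hu Hv;
  specialize (Hd u v Hu Hv); eapply Rle_trans.
  2, 4: exact Hd.
  - eapply Rle_trans; [|apply re_le_Cmod]. apply Req_le. f_equal. unfold Re, Im; simpl; ring.
  - eapply Rle_trans; [|apply im_le_Cmod]. apply Req_le. f_equal. unfold Re, Im; simpl; ring.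
Qed.

(** The imaginary part of f(z) dz is Im f dx + Re f dy; the Cauchy-Riemann
    equations say that it is closed. Its integral over a vertical side is that of
    Re f, which is the quantity wanted on circles. *)
Lemma is_Cderive_closed_form (f : C -> C) (x y : R) (l : C) :
  is_Cderive f (x, y) l ->
  closed_form_at (fun x y => Im (f (x, y))) (fun x y => Re (f (x, y))) x y.
Proof.
  intros H. destruct (is_Cderive_differentiable f (x, y) l H) as [H1 H2].
  exists (Im l), (Re l), (- Im l). split; [exact H2|exact H1].
Qed.

Definition polar (r t : R) : C := (r * cos t, r * sin t).

Lemma Cmod_polar (r t : R) : 0 <= r -> Cmod (polar r t) = r.
Proof.
  intros H. apply Rsqr_inj; [apply Cmod_ge_0|auto|].
  rewrite !Rsqr_pow2, Cmod2_alt. unfold polar; simpl.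
  assert (T := sin2_cos2 t). unfold Rsqr in T. nra.
Qed.

Lemma polar_Cexp (r t : R) : 0 < r -> polar r t = Cexp (ln r, t).
Proof.
  intros H. unfold polar, Cexp; simpl. rewrite exp_ln by auto. reflexivity.
Qed.

(** The function g (exp w) is holomorphic on a half-plane and 2 pi i-periodic. On
    the rectangle between Re w = s and Re w = ln r, of height 2 pi, the two
    horizontal sides cancel, so by Goursat's theorem the mean of g over a circle
    does not depend on the radius; it tends to l as s tends to minus infinity. The
    origin is never reached, so nothing beyond the limit is asked of g there. *)
Theorem mean_value_punctured (g : C -> C) (r0 r : R) (l : C) :
  0 < r < r0 ->
  (forall z : C, z <> 0%C -> Cmod z < r0 -> exists l', is_Cderive g z l') ->
  (forall eps, 0 < eps -> exists d, 0 < d /\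
     forall z : C, z <> 0%C -> Cmod z < d -> Cmod (g z - l)%C < eps) ->
  is_RInt (fun t => Re (g (polar r t))) 0 (2 * PI) (2 * PI * Re l).
Proof.
  intros Hr Hg Hl.
  assert (PP := PI_RGT_0).
  set (h := fun w => g (Cexp w)).
  set (U := fun s t => Re (h (s, t))). set (V := fun s t => Im (h (s, t))).
  assert (CF : forall s t, s <= ln r -> closed_form_at V U s t).
  { intros s t Hs.
    destruct (Hg (Cexp (s, t))) as [l' Hl'].
    - apply Cexp_neq_0.
    - rewrite Cmod_Cexp. simpl. apply Rle_lt_trans with r; [|lra].
      rewrite <- (exp_ln r) by lra. destruct Hs as [Hs| ->]; [|lra].
      apply Rlt_le, exp_increasing; auto.
    - apply is_Cderive_closed_form with (Cexp (s, t) * l')%C.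
      apply (is_Cderive_comp g Cexp); [exact Hl'|apply is_Cderive_Cexp]. }
  assert (EX : forall s, s <= ln r -> ex_RInt (fun t => U s t) 0 (2 * PI)).
  { intros s Hs.
    apply (closed_form_ex_RInt_y V U s s 0 (2 * PI)); try lra.
    intros x y Hx _. apply CF. lra. }
  assert (Cst : forall s, s <= ln r ->
    RInt (fun t => U s t) 0 (2 * PI) = RInt (fun t => U (ln r) t) 0 (2 * PI)).
  { intros s Hs.
    assert (G : rect_integral V U s (ln r) 0 (2 * PI) = 0).
    { apply goursat; [auto|lra|]. intros x y Hx _. apply CF. lra. }
    unfold rect_integral in G.
    assert (E : RInt (fun x => V x (2 * PI)) s (ln r) = RInt (fun x => V x 0) s (ln r)).
    { apply RInt_ext. intros x _. unfold V, h. f_equal. f_equal.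
      unfold Cexp; simpl. rewrite cos_2PI, sin_2PI, cos_0, sin_0. reflexivity. }
    rewrite E in G. lra. }
  assert (Lim : RInt (fun t => U (ln r) t) 0 (2 * PI) = Re l * (2 * PI - 0)).
  { apply cond_eq. intros eps He.
    destruct (Hl (eps / (4 * PI))) as [d [Hd Hd']].
    { apply Rdiv_lt_0_compat; lra. }
    set (s := Rmin (ln r) (ln (d / 2))).
    assert (Hs : s <= ln r) by apply Rmin_l.
    rewrite <- (Cst s Hs).
    apply Rle_lt_trans with (eps / (4 * PI) * (2 * PI - 0)).
    - apply RInt_near_const; [lra|apply EX; auto|].
      intros t _. unfold U, h.
      replace (Re (g (Cexp (s, t))) - Re l) with (Re (g (Cexp (s, t)) - l)%C)
        by (unfold Cminus; rewrite re_plus, re_opp; reflexivity).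
      eapply Rle_trans; [apply re_le_Cmod|]. apply Rlt_le, Hd'.
      + apply Cexp_neq_0.
      + rewrite Cmod_Cexp. simpl.
        apply Rle_lt_trans with (d / 2); [|lra].
        rewrite <- (exp_ln (d / 2)) by lra.
        destruct (Rmin_r (ln r) (ln (d / 2))) as [K|K]; fold s in K.
        * apply Rlt_le, exp_increasing; auto.
        * rewrite K; lra.
    - replace (eps / (4 * PI) * (2 * PI - 0)) with (eps / 2) by (field; lra). lra. }
  replace (2 * PI * Re l) with (Re l * (2 * PI - 0)) by ring.
  rewrite <- Lim.
  apply is_RInt_ext with (fun t => U (ln r) t).
  - intros t _. unfold U, h. rewrite polar_Cexp by lra. reflexivity.
  - apply (RInt_correct (V := R_CompleteNormedModule)), EX. lra.
Qed.

(** Compactness of the closed disc, as a Lebesgue number: if each point u of the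
    disc has a radius d good for it, then there is a single d such that every z of
    the disc is within a good radius at least d of some u. *)
Lemma closed_disc_lebesgue (r : R) (N : C -> R -> Prop) :
  (forall u : C, Cmod u <= r -> exists d, 0 < d /\ N u d) ->
  exists d, 0 < d /\ forall z : C, Cmod z <= r ->
    exists u d', Cmod u <= r /\ N u d' /\ d <= d' /\ Cmod (z - u)%C < d'.
Proof.
  intros H.
  (* Compactness is applied to a square containing the disc. A point outside the
     disc receives half its distance to the disc, so that its neighbourhood misses
     the disc. *)
  assert (H' : forall u : C, exists d : posreal,
    (Cmod u <= r -> N u d) /\ (r < Cmod u -> 2 * d = Cmod u - r)).
  { intros u. destruct (Rle_lt_dec (Cmod u) r) as [L|L].
    - destruct (H u L) as [d [Hd Hn]]. exists (mkposreal d Hd).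
      split; [auto|lra].
    - assert (Hd : 0 < (Cmod u - r) / 2) by lra.
      exists (mkposreal _ Hd). simpl. split; [lra|intros; field]. }
  set (dl := fun u => proj1_sig (constructive_indefinite_description _ (H' u))).
  assert (Hdl : forall u : C,
    (Cmod u <= r -> N u (dl u)) /\ (r < Cmod u -> 2 * dl u = Cmod u - r)).
  { intros u. unfold dl. destruct constructive_indefinite_description. auto. }
  clearbody dl.
  destruct (compactness_value_2d (- r) r (- r) r
    (fun x y => pos_div_2 (dl (x, y)))) as [d Hd].
  exists d. split; [apply cond_pos|].
  intros z Hz.
  assert (Zr := re_le_Cmod z). assert (Zi := im_le_Cmod z).
  apply Rabs_le_between in Zr. apply Rabs_le_between in Zi.
  assert (K := Hd (Re z) (Im z)). apply NNPP in K; [|lra|lra].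
  destruct K as [x [y [_ [_ [K1 [K2 K3]]]]]]. simpl in K1, K2, K3.
  exists (x, y), (dl (x, y)).
  assert (D : Cmod (z - (x, y))%C < dl (x, y)).
  { eapply Rle_lt_trans; [apply Cmod_le_Rabs|].
    replace (Re (z - (x, y))%C) with (Re z - x) by (unfold Re; simpl; ring).
    replace (Im (z - (x, y))%C) with (Im z - y) by (unfold Im; simpl; ring).
    lra. }
  destruct (Hdl (x, y)) as [A1 A2].
  destruct (Rle_lt_dec (Cmod (x, y)) r) as [L|L].
  - repeat split; auto. assert (P := cond_pos (dl (x, y))). lra.
  - exfalso. specialize (A2 L).
    assert (T := Cmod_triangle z ((x, y) - z)%C).
    replace (z + ((x, y) - z))%C with (x, y) in T by (apply C_ext; unfold Re, Im; simpl; ring).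
    replace ((x, y) - z)%C with (- (z - (x, y)))%C in T by ring.
    rewrite Cmod_opp in T.
    assert (P := cond_pos (dl (x, y))).
    assert (D' : Cmod (z - (x, y))%C <= Rabs (Re z - x) + Rabs (Im z - y)).
    { eapply Rle_trans; [apply Cmod_le_Rabs|]. apply Req_le.
      unfold Re, Im; simpl. reflexivity. }
    lra.
Qed.

Lemma closed_disc_bounded (f : C -> C) (r : R) :
  (forall u : C, Cmod u <= r -> exists l, is_Cderive f u l) ->
  exists M, 0 < M /\ forall z, Cmod z <= r -> Cmod (f z) <= M.
Proof.
  intros H.
  destruct (closed_disc_lebesgue r (fun u d =>
    (forall z, Cmod (z - u)%C < d -> Cmod (f z - f u)%C < 1) /\
    d * (Cmod (f u) + 1) <= 1)) as [d [Hd K]].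
  - intros u Hu. destruct (H u Hu) as [l Hl].
    destruct (is_Cderive_continuous f u l Hl 1 Rlt_0_1) as [d [Hd H']].
    assert (P := Cmod_ge_0 (f u)).
    assert (Q : 0 < / (Cmod (f u) + 1)) by (apply Rinv_0_lt_compat; lra).
    exists (Rmin d (/ (Cmod (f u) + 1))). split; [apply Rmin_pos; auto|].
    split.
    + intros z Hz. apply H'. apply (Rlt_le_trans _ _ _ Hz (Rmin_l _ _)).
    + apply Rle_trans with (/ (Cmod (f u) + 1) * (Cmod (f u) + 1));
        [|rewrite Rinv_l; lra].
      apply Rmult_le_compat_r; [lra|apply Rmin_r].
  - exists (/ d). split; [apply Rinv_0_lt_compat; auto|].
    intros z Hz. destruct (K z Hz) as [u [d' [Hu [[K1 K2] [K3 K4]]]]].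
    specialize (K1 z K4).
    assert (P := Cmod_ge_0 (f u)).
    assert (T : Cmod (f z) <= Cmod (f u) + 1).
    { replace (f z) with (f u + (f z - f u))%C by ring.
      eapply Rle_trans; [apply Cmod_triangle|]. lra. }
    eapply Rle_trans; [exact T|].
    apply Rmult_le_reg_l with d; [auto|]. rewrite Rinv_r by lra. nra.
Qed.

(** A is the mean of q over [0, 2 pi]. The complex mean is tested by the real
    integrals of Re (c q); multiplying by a unimodular c turns an estimate of |A|
    into an estimate of one real integral. *)
Definition circle_mean (q : R -> C) (A : C) : Prop :=
  forall c : C, is_RInt (fun t => Re (c * q t)%C) 0 (2 * PI) (2 * PI * Re (c * A)%C).

Lemma circle_mean_minus (q q' : R -> C) (A A' : C) :
  circle_mean q A -> circle_mean q' A' ->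
  circle_mean (fun t => q t - q' t)%C (A - A')%C.
Proof.
  intros H H' c.
  replace (2 * PI * Re (c * (A - A'))%C) with
    (minus (2 * PI * Re (c * A)%C) (2 * PI * Re (c * A')%C))
    by (unfold minus, plus, opp, Re; simpl; ring).
  apply is_RInt_ext with (fun t => minus (Re (c * q t)%C) (Re (c * q' t)%C)).
  - intros t _. unfold minus, plus, opp, Re; simpl. ring.
  - apply (is_RInt_minus (V := R_NormedModule)); auto.
Qed.

Lemma circle_mean_scal (k : C) (q : R -> C) (A : C) :
  circle_mean q A -> circle_mean (fun t => k * q t)%C (k * A)%C.
Proof.
  intros H c. rewrite Cmult_assoc.
  apply is_RInt_ext with (fun t => Re (c * k * q t)%C); [|apply H].
  intros t _. rewrite Cmult_assoc. reflexivity.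
Qed.

Lemma Cmod_le_of_Re (A : C) (B : R) :
  0 <= B -> (forall c, Cmod c = 1 -> Re (c * A)%C <= B) -> Cmod A <= B.
Proof.
  intros HB H. destruct (Ceq_dec A 0) as [->|N].
  - rewrite Cmod_0. auto.
  - assert (P : 0 < Cmod A) by (apply Cmod_gt_0; auto).
    assert (NR : RtoC (Cmod A) <> 0%C) by (intros E; apply RtoC_inj in E; lra).
    specialize (H (Cconj A / Cmod A)%C).
    replace (Re (Cconj A / Cmod A * A)%C) with (Cmod A) in H.
    + apply H. rewrite Cmod_div, Cmod_conj, Cmod_R, Rabs_right by (auto; lra).
      field; lra.
    + replace (Cconj A / Cmod A * A)%C with (RtoC (Cmod A)); [reflexivity|].
      replace (Cconj A / Cmod A * A)%C with (A * Cconj A / Cmod A)%C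
        by (field; auto).
      rewrite <- Cmod2_conj. rewrite RtoC_pow. field; auto.
Qed.

Lemma circle_mean_le (q : R -> C) (A : C) (B : R) :
  circle_mean q A -> (forall t, Cmod (q t) <= B) -> Cmod A <= B.
Proof.
  intros H HB. assert (PP := PI_RGT_0).
  apply Cmod_le_of_Re.
  - eapply Rle_trans; [apply Cmod_ge_0|apply (HB 0)].
  - intros c Hc.
    apply Rmult_le_reg_l with (2 * PI); [lra|].
    replace (2 * PI * B) with (B * (2 * PI - 0)) by ring.
    apply (is_RInt_le (fun t => Re (c * q t)%C) (fun _ => B) 0 (2 * PI)).
    + lra.
    + apply H.
    + replace (B * (2 * PI - 0)) with (scal (2 * PI - 0) B)
        by (unfold scal; simpl; unfold mult; simpl; ring).
      apply (is_RInt_const (V := R_NormedModule)).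
    + intros t _. eapply Rle_trans; [apply Rle_abs|].
      eapply Rle_trans; [apply re_le_Cmod|].
      rewrite Cmod_mult, Hc, Rmult_1_l. apply HB.
Qed.

Lemma circle_mean_exists (q : R -> C) :
  (forall t, continuous (fun s => Re (q s)) t) ->
  (forall t, continuous (fun s => Im (q s)) t) ->
  exists A, circle_mean q A.
Proof.
  intros Hr Hi. assert (PP := PI_RGT_0).
  assert (Er : ex_RInt (fun s => Re (q s)) 0 (2 * PI))
    by (apply (ex_RInt_continuous (V := R_CompleteNormedModule)); auto).
  assert (Ei : ex_RInt (fun s => Im (q s)) 0 (2 * PI))
    by (apply (ex_RInt_continuous (V := R_CompleteNormedModule)); auto).
  destruct Er as [a Ha]. destruct Ei as [b Hb].
  exists (a / (2 * PI), b / (2 * PI))%R. intros c.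
  replace (2 * PI * Re (c * (a / (2 * PI), b / (2 * PI))%R)%C)
    with (minus (scal (Re c) a) (scal (Im c) b)).
  - apply is_RInt_ext with
      (fun t => minus (scal (Re c) (Re (q t))) (scal (Im c) (Im (q t)))).
    + intros t _. rewrite re_mult. reflexivity.
    + apply (is_RInt_minus (V := R_NormedModule));
      apply (is_RInt_scal (V := R_NormedModule)); auto.
  - rewrite re_mult. unfold minus, plus, opp, scal; simpl. unfold mult; simpl.
    field. lra.
Qed.

Lemma circle_mean_punctured (g : C -> C) (r0 r : R) (l : C) :
  0 < r < r0 ->
  (forall z : C, z <> 0%C -> Cmod z < r0 -> exists l', is_Cderive g z l') ->
  (forall eps, 0 < eps -> exists d, 0 < d /\
     forall z : C, z <> 0%C -> Cmod z < d -> Cmod (g z - l)%C < eps) ->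
  circle_mean (fun t => g (polar r t)) l.
Proof.
  intros Hr Hg Hl c.
  apply (mean_value_punctured (fun z => c * g z)%C r0); auto.
  - intros z N Hz. destruct (Hg z N Hz) as [l' H']. exists (c * l')%C.
    apply is_Cderive_scal; auto.
  - intros eps He. assert (P := Cmod_ge_0 c).
    destruct (Hl (eps / (Cmod c + 1))) as [d [Hd H']].
    { apply Rdiv_lt_0_compat; lra. }
    exists d. split; [auto|]. intros z N Hz.
    replace (c * g z - c * l)%C with (c * (g z - l))%C by ring.
    rewrite Cmod_mult. specialize (H' z N Hz).
    apply Rle_lt_trans with ((Cmod c) * (eps / (Cmod c + 1))).
    + apply Rmult_le_compat_l; lra.
    + replace eps with ((Cmod c + 1) * (eps / (Cmod c + 1))) at 2 by (field; lra).
      apply Rmult_lt_compat_r; [|lra]. apply Rdiv_lt_0_compat; lra.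
Qed.

(** The difference quotient at z is holomorphic off z and tends to l there, so l
    is its mean over circles around z. *)
Lemma Cauchy_derivative (f : C -> C) (z l : C) (r0 r : R) :
  0 < r < r0 ->
  (forall w : C, Cmod (w - z)%C < r0 -> exists l', is_Cderive f w l') ->
  is_Cderive f z l ->
  circle_mean (fun t => (f (z + polar r t) - f z) / polar r t)%C l.
Proof.
  intros Hr Hf Hl.
  apply (circle_mean_punctured (fun p => (f (z + p) - f z) / p)%C r0); auto.
  - intros p N Hp. destruct (Hf (z + p)%C) as [l' Hl'].
    { replace (z + p - z)%C with p by ring. auto. }
    eexists. apply is_Cderive_div; [auto| |apply is_Cderive_id].
    apply is_Cderive_minus; [|apply is_Cderive_const].
    apply (is_Cderive_comp f (fun p => z + p)%C); [exact Hl'|].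
    apply is_Cderive_plus; [apply is_Cderive_const|apply is_Cderive_id].
  - intros eps He.
    destruct (proj1 (is_Cderive_eps f z l) Hl (eps / 2)) as [d [Hd H]]; [lra|].
    exists d. split; [auto|]. intros p N Hp.
    specialize (H (z + p)%C). replace (z + p - z)%C with p in H by ring.
    specialize (H Hp).
    replace ((f (z + p) - f z) / p - l)%C with ((f (z + p) - f z - l * p) / p)%C
      by (field; auto).
    assert (P : 0 < Cmod p) by (apply Cmod_gt_0; auto).
    rewrite Cmod_div by auto. apply Rle_lt_trans with (eps / 2); [|lra].
    apply Rle_div_l; auto.
Qed.

Lemma is_Cderive_line (f : C -> C) (z v l : C) (s : R) :
  is_Cderive f (z + s * v)%C l ->
  is_derive (fun s : R => Re (f (z + s * v)%C)) s (Re (l * v)%C).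
Proof.
  intros H. apply is_derive_Reals.
  destruct (is_Cderive_differentiable _ _ _ H) as [H1 _].
  assert (K := derivable_pt_lim_comp_2d (fun x y => Re (f (x, y)))
    (fun s => Re z + s * Re v) (fun s => Im z + s * Im v) s
    (Re l) (- Im l) (Re v) (Im v)).
  rewrite re_mult.
  replace (Re l * Re v - Im l * Im v) with (Re l * Re v + - Im l * Im v) by ring.
  assert (E : forall s : R, (Re z + s * Re v, Im z + s * Im v) = (z + s * v)%C).
  { intros t. destruct z, v. apply C_ext; simpl; ring. }
  assert (L : forall a b : R, derivable_pt_lim (fun s => a + s * b) s b).
  { intros a b. apply is_derive_Reals. auto_derive; [auto|ring]. }
  apply is_derive_Reals.
  apply (is_derive_ext (fun s => Re (f (Re z + s * Re v, Im z + s * Im v)))).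
  - intros t. rewrite E. reflexivity.
  - apply is_derive_Reals. apply K; auto.
    replace (Re z + s * Re v) with (Re (z + s * v)%C) by (rewrite <- E; reflexivity).
    replace (Im z + s * Im v) with (Im (z + s * v)%C) by (rewrite <- E; reflexivity).
    exact H1.
Qed.

Lemma Re_mean_value (f f' : C -> C) (z w : C) :
  (forall s : R, 0 <= s <= 1 -> is_Cderive f (z + s * (w - z))%C (f' (z + s * (w - z))%C)) ->
  exists s, 0 <= s <= 1 /\
    Re (f w - f z)%C = Re (f' (z + s * (w - z)) * (w - z))%C.
Proof.
  intros H.
  destruct (MVT_gen (fun s : R => Re (f (z + s * (w - z))%C)) 0 1
    (fun s => Re (f' (z + s * (w - z)) * (w - z))%C)) as [s [Hs E]].
  - intros s. rewrite Rmin_left, Rmax_right by lra. intros Hs.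
    apply is_Cderive_line. apply H; lra.
  - intros s. rewrite Rmin_left, Rmax_right by lra. intros Hs.
    apply continuity_pt_filterlim.
    apply (ex_derive_continuous (V := R_NormedModule)).
    eexists. apply is_Cderive_line. apply H; lra.
  - rewrite Rmin_left, Rmax_right in Hs by lra.
    exists s. split; [auto|].
    replace (z + 1 * (w - z))%C with w in E by ring.
    replace (z + 0 * (w - z))%C with z in E by ring.
    unfold Cminus at 1. rewrite re_plus, re_opp. unfold Rminus in E. lra.
Qed.

Lemma mean_value_inequality (f f' : C -> C) (z w : C) (B : R) :
  (forall s : R, 0 <= s <= 1 -> is_Cderive f (z + s * (w - z))%C (f' (z + s * (w - z))%C)) ->
  (forall s : R, 0 <= s <= 1 -> Cmod (f' (z + s * (w - z)))%C <= B) ->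
  Cmod (f w - f z)%C <= B * Cmod (w - z)%C.
Proof.
  intros H HB.
  assert (B0 : 0 <= B).
  { eapply Rle_trans; [apply Cmod_ge_0|apply (HB 0); lra]. }
  apply Cmod_le_of_Re.
  - apply Rmult_le_pos; auto using Cmod_ge_0.
  - intros c Hc.
    destruct (Re_mean_value (fun u => c * f u)%C (fun u => c * f' u)%C z w) as [s [Hs E]].
    + intros s Hs. apply is_Cderive_scal, H; auto.
    + replace (c * (f w - f z))%C with (c * f w - c * f z)%C by ring.
      rewrite E. eapply Rle_trans; [apply Rle_abs|].
      eapply Rle_trans; [apply re_le_Cmod|].
      rewrite !Cmod_mult, Hc, Rmult_1_l.
      apply Rmult_le_compat_r; auto using Cmod_ge_0.
Qed.

Lemma segment_in_ball (z0 z w : C) (r s : R) :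
  0 <= s <= 1 -> Cmod (z - z0)%C <= r -> Cmod (w - z0)%C <= r ->
  Cmod (z + s * (w - z) - z0)%C <= r.
Proof.
  intros Hs Hz Hw.
  replace (z + s * (w - z) - z0)%C with
    (RtoC (1 - s) * (z - z0) + RtoC s * (w - z0))%C by (rewrite RtoC_minus; ring).
  eapply Rle_trans; [apply Cmod_triangle|].
  rewrite !Cmod_mult, !Cmod_R, !Rabs_right by lra. nra.
Qed.

(** * The derivative of a holomorphic function is holomorphic *)

Lemma Cmod_lipschitz_continuous (q : R -> C) (K : R) :
  (forall s t, Cmod (q s - q t)%C <= K * Rabs (s - t)) ->
  (forall t, continuous (fun s => Re (q s)) t) /\
  (forall t, continuous (fun s => Im (q s)) t).
Proof.
  intros H.
  assert (HK : 0 <= K).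
  { specialize (H 1 0). assert (P := Cmod_ge_0 (q 1 - q 0)%C).
    rewrite Rminus_0_r, Rabs_R1 in H. lra. }
  assert (G : forall u : R -> R, (forall s t, Rabs (u s - u t) <= K * Rabs (s - t)) ->
    forall t, continuous u t).
  { intros u Hu t. apply continuity_pt_filterlim.
    intros eps He. exists (eps / (K + 1)). split; [apply Rdiv_lt_0_compat; lra|].
    intros s [_ Hs]. simpl in *. unfold R_dist in *.
    eapply Rle_lt_trans; [apply Hu|].
    apply Rle_lt_trans with ((K + 1) * Rabs (s - t)).
    - apply Rmult_le_compat_r; [apply Rabs_pos|lra].
    - replace eps with ((K + 1) * (eps / (K + 1))) by (field; lra).
      apply Rmult_lt_compat_l; lra. }
  split; apply G; intros s t; eapply Rle_trans; try apply (H s t).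
  - eapply Rle_trans; [|apply re_le_Cmod]. apply Req_le.
    f_equal; unfold Re; simpl; ring.
  - eapply Rle_trans; [|apply im_le_Cmod]. apply Req_le.
    f_equal; unfold Im; simpl; ring.
Qed.

Lemma polar_lipschitz (r s t : R) :
  0 <= r -> Cmod (polar r s - polar r t)%C <= 2 * r * Rabs (s - t).
Proof.
  intros Hr.
  assert (Ls : Rabs (sin s - sin t) <= Rabs (s - t)).
  { destruct (MVT_gen sin t s cos) as [c [_ E]].
    - intros; apply is_derive_Reals, derivable_pt_lim_sin.
    - intros; apply continuity_sin.
    - rewrite E, Rabs_mult. assert (B := COS_bound c).
      assert (Rabs (cos c) <= 1) by (apply Rabs_le; lra).
      assert (P := Rabs_pos (s - t)). nra. }
  assert (Lc : Rabs (cos s - cos t) <= Rabs (s - t)).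
  { destruct (MVT_gen cos t s (fun x => - sin x)) as [c [_ E]].
    - intros; apply is_derive_Reals, derivable_pt_lim_cos.
    - intros; apply continuity_cos.
    - rewrite E, Rabs_mult. assert (B := SIN_bound c).
      assert (Rabs (- sin c) <= 1) by (apply Rabs_le; lra).
      assert (P := Rabs_pos (s - t)). nra. }
  eapply Rle_trans; [apply Cmod_le_Rabs|].
  replace (Re (polar r s - polar r t)%C) with (r * (cos s - cos t))
    by (unfold polar, Re; simpl; ring).
  replace (Im (polar r s - polar r t)%C) with (r * (sin s - sin t))
    by (unfold polar, Im; simpl; ring).
  rewrite !Rabs_mult, (Rabs_right r) by lra. nra.
Qed.

Lemma polar_neq_0 (r t : R) : 0 < r -> polar r t <> 0%C.
Proof. intros H. apply Cmod_gt_0. rewrite Cmod_polar; lra. Qed.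

(** Cauchy's formula writes f' as a mean of values of f over circles of a fixed
    radius, so every bound for f gives one for f' on a smaller disc: f is bounded,
    hence f' is bounded, hence f is Lipschitz, hence f' is Lipschitz, hence the
    first order remainder of f is quadratic. Inserting that remainder in Cauchy's
    formula differentiates f'. *)
Theorem derivative_holomorphic (f : C -> C) :
  holomorphic f -> holomorphic (C_derive f).
Proof.
  intros Hf z0 Hz0.
  set (f' := C_derive f).
  set (r := (1 - Cmod z0) / 5).
  assert (Hr : 0 < r) by (unfold disk in Hz0; unfold r; lra).
  assert (Hd : forall z, Cmod (z - z0)%C <= 4 * r -> is_Cderive f z (f' z)).
  { intros z Hz. apply ex_Cderive_C_derive, Hf. unfold disk.
    replace z with (z0 + (z - z0))%C by ring.
    eapply Rle_lt_trans; [apply Cmod_triangle|]. unfold r in *. lra. }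
  assert (Z0 : Cmod (z0 - z0)%C = 0) by (replace (z0 - z0)%C with (RtoC 0) by ring; apply Cmod_0).
  assert (Shift : forall z p : C, Cmod (z + p - z0)%C <= Cmod (z - z0)%C + Cmod p).
  { intros z p. replace (z + p - z0)%C with ((z - z0) + p)%C by ring.
    apply Cmod_triangle. }
  clearbody r.
  assert (Pol : forall t, Cmod (polar r t) = r) by (intros; apply Cmod_polar; lra).
  assert (PolN : forall t, polar r t <> 0%C) by (intros; apply polar_neq_0; auto).
  (* Each use of Cauchy's formula costs a circle of radius r; 5 r is the distance
     to the unit circle. *)
  destruct (closed_disc_bounded (fun p => f (z0 + p)%C) (4 * r)) as [M [HM BM]].
  { intros u Hu. exists (f' (z0 + u) * 1)%C. rewrite Cmult_comm.
    apply (is_Cderive_comp f (fun p => z0 + p)%C).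
    - apply Hd. eapply Rle_trans; [apply Shift|]. lra.
    - replace (RtoC 1) with (0 + 1)%C by ring.
      apply is_Cderive_plus; [apply is_Cderive_const|apply is_Cderive_id]. }
  assert (B0 : forall z, Cmod (z - z0)%C <= 4 * r -> Cmod (f z) <= M).
  { intros z Hz. replace z with (z0 + (z - z0))%C by ring. apply BM; auto. }
  assert (Cau : forall z, Cmod (z - z0)%C <= 2.9 * r ->
    circle_mean (fun t => (f (z + polar r t) - f z) / polar r t)%C (f' z)).
  { intros z Hz. apply Cauchy_derivative with (1.1 * r); [lra| |apply Hd; lra].
    intros w Hw. exists (f' w). apply Hd.
    replace w with (z + (w - z))%C by ring.
    eapply Rle_trans; [apply Shift|]. lra. }
  set (M1 := 2 * M / r).
  assert (HM1 : 0 < M1) by (apply Rdiv_lt_0_compat; lra).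
  assert (B1 : forall z, Cmod (z - z0)%C <= 2.9 * r -> Cmod (f' z) <= M1).
  { intros z Hz. apply circle_mean_le with (1 := Cau z Hz). intros t.
    rewrite Cmod_div, Pol by auto. unfold M1.
    apply Rmult_le_compat_r; [apply Rlt_le, Rinv_0_lt_compat; auto|].
    unfold Cminus. eapply Rle_trans; [apply Cmod_triangle|]. rewrite Cmod_opp.
    assert (Cmod (f (z + polar r t))%C <= M).
    { apply B0. eapply Rle_trans; [apply Shift|]. rewrite Pol. lra. }
    assert (Cmod (f z) <= M) by (apply B0; lra). lra. }
  assert (L0 : forall z w, Cmod (z - z0)%C <= 2.9 * r -> Cmod (w - z0)%C <= 2.9 * r ->
    Cmod (f w - f z)%C <= M1 * Cmod (w - z)%C).
  { intros z w Hz Hw. apply (mean_value_inequality f f').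
    - intros s Hs. apply Hd.
      apply Rle_trans with (2.9 * r); [apply segment_in_ball; auto|lra].
    - intros s Hs. apply B1. apply segment_in_ball; auto. }
  set (M2 := 2 * M1 / r).
  assert (HM2 : 0 < M2) by (apply Rdiv_lt_0_compat; lra).
  assert (L1 : forall z w, Cmod (z - z0)%C <= 1.9 * r -> Cmod (w - z0)%C <= 1.9 * r ->
    Cmod (f' w - f' z)%C <= M2 * Cmod (w - z)%C).
  { intros z w Hz Hw.
    apply circle_mean_le with
      (fun t => (f (w + polar r t) - f w) / polar r t -
                (f (z + polar r t) - f z) / polar r t)%C.
    - apply circle_mean_minus; apply Cau; lra.
    - intros t.
      replace ((f (w + polar r t) - f w) / polar r t -
               (f (z + polar r t) - f z) / polar r t)%C
        with (((f (w + polar r t) - f (z + polar r t)) + - (f w - f z)) / polar r t)%C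
        by (field; auto).
      rewrite Cmod_div, Pol by auto.
      apply Rle_div_l; [auto|].
      eapply Rle_trans; [apply Cmod_triangle|]. rewrite Cmod_opp.
      assert (A1 : Cmod (f (w + polar r t) - f (z + polar r t))%C <= M1 * Cmod (w - z)%C).
      { replace (w - z)%C with ((w + polar r t) - (z + polar r t))%C by ring.
        apply L0; (eapply Rle_trans; [apply Shift|]; rewrite Pol; lra). }
      assert (A2 : Cmod (f w - f z)%C <= M1 * Cmod (w - z)%C) by (apply L0; lra).
      unfold M2. field_simplify; [|lra]. lra. }
  assert (E2 : forall z h, Cmod (z - z0)%C <= 1.5 * r -> Cmod h <= 0.4 * r ->
    Cmod (f (z + h) - f z - h * f' z)%C <= M2 * Cmod h ^ 2).
  { intros z h Hz Hh.
    assert (V := mean_value_inequality (fun w => f w - f' z * w)%C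
      (fun w => f' w - f' z * 1)%C z (z + h)%C (M2 * Cmod h)).
    replace (z + h - z)%C with h in V by ring.
    replace (f (z + h) - f' z * (z + h) - (f z - f' z * z))%C with
      (f (z + h) - f z - h * f' z)%C in V by ring.
    replace (M2 * Cmod h ^ 2) with (M2 * Cmod h * Cmod h) by ring.
    assert (Sh : forall s : R, 0 <= s <= 1 -> Cmod (s * h)%C <= Cmod h).
    { intros s Hs. rewrite Cmod_mult, Cmod_R, Rabs_right by lra.
      assert (P := Cmod_ge_0 h). nra. }
    apply V; intros s Hs.
    - apply is_Cderive_minus.
      + apply Hd. eapply Rle_trans; [apply Shift|]. specialize (Sh s Hs). lra.
      + apply is_Cderive_scal, is_Cderive_id.
    - rewrite Cmult_1_r. specialize (Sh s Hs).
      eapply Rle_trans; [apply L1; [lra|]|].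
      + eapply Rle_trans; [apply Shift|]. lra.
      + replace (z + s * h - z)%C with (s * h)%C by ring.
        apply Rmult_le_compat_l; lra. }
  set (q := fun t => ((f' (z0 + polar r t) - f' z0) / polar r t)%C).
  assert (Lq : forall s t, Cmod (q s - q t)%C <= (2 * M2 + 2 * M2) * Rabs (s - t)).
  { intros s t. unfold q.
    replace ((f' (z0 + polar r s) - f' z0) / polar r s - (f' (z0 + polar r t) - f' z0) / polar r t)%C
      with ((f' (z0 + polar r s) - f' (z0 + polar r t)) / polar r s +
            - ((f' (z0 + polar r t) - f' z0) * (polar r s - polar r t) / (polar r s * polar r t)))%C
      by (field; auto).
    eapply Rle_trans; [apply Cmod_triangle|].
    rewrite Cmod_opp, !Cmod_div, !Cmod_mult, !Pol by auto using Cmult_neq_0.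
    assert (PL := polar_lipschitz r s t (Rlt_le _ _ Hr)).
    assert (A1 : Cmod (f' (z0 + polar r s) - f' (z0 + polar r t))%C <=
      M2 * (2 * r * Rabs (s - t))).
    { eapply Rle_trans.
      - apply L1; (eapply Rle_trans; [apply Shift|]; rewrite Pol; lra).
      - replace (z0 + polar r s - (z0 + polar r t))%C with (polar r s - polar r t)%C by ring.
        apply Rmult_le_compat_l; lra. }
    assert (A2 : Cmod (f' (z0 + polar r t) - f' z0)%C <= M2 * r).
    { eapply Rle_trans.
      - apply L1; [lra|]. eapply Rle_trans; [apply Shift|]; rewrite Pol; lra.
      - replace (z0 + polar r t - z0)%C with (polar r t)%C by ring. rewrite Pol. lra. }
    rewrite Rmult_plus_distr_r. apply Rplus_le_compat.
    - apply Rle_div_l; [auto|]. lra.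
    - apply Rle_div_l; [nra|].
      replace (2 * M2 * Rabs (s - t) * (r * r)) with ((M2 * r) * (2 * r * Rabs (s - t))) by ring.
      apply Rmult_le_compat; auto using Cmod_ge_0. }
  apply Cmod_lipschitz_continuous in Lq. destruct Lq as [Qr Qi].
  destruct (circle_mean_exists q Qr Qi) as [K HK].
  exists K. change (is_Cderive f' z0 K). apply is_Cderive_eps. intros eps He.
  exists (Rmin (0.4 * r) (eps / (2 * M2 / r))). split.
  { assert (0 < 2 * M2 / r) by (apply Rdiv_lt_0_compat; lra).
    apply Rmin_pos; [lra|]. apply Rdiv_lt_0_compat; lra. }
  intros w Hw.
  assert (W1 := Rlt_le_trans _ _ _ Hw (Rmin_l _ _)).
  assert (W2 := Rlt_le_trans _ _ _ Hw (Rmin_r _ _)).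
  set (h := (w - z0)%C) in *. assert (Ew : w = (z0 + h)%C) by (unfold h; ring).
  apply Rle_trans with (2 * M2 / r * Cmod h ^ 2).
  - apply circle_mean_le with
      (fun t => (f (w + polar r t) - f w) / polar r t
                - (f (z0 + polar r t) - f z0) / polar r t
                - h * ((f' (z0 + polar r t) - f' z0) / polar r t))%C.
    + replace (K * h)%C with (h * K)%C by ring.
      apply circle_mean_minus; [apply circle_mean_minus; apply Cau; fold h; lra|].
      apply circle_mean_scal, HK.
    + intros t.
      replace ((f (w + polar r t) - f w) / polar r t
                - (f (z0 + polar r t) - f z0) / polar r t
                - h * ((f' (z0 + polar r t) - f' z0) / polar r t))%C
       with ((f (z0 + polar r t + h) - f (z0 + polar r t) - h * f' (z0 + polar r t)
             + - (f (z0 + h) - f z0 - h * f' z0)) / polar r t)%C.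
      2:{ rewrite Ew. replace (z0 + h + polar r t)%C with (z0 + polar r t + h)%C by ring.
          field; auto. }
      rewrite Cmod_div, Pol by auto. apply Rle_div_l; [auto|].
      eapply Rle_trans; [apply Cmod_triangle|]. rewrite Cmod_opp.
      assert (A1 := E2 (z0 + polar r t)%C h).
      assert (A2 := E2 z0 h).
      replace (2 * M2 / r * Cmod h ^ 2 * r) with (M2 * Cmod h ^ 2 + M2 * Cmod h ^ 2)
        by (field; lra).
      apply Rplus_le_compat; [apply A1|apply A2]; try lra.
      eapply Rle_trans; [apply Shift|]; rewrite Pol; lra.
  - replace (Cmod h ^ 2) with (Cmod h * Cmod h) by ring.
    rewrite <- Rmult_assoc. apply Rmult_le_compat_r; [apply Cmod_ge_0|].
    assert (0 < 2 * M2 / r) by (apply Rdiv_lt_0_compat; lra).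
    apply Rlt_div_r in W2; lra.
Qed.

Open Scope C_scope.

(** * Schwarz's lemma *)

Lemma holomorphic_is_Cderive (f : C -> C) (z : C) :
  holomorphic f -> disk z -> is_Cderive f z (C_derive f z).
Proof. intros H Hz. apply ex_Cderive_C_derive, H, Hz. Qed.

Lemma disk_0 : disk 0.
Proof. unfold disk. rewrite Cmod_0. lra. Qed.

(** The value at 0 is the one that makes the quotient continuous when f 0 = 0. *)
Definition div_by_z (f : C -> C) (z : C) : C :=
  if Ceq_dec z 0 then C_derive f 0 else f z / z.

Lemma div_by_z_mult (f : C -> C) (z : C) : f 0 = 0 -> f z = z * div_by_z f z.
Proof.
  intros H. unfold div_by_z. destruct Ceq_dec as [->|N].
  - rewrite H. ring.
  - field. exact N.
Qed.

(** At 0 the quotient has derivative f''(0) / 2: since f' is differentiable at 0,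
    the mean value inequality makes f z - f'(0) z - f''(0) z^2 / 2 an o(z^2). *)
Lemma div_by_z_holomorphic (f : C -> C) :
  holomorphic f -> f 0 = 0 -> holomorphic (div_by_z f).
Proof.
  intros Hf H0 z Hz. destruct (Ceq_dec z 0) as [->|N].
  - destruct (derivative_holomorphic f Hf 0 disk_0) as [b Hb].
    exists (b / 2). change (is_Cderive (div_by_z f) 0 (b / 2)).
    apply is_Cderive_eps. intros eps He.
    destruct (proj1 (is_Cderive_eps (C_derive f) 0 b) Hb eps He) as [d [Hd Hk]].
    destruct (disk_open 0 disk_0) as [d' [Hd' Hk']].
    exists (Rmin d d'). split; [apply Rmin_pos; auto|].
    intros w Hw. replace (w - 0) with w in * by ring.
    destruct (Ceq_dec w 0) as [->|Nw].
    { replace (div_by_z f 0 - div_by_z f 0 - b / 2 * 0) with (RtoC 0) by ring.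
      rewrite Cmod_0. lra. }
    assert (Sg : forall s : R, (0 <= s <= 1)%R -> (Cmod (s * w) <= Cmod w)%R).
    { intros s Hs. rewrite Cmod_mult, Cmod_R, Rabs_right by lra.
      assert (P := Cmod_ge_0 w). nra. }
    assert (V := mean_value_inequality
      (fun u => f u - (C_derive f 0 * u + b / 2 * (u * u)))
      (fun u => C_derive f u - (C_derive f 0 * 1 + b / 2 * (1 * u + u * 1)))
      0 w (eps * Cmod w)).
    replace (w - 0) with w in V by ring.
    replace (div_by_z f w - div_by_z f 0 - b / 2 * w) with
      ((f w - (C_derive f 0 * w + b / 2 * (w * w)) -
       (f 0 - (C_derive f 0 * 0 + b / 2 * (0 * 0)))) / w).
    2:{ rewrite H0. unfold div_by_z. destruct (Ceq_dec w 0); [contradiction|].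
        destruct (Ceq_dec 0 0); [|contradiction]. field. auto. }
    assert (P : (0 < Cmod w)%R) by (apply Cmod_gt_0; auto).
    rewrite Cmod_div by auto. apply Rle_div_l; [auto|].
    apply V; intros s Hs; replace (0 + s * w) with (s * w) by ring;
    specialize (Sg s Hs).
    + assert (Ds : disk (s * w)).
      { apply Hk'. replace (s * w - 0) with (s * w) by ring.
        eapply Rle_lt_trans; [exact Sg|].
        apply (Rlt_le_trans _ _ _ Hw (Rmin_r _ _)). }
      apply is_Cderive_minus; [apply holomorphic_is_Cderive; auto|].
      apply is_Cderive_plus; [apply is_Cderive_scal, is_Cderive_id|].
      apply is_Cderive_scal.
      apply (is_Cderive_mult (fun u => u) (fun u => u)); apply is_Cderive_id.
    + specialize (Hk (s * w)). replace (s * w - 0) with (s * w) in Hk by ring.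
      replace (C_derive f (s * w) - (C_derive f 0 * 1 + b / 2 * (1 * (s * w) + s * w * 1)))
        with (C_derive f (s * w) - C_derive f 0 - b * (s * w)) by field.
      eapply Rle_trans; [apply Hk|].
      * eapply Rle_lt_trans; [exact Sg|].
        apply (Rlt_le_trans _ _ _ Hw (Rmin_l _ _)).
      * apply Rmult_le_compat_l; lra.
  - assert (P : (0 < Cmod z)%R) by (apply Cmod_gt_0; auto).
    eexists. apply (is_Cderive_ext_near (fun u => f u / u) (div_by_z f) z _ (Cmod z) P).
    + intros w Hw. unfold div_by_z. destruct (Ceq_dec w 0) as [->|]; [|reflexivity].
      exfalso. replace (0 - z) with (- z) in Hw by ring. rewrite Cmod_opp in Hw. lra.
    + apply is_Cderive_div; [auto| |apply is_Cderive_id].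
      apply holomorphic_is_Cderive; auto.
Qed.

Lemma circle_mean_disk (g : C -> C) (r : R) :
  holomorphic g -> (0 < r < 1)%R -> circle_mean (fun t => g (polar r t)) (g 0).
Proof.
  intros Hg Hr. apply circle_mean_punctured with 1%R; auto.
  - intros z _ Hz. apply Hg. exact Hz.
  - intros eps He.
    destruct (is_Cderive_continuous g 0 _ (holomorphic_is_Cderive g 0 Hg disk_0) eps He)
      as [d [Hd H]].
    exists d. split; [auto|]. intros z _ Hz. apply H.
    replace (z - 0) with z by ring. exact Hz.
Qed.

(** The automorphism of the disc that sends 0 to a; its inverse is
    [disk_automorphism (- a)]. It moves the centre of a mean value to any point. *)
Definition disk_automorphism (a w : C) : C := (w + a) / (1 + Cconj a * w).

Lemma disk_automorphism_den (a w : C) : disk a -> (Cmod w <= 1)%R ->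
  (1 - Cmod a <= Cmod (1 + Cconj a * w))%R /\ 1 + Cconj a * w <> 0.
Proof.
  unfold disk. intros Ha Hw.
  assert (T := Cmod_triangle (1 + Cconj a * w) (- (Cconj a * w))).
  replace (1 + Cconj a * w + - (Cconj a * w)) with (RtoC 1) in T by ring.
  rewrite Cmod_opp, Cmod_mult, Cmod_conj, Cmod_1 in T.
  assert (P := Cmod_ge_0 a).
  assert (L : (1 - Cmod a <= Cmod (1 + Cconj a * w))%R) by nra.
  split; [exact L|]. apply Cmod_gt_0. lra.
Qed.

Lemma disk_automorphism_Cmod (a w : C) : 1 + Cconj a * w <> 0 ->
  ((1 - Cmod (disk_automorphism a w) ^ 2) * Cmod (1 + Cconj a * w) ^ 2 =
   (1 - Cmod a ^ 2) * (1 - Cmod w ^ 2))%R.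
Proof.
  intros N. unfold disk_automorphism. rewrite Cmod_div by auto.
  assert (P : (0 < Cmod (1 + Cconj a * w))%R) by (apply Cmod_gt_0; auto).
  apply Rminus_diag_uniq. field_simplify; [|lra].
  rewrite !Cmod2_alt. destruct a, w; unfold Re, Im; simpl. ring.
Qed.

Lemma disk_automorphism_disk (a w : C) : disk a -> disk w -> disk (disk_automorphism a w).
Proof.
  intros Ha Hw. unfold disk in *.
  destruct (disk_automorphism_den a w Ha) as [_ N]; [lra|].
  assert (E := disk_automorphism_Cmod a w N).
  assert (P : (0 < Cmod (1 + Cconj a * w))%R) by (apply Cmod_gt_0; auto).
  assert (Pa := Cmod_ge_0 a). assert (Pw := Cmod_ge_0 w).
  set (m := Cmod (disk_automorphism a w)) in *. assert (Pm : (0 <= m)%R) by apply Cmod_ge_0.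
  assert (Q : (0 < (1 - Cmod a ^ 2) * (1 - Cmod w ^ 2))%R)
    by (apply Rmult_lt_0_compat; nra).
  rewrite <- E in Q. apply Rnot_le_lt. intros L.
  assert ((1 - m ^ 2) <= 0)%R by nra.
  assert (0 < Cmod (1 + Cconj a * w) ^ 2)%R by (apply pow_lt; auto). nra.
Qed.

Lemma disk_automorphism_0 (a : C) : disk_automorphism a 0 = a.
Proof. unfold disk_automorphism. field. Qed.

Lemma disk_opp (a : C) : disk a -> disk (- a).
Proof. unfold disk. rewrite Cmod_opp. auto. Qed.

Lemma disk_automorphism_inv (a z : C) : disk a -> disk z ->
  disk_automorphism a (disk_automorphism (- a) z) = z.
Proof.
  intros Ha Hz.
  destruct (disk_automorphism_den (- a) z (disk_opp a Ha)) as [_ N]; [apply Rlt_le, Hz|].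
  destruct (disk_automorphism_den a (disk_automorphism (- a) z) Ha) as [_ N'].
  { apply Rlt_le, disk_automorphism_disk; auto using disk_opp. }
  unfold disk_automorphism in *. rewrite Copp_conj in *.
  assert (E : 1 + Cconj a * ((z + - a) / (1 + - Cconj a * z)) =
              (1 - Cconj a * a) / (1 + - Cconj a * z)) by (field; auto).
  rewrite E in *.
  assert (N2 : 1 - Cconj a * a <> 0).
  { intros K. apply N'. rewrite K. field. auto. }
  field. auto.
Qed.

Lemma is_Cderive_disk_automorphism (a w : C) : disk a -> disk w ->
  exists l, is_Cderive (disk_automorphism a) w l.
Proof.
  intros Ha Hw. destruct (disk_automorphism_den a w Ha) as [_ N]; [apply Rlt_le, Hw|].
  eexists. apply is_Cderive_div; [exact N| |].
  - apply is_Cderive_plus; [apply is_Cderive_id|apply is_Cderive_const].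
  - apply is_Cderive_plus; [apply is_Cderive_const|].
    apply is_Cderive_scal, is_Cderive_id.
Qed.

Lemma holomorphic_disk_automorphism (g : C -> C) (a : C) : disk a -> holomorphic g ->
  holomorphic (fun w => g (disk_automorphism a w)).
Proof.
  intros Ha Hg w Hw. destruct (is_Cderive_disk_automorphism a w Ha Hw) as [l Hl].
  eexists. apply (is_Cderive_comp g (disk_automorphism a)); [|exact Hl].
  apply holomorphic_is_Cderive; auto using disk_automorphism_disk.
Qed.

(** The value of f(z) / z at a is its mean over the image of the circle of radius s
    under the automorphism taking 0 to a. On that image |f(z) / z| is at most
    1 / |z|, which tends to 1 uniformly as s tends to 1. *)
Lemma schwarz_quotient (f : C -> C) :
  holomorphic f -> f 0 = 0 -> (forall z, disk z -> (Cmod (f z) <= 1)%R) ->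
  forall z, disk z -> (Cmod (div_by_z f z) <= 1)%R.
Proof.
  intros Hf H0 H1 a Ha.
  apply Rnot_lt_le. intros L.
  set (m := Cmod (div_by_z f a)) in *. set (B := ((1 + m) / 2)%R).
  assert (HB : (1 < B)%R) by (unfold B; lra).
  assert (HBm : (B < m)%R) by (unfold B; lra).
  clearbody B.
  (* s is chosen so that the image of the circle of radius s lies in
     |z| >= 1 / B. *)
  set (tau := (1 - / (B * B))%R).
  assert (Ht : (0 < tau < 1)%R).
  { assert (0 < / (B * B) < 1)%R; [|unfold tau; lra].
    split; [apply Rinv_0_lt_compat; nra|].
    rewrite <- Rinv_1. apply Rinv_lt_contravar; nra. }
  unfold disk in Ha. assert (Pa := Cmod_ge_0 a).
  set (s := sqrt (1 - tau * (1 - Cmod a) / 2)).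
  assert (Hs2 : (s * s = 1 - tau * (1 - Cmod a) / 2)%R) by (apply sqrt_sqrt; nra).
  assert (Hs : (0 < s < 1)%R).
  { assert (0 < s)%R by (apply sqrt_lt_R0; nra). split; nra. }
  assert (CM := circle_mean_disk _ s
    (holomorphic_disk_automorphism _ a Ha (div_by_z_holomorphic f Hf H0)) Hs).
  simpl in CM. rewrite disk_automorphism_0 in CM.
  assert (K : (m <= B)%R); [|lra].
  apply circle_mean_le with (1 := CM). intros t.
  assert (Dp : disk (polar s t)) by (unfold disk; rewrite Cmod_polar; lra).
  assert (Dz := disk_automorphism_disk a _ Ha Dp).
  destruct (disk_automorphism_den a (polar s t) Ha) as [D1 N]; [apply Rlt_le, Dp|].
  assert (E := disk_automorphism_Cmod a (polar s t) N).
  rewrite (Cmod_polar s t) in E by lra.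
  set (z := disk_automorphism a (polar s t)) in *.
  set (D := Cmod (1 + Cconj a * polar s t)) in *.
  assert (Z : (1 - Cmod z ^ 2 <= tau)%R).
  { apply Rnot_lt_le. intros Q.
    assert (D2 : ((1 - Cmod a) ^ 2 <= D ^ 2)%R) by (apply pow_incr; lra).
    assert (0 < (1 - Cmod a) ^ 2)%R by (apply pow_lt; lra).
    assert (X : (tau * (1 - Cmod a) ^ 2 < (1 - Cmod z ^ 2) * D ^ 2)%R) by nra.
    rewrite E in X. replace (s ^ 2)%R with (s * s)%R in X by ring. rewrite Hs2 in X.
    assert (0 < tau * (1 - Cmod a) ^ 2)%R by nra. nra. }
  assert (Zp : (/ B <= Cmod z)%R).
  { apply Rsqr_incr_0; [|apply Rlt_le, Rinv_0_lt_compat; lra|apply Cmod_ge_0].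
    unfold Rsqr. rewrite <- Rinv_mult. unfold tau in Z. nra. }
  assert (Pz : (0 < Cmod z)%R).
  { eapply Rlt_le_trans; [|exact Zp]. apply Rinv_0_lt_compat; lra. }
  specialize (H1 z Dz). rewrite (div_by_z_mult f z H0), Cmod_mult in H1.
  apply Rmult_le_reg_l with (Cmod z); [auto|].
  apply Rle_trans with 1%R; [exact H1|].
  rewrite <- (Rinv_l B) by lra. apply Rmult_le_compat_r; lra.
Qed.

(** The function x |-> RInt f a x vanishes on all of [a, b], hence so does its
    derivative f. *)
Lemma RInt_zero_nonneg (f : R -> R) (a b t : R) :
  (forall x, continuous f x) -> (forall x, 0 <= f x)%R ->
  is_RInt f a b 0%R -> (a < t < b)%R -> f t = 0%R.
Proof.
  intros Hc Hp HI Ht.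
  assert (Ex : forall u v, ex_RInt f u v)
    by (intros; apply (ex_RInt_continuous (V := R_CompleteNormedModule)); auto).
  assert (Z : forall x, (a < x < b)%R -> RInt f a x = 0%R).
  { intros x Hx.
    assert (A1 : (0 <= RInt f a x)%R) by (apply RInt_ge_0; auto; lra).
    assert (A2 : (0 <= RInt f x b)%R) by (apply RInt_ge_0; auto; lra).
    assert (A3 := RInt_Chasles_R f a x b (Ex _ _) (Ex _ _)).
    rewrite (is_RInt_unique _ _ _ _ HI) in A3. lra. }
  assert (D1 : is_derive (fun x => RInt f a x) t (f t)).
  { apply is_derive_RInt with a; [|apply Hc].
    exists (mkposreal _ Rlt_0_1). intros y _.
    apply (RInt_correct (V := R_CompleteNormedModule)); auto. }
  assert (D2 : is_derive (fun x => RInt f a x) t 0%R).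
  { apply is_derive_ext_loc with (fun _ => 0%R); [|apply (is_derive_const (V := R_NormedModule))].
    assert (Hd : (0 < Rmin (t - a) (b - t))%R) by (apply Rmin_pos; lra).
    exists (mkposreal _ Hd). intros y Hy. symmetry. apply Z.
    change (Rabs (y - t) < Rmin (t - a) (b - t))%R in Hy.
    assert (M1 := Rmin_l (t - a) (b - t)). assert (M2 := Rmin_r (t - a) (b - t)).
    apply Rabs_lt_between in Hy. lra. }
  rewrite <- (is_derive_unique _ _ _ D1). apply is_derive_unique; exact D2.
Qed.

Lemma holomorphic_circle_continuous (g : C -> C) (r t : R) (c : C) :
  holomorphic g -> (0 < r < 1)%R -> continuous (fun s => Re (c * g (polar r s))) t.
Proof.
  intros Hg Hr. apply continuity_pt_filterlim. intros eps He.
  assert (Dp : disk (polar r t)) by (unfold disk; rewrite Cmod_polar; lra).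
  destruct (is_Cderive_continuous (fun z => c * g z) (polar r t) _
    (is_Cderive_scal _ c _ _ (holomorphic_is_Cderive g _ Hg Dp)) eps He) as [d [Hd H]].
  exists (d / (2 * r))%R. split; [apply Rdiv_lt_0_compat; lra|].
  intros s [_ Hs]. unfold dist, R_met, R_dist, Base in *.
  replace (Re (c * g (polar r s)) - Re (c * g (polar r t)))%R with
    (Re (c * g (polar r s) - c * g (polar r t))) by (unfold Re; simpl; ring).
  eapply Rle_lt_trans; [apply re_le_Cmod|]. apply H.
  eapply Rle_lt_trans; [apply polar_lipschitz; lra|].
  apply Rlt_div_r in Hs; lra.
Qed.

(** The mean over a circle of 1 - Re (conj (g 0) g) is 0 and the integrand is
    nonnegative, so it vanishes. *)
Lemma max_modulus_centre (g : C -> C) :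
  holomorphic g -> (forall z, disk z -> (Cmod (g z) <= 1)%R) -> Cmod (g 0) = 1%R ->
  forall z, disk z -> g z = g 0.
Proof.
  intros Hg Hb H1 z Hz.
  destruct (Ceq_dec z 0) as [->|N]; [reflexivity|].
  assert (P : (0 < Cmod z)%R) by (apply Cmod_gt_0; auto).
  set (r := Cmod z) in *.
  assert (NR : RtoC r <> 0) by (intros E; apply RtoC_inj in E; lra).
  (* The circle is rotated so that z sits at the parameter pi, in the interior of
     the interval of integration. *)
  set (u := - (z / r)).
  assert (Hu : Cmod u = 1%R).
  { unfold u. rewrite Cmod_opp, Cmod_div, Cmod_R, Rabs_right by (auto; lra).
    fold r. field; lra. }
  assert (Hdu : forall p, disk p -> disk (u * p)).
  { intros p Hp. unfold disk in *. rewrite Cmod_mult, Hu. lra. }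
  set (G := fun p => g (u * p)).
  assert (HG : holomorphic G).
  { intros p Hp. eexists. apply (is_Cderive_comp g (fun p => u * p)).
    - apply holomorphic_is_Cderive; auto.
    - apply is_Cderive_scal, is_Cderive_id. }
  assert (Hr : (0 < r < 1)%R) by (split; [auto|exact Hz]).
  assert (G0 : G 0 = g 0) by (unfold G; f_equal; ring).
  assert (CM := circle_mean_disk G r HG Hr (Cconj (g 0))).
  rewrite G0 in CM.
  assert (Dp : forall t, disk (polar r t)) by (intros; unfold disk; rewrite Cmod_polar; lra).
  assert (Ec : Cconj (g 0) * g 0 = 1).
  { rewrite Cmult_comm, <- Cmod2_conj, H1. f_equal. ring. }
  rewrite Ec in CM.
  assert (PP := PI_RGT_0).
  assert (Z : (1 - Re (Cconj (g 0) * G (polar r PI)))%R = 0%R).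
  { apply (RInt_zero_nonneg (fun t => 1 - Re (Cconj (g 0) * G (polar r t)))%R 0 (2 * PI)).
    - intros x. apply (continuous_minus (V := R_NormedModule)); [apply continuous_const|].
      apply holomorphic_circle_continuous; auto.
    - intros x. assert (Q := re_le_Cmod (Cconj (g 0) * G (polar r x))).
      rewrite Cmod_mult, Cmod_conj, H1 in Q.
      assert (Q' := Hb _ (Hdu _ (Dp x))). fold (G (polar r x)) in Q'.
      apply Rabs_le_between in Q. lra.
    - replace 0%R with (minus (scal (2 * PI - 0)%R 1%R) (2 * PI * Re 1)%R) at 2
        by (unfold minus, plus, opp, scal; simpl; unfold mult; simpl; ring).
      apply (is_RInt_minus (V := R_NormedModule)); [|exact CM].
      apply (is_RInt_const (V := R_NormedModule)).
    - lra. }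
  assert (EG : G (polar r PI) = g z).
  { unfold G. f_equal. unfold u, polar. rewrite cos_PI, sin_PI.
    replace ((r * -1)%R, (r * 0)%R) with (- RtoC r) by (apply C_ext; simpl; ring).
    field. auto. }
  rewrite EG in Z.
  assert (One : Cconj (g 0) * g z = 1).
  { assert (Q : (Cmod (Cconj (g 0) * g z) <= 1)%R).
    { rewrite Cmod_mult, Cmod_conj, H1, Rmult_1_l. apply Hb; auto. }
    set (v := Cconj (g 0) * g z) in *.
    assert (Qv := Cmod2_alt v). assert (Pv := Cmod_ge_0 v).
    assert (Rv : Re v = 1%R) by lra. rewrite Rv in Qv. clearbody v.
    apply C_ext; [rewrite Rv; reflexivity|rewrite im_RtoC; nra]. }
  rewrite <- (Cmult_1_r (g 0)), <- One.
  replace (g 0 * (Cconj (g 0) * g z)) with ((Cconj (g 0) * g 0) * g z) by ring.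
  rewrite Ec. ring.
Qed.

Lemma max_modulus (g : C -> C) (a : C) :
  holomorphic g -> (forall z, disk z -> (Cmod (g z) <= 1)%R) ->
  disk a -> Cmod (g a) = 1%R -> forall z, disk z -> g z = g a.
Proof.
  intros Hg Hb Ha H1 z Hz.
  assert (K := max_modulus_centre (fun w => g (disk_automorphism a w))
    (holomorphic_disk_automorphism g a Ha Hg)). simpl in K.
  rewrite disk_automorphism_0 in K.
  rewrite <- (disk_automorphism_inv a z Ha Hz) at 1.
  apply K; auto using disk_automorphism_disk, disk_opp.
Qed.

Theorem schwarz (f : C -> C) :
  holomorphic f -> f 0 = 0 -> (forall z, disk z -> (Cmod (f z) <= 1)%R) ->
  (forall z, disk z -> (Cmod (f z) <= Cmod z)%R) /\
  (Cmod (C_derive f 0) <= 1)%R /\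
  (forall a, disk a -> a <> 0 -> Cmod (f a) = Cmod a ->
     exists c, Cmod c = 1%R /\ forall z, disk z -> f z = c * z).
Proof.
  intros Hf H0 H1. assert (Q := schwarz_quotient f Hf H0 H1). repeat split.
  - intros z Hz. rewrite (div_by_z_mult f z H0), Cmod_mult.
    specialize (Q z Hz). assert (P := Cmod_ge_0 z). nra.
  - specialize (Q 0 disk_0). unfold div_by_z in Q.
    destruct (Ceq_dec 0 0); [exact Q|contradiction].
  - intros a Ha N E. exists (div_by_z f a).
    assert (P : (0 < Cmod a)%R) by (apply Cmod_gt_0; auto).
    rewrite (div_by_z_mult f a H0), Cmod_mult in E.
    assert (E1 : Cmod (div_by_z f a) = 1%R) by nra.
    split; [exact E1|]. intros z Hz. rewrite (div_by_z_mult f z H0) at 1.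
    rewrite (max_modulus (div_by_z f) a (div_by_z_holomorphic f Hf H0) Q Ha E1 z Hz). ring.
Qed.

(** * Branches of the logarithm *)

Lemma zero_derivative_const (f : C -> C) (r : R) :
  (forall z, (Cmod z < r)%R -> is_Cderive f z 0) ->
  forall z, (Cmod z < r)%R -> f z = f 0.
Proof.
  intros H z Hz.
  assert (K : (Cmod (f z - f 0) <= 0 * Cmod (z - 0))%R).
  { apply (mean_value_inequality f (fun _ => 0)); intros s Hs.
    - apply H. assert (S := segment_in_ball 0 0 z (Cmod z) s Hs).
      replace (0 + s * (z - 0) - 0) with (0 + s * (z - 0)) in S by ring.
      eapply Rle_lt_trans; [apply S|exact Hz].
      + replace (0 - 0) with (RtoC 0) by ring. rewrite Cmod_0. apply Cmod_ge_0.
      + replace (z - 0) with z by ring. lra.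
    - rewrite Cmod_0. lra. }
  rewrite Rmult_0_l in K. apply Ceq_minus, Cmod_eq_0.
  apply Rle_antisym; [exact K|apply Cmod_ge_0].
Qed.

Lemma log_derivative (L f : C -> C) (z l : C) (d : R) :
  (0 < d)%R -> (forall w, (Cmod (w - z) < d)%R -> Cexp (L w) = f w) ->
  is_Cderive L z l -> is_Cderive f z (l * f z).
Proof.
  intros Hd E HL.
  apply is_Cderive_ext_near with (fun w => Cexp (L w)) d; auto.
  rewrite <- (E z).
  - apply is_Cderive_Cexp_comp. exact HL.
  - replace (z - z) with (RtoC 0) by ring. rewrite Cmod_0. exact Hd.
Qed.

(** Both functions have the logarithmic derivative of the same exponential. *)
Lemma log_unique_on_disc (L1 L2 : C -> C) (r : R) :
  (forall z, (Cmod z < r)%R -> exists l, is_Cderive L1 z l) ->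
  (forall z, (Cmod z < r)%R -> exists l, is_Cderive L2 z l) ->
  (forall z, (Cmod z < r)%R -> Cexp (L1 z) = Cexp (L2 z)) -> L1 0 = L2 0 ->
  forall z, (Cmod z < r)%R -> L1 z = L2 z.
Proof.
  intros H1 H2 E E0 z Hz.
  assert (K : L1 z - L2 z = L1 0 - L2 0).
  { apply (zero_derivative_const (fun z => L1 z - L2 z) r); auto.
    intros w Hw. destruct (H1 w Hw) as [l1 K1]. destruct (H2 w Hw) as [l2 K2].
    assert (Hd : (0 < r - Cmod w)%R) by lra.
    assert (D1 : is_Cderive (fun u => Cexp (L2 u)) w (l1 * Cexp (L2 w))).
    { apply (log_derivative L1 (fun u => Cexp (L2 u)) w l1 (r - Cmod w)%R); auto.
      intros u Hu. apply E. replace u with ((u - w) + w) by ring.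
      eapply Rle_lt_trans; [apply Cmod_triangle|]. lra. }
    assert (D2 := is_Cderive_Cexp_comp L2 w l2 K2).
    assert (Eq := is_Cderive_unique _ _ _ _ D1 D2).
    assert (N := Cexp_neq_0 (L2 w)).
    assert (El : l1 = l2).
    { replace l1 with (l1 * Cexp (L2 w) / Cexp (L2 w)) by (field; auto).
      rewrite Eq. field; auto. }
    subst l2. replace (RtoC 0) with (l1 - l1) by ring.
    apply is_Cderive_minus; auto. }
  rewrite E0 in K. apply Ceq_minus. rewrite K. ring.
Qed.

Lemma Re_div_pos (a b : C) : (Cmod (a - b) < Cmod b)%R -> (0 < Re (a / b))%R.
Proof.
  intros H. assert (Nb : b <> 0).
  { apply Cmod_gt_0. assert (P := Cmod_ge_0 (a - b)). lra. }
  assert (P : (0 < Cmod b)%R) by (apply Cmod_gt_0; auto).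
  replace (a / b) with ((a - b) / b + 1) by (field; auto).
  assert (Q : (Cmod ((a - b) / b) < 1)%R) by (rewrite Cmod_div by auto; apply Rlt_div_l; lra).
  assert (R1 := re_le_Cmod ((a - b) / b)). apply Rabs_le_between in R1.
  rewrite re_plus, re_RtoC. lra.
Qed.

(** By uniform continuity, n can be taken so large that for |z| <= r consecutive
    values f (k z / n) and f ((k + 1) z / n) have a ratio in the right half-plane.
    The principal logarithms of these ratios add up to a logarithm of
    f z / f 0 = f z, and each of them is holomorphic. *)
Lemma log_on_disc (f : C -> C) (r : R) :
  holomorphic f -> (forall z, disk z -> f z <> 0) -> f 0 = 1 -> (0 < r < 1)%R ->
  exists L : C -> C, L 0 = 0 /\ forall z, (Cmod z <= r)%R ->
    (exists l, is_Cderive L z l) /\ Cexp (L z) = f z.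
Proof.
  intros Hf Hn H1 Hr.
  destruct (closed_disc_lebesgue r (fun u d => forall z w,
    (Cmod (z - u) < d)%R -> (Cmod (w - u) < 2 * d)%R -> (0 < Re (f w / f z))%R))
    as [d [Hd K]].
  { intros u Hu. assert (Du : disk u) by (unfold disk; lra).
    assert (P : (0 < Cmod (f u))%R) by (apply Cmod_gt_0; auto).
    destruct (is_Cderive_continuous f u _ (holomorphic_is_Cderive f u Hf Du) (Cmod (f u) / 3))
      as [d [Hd H]]; [lra|].
    exists (d / 2)%R. split; [lra|]. intros z w Hz Hw.
    assert (Az : (Cmod (f z - f u) < Cmod (f u) / 3)%R) by (apply H; lra).
    assert (Aw : (Cmod (f w - f u) < Cmod (f u) / 3)%R) by (apply H; lra).
    apply Re_div_pos.
    assert (T1 : (Cmod (f w - f z) <= Cmod (f w - f u) + Cmod (f z - f u))%R).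
    { replace (f w - f z) with ((f w - f u) + - (f z - f u)) by ring.
      rewrite <- (Cmod_opp (f z - f u)). apply Cmod_triangle. }
    assert (T2 : (Cmod (f u) <= Cmod (f z) + Cmod (f z - f u))%R).
    { replace (f u) with (f z + - (f z - f u)) at 1 by ring.
      rewrite <- (Cmod_opp (f z - f u)). apply Cmod_triangle. }
    lra. }
  assert (Ratio : forall z w, (Cmod z <= r)%R -> (Cmod (w - z) < d)%R -> (0 < Re (f w / f z))%R).
  { intros z w Hz Hw. destruct (K z Hz) as [u [d' [_ [K1 [K2 K3]]]]].
    apply K1; [exact K3|].
    replace (w - u) with ((w - z) + (z - u)) by ring.
    eapply Rle_lt_trans; [apply Cmod_triangle|]. lra. }
  destruct (archimed_cor1 d Hd) as [n [Hn1 Hn2]].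
  assert (Pn : (0 < INR n)%R) by (apply lt_0_INR; auto).
  set (c := fun k => RtoC (INR k / INR n)).
  assert (Hc : forall k z, (k <= n)%nat -> (Cmod (c k * z) <= Cmod z)%R).
  { intros k z Hk. unfold c. assert (P := Cmod_ge_0 z).
    assert (B : (0 <= INR k / INR n <= 1)%R).
    { apply le_INR in Hk. split.
      - apply Rdiv_le_0_compat; [apply pos_INR|auto].
      - apply Rle_div_l; lra. }
    rewrite Cmod_mult, Cmod_R, Rabs_right by lra. nra. }
  assert (Step : forall k, (k <= n)%nat -> exists L : C -> C, L 0 = 0 /\
    forall z, (Cmod z <= r)%R -> (exists l, is_Cderive L z l) /\ Cexp (L z) = f (c k * z)).
  { intros k. induction k as [|k IH]; intros Hk.
    - exists (fun _ => 0). split; [reflexivity|]. intros z Hz. split.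
      + exists 0. apply is_Cderive_const.
      + replace (c 0%nat * z) with (RtoC 0); [rewrite Cexp_0; auto|].
        unfold c. simpl. unfold Rdiv. rewrite Rmult_0_l. ring.
    - destruct IH as [L [L0 HL]]; [lia|].
      exists (fun z => L z + Clog (f (c (S k) * z) / f (c k * z))).
      split.
      + rewrite L0, !Cmult_0_r, H1. replace (1 / 1) with (RtoC 1) by field.
        rewrite Clog_1. ring.
      + intros z Hz. destruct (HL z Hz) as [[l Hl] El].
        assert (Hz1 : disk (c k * z)).
        { unfold disk. eapply Rle_lt_trans; [apply Hc; lia|lra]. }
        assert (Hz2 : disk (c (S k) * z)).
        { unfold disk. eapply Rle_lt_trans; [apply Hc; lia|lra]. }
        assert (Rp : (0 < Re (f (c (S k) * z)%C / f (c k * z)%C))%R).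
        { apply Ratio.
          - eapply Rle_trans; [apply Hc; lia|lra].
          - replace (c (S k) * z - c k * z) with (RtoC (/ INR n) * z).
            + rewrite Cmod_mult, Cmod_R, Rabs_right
                by (apply Rle_ge, Rlt_le, Rinv_0_lt_compat; auto).
              assert (Q := Cmod_ge_0 z).
              assert (0 < / INR n)%R by (apply Rinv_0_lt_compat; auto). nra.
            + unfold c. rewrite S_INR.
              replace ((INR k + 1) / INR n)%R with (INR k / INR n + / INR n)%R
                by (field; lra).
              rewrite RtoC_plus. ring. }
        split.
        * eexists. apply is_Cderive_plus; [exact Hl|].
          apply (is_Cderive_comp Clog (fun z => f (c (S k) * z) / f (c k * z))).
          -- apply is_Cderive_Clog. exact Rp.
          -- apply is_Cderive_div; [auto| |].
             ++ apply (is_Cderive_comp f (fun z => c (S k) * z)).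
                ** apply holomorphic_is_Cderive; auto.
                ** apply is_Cderive_scal, is_Cderive_id.
             ++ apply (is_Cderive_comp f (fun z => c k * z)).
                ** apply holomorphic_is_Cderive; auto.
                ** apply is_Cderive_scal, is_Cderive_id.
        * rewrite Cexp_plus, El, Cexp_Clog by (apply Re_pos_neq_0; auto).
          field. auto. }
  destruct (Step n (le_n n)) as [L [L0 HL]]. exists L. split; [auto|].
  intros z Hz. destruct (HL z Hz) as [A B]. split; [exact A|].
  rewrite B. f_equal. unfold c. rewrite Rdiv_diag by lra. ring.
Qed.

(** Uniqueness lets the logarithms on smaller discs be glued: at z the one on the
    disc of radius (1 + |z|) / 2 is used. *)
Theorem log_branch_exists (f : C -> C) :
  holomorphic f -> (forall z, disk z -> f z <> 0) -> f 0 = 1 ->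
  exists L, is_log_branch f L.
Proof.
  intros Hf Hn H1.
  assert (Ex : forall r, exists L : C -> C, (0 < r < 1)%R ->
    L 0 = 0 /\ forall z, (Cmod z <= r)%R ->
    (exists l, is_Cderive L z l) /\ Cexp (L z) = f z).
  { intros r. destruct (classic (0 < r < 1)%R) as [Hr|Hr].
    - destruct (log_on_disc f r Hf Hn H1 Hr) as [L HL]. exists L; auto.
    - exists (fun _ => 0). intros; contradiction. }
  set (Lr := fun r => proj1_sig (constructive_indefinite_description _ (Ex r))).
  assert (HLr : forall r, (0 < r < 1)%R -> Lr r 0 = 0 /\
    forall z, (Cmod z <= r)%R ->
    (exists l, is_Cderive (Lr r) z l) /\ Cexp (Lr r z) = f z).
  { intros r. unfold Lr. destruct constructive_indefinite_description; auto. }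
  clearbody Lr.
  set (rho := fun z : C => ((1 + Cmod z) / 2)%R).
  assert (Hrho : forall z, disk z -> (0 < rho z < 1)%R /\ (Cmod z < rho z)%R).
  { intros z Hz. unfold disk in Hz. unfold rho. assert (P := Cmod_ge_0 z). lra. }
  assert (Agree : forall r s z, (0 < r < 1)%R -> (0 < s < 1)%R ->
    (Cmod z < r)%R -> (Cmod z < s)%R -> Lr r z = Lr s z).
  { intros r s z Hr Hs Hzr Hzs.
    destruct (HLr r Hr) as [A0 A]. destruct (HLr s Hs) as [B0 B].
    assert (M1 := Rmin_l r s). assert (M2 := Rmin_r r s).
    apply log_unique_on_disc with (Rmin r s).
    - intros w Hw. apply A. lra.
    - intros w Hw. apply B. lra.
    - intros w Hw. rewrite (proj2 (A w ltac:(lra))), (proj2 (B w ltac:(lra))).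
      reflexivity.
    - rewrite A0, B0. reflexivity.
    - apply Rmin_glb_lt; auto. }
  exists (fun z => Lr (rho z) z). repeat split.
  - intros z Hz. destruct (Hrho z Hz) as [R1 R2].
    destruct (HLr (rho z) R1) as [_ A].
    destruct (A z (Rlt_le _ _ R2)) as [[l Hl] _]. exists l.
    apply (is_Cderive_ext_near (Lr (rho z)) _ z l (rho z - Cmod z)%R); [lra| |exact Hl].
    intros w Hw.
    assert (Hw2 : (Cmod w < rho z)%R).
    { replace w with ((w - z) + z) by ring.
      eapply Rle_lt_trans; [apply Cmod_triangle|]. lra. }
    assert (Dw : disk w) by (unfold disk; lra).
    destruct (Hrho w Dw). apply Agree; auto.
  - apply HLr. apply Hrho, disk_0.
  - intros z Hz. destruct (Hrho z Hz) as [R1 R2].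
    apply (proj2 (HLr (rho z) R1)). lra.
Qed.

Lemma log_branch_spec (f : C -> C) :
  holomorphic f -> (forall z, disk z -> f z <> 0) -> f 0 = 1 ->
  is_log_branch f (log_branch f).
Proof.
  intros Hf Hn H1. unfold log_branch. apply epsilon_spec.
  apply log_branch_exists; auto.
Qed.

Lemma log_branch_eq (f L : C -> C) (z : C) :
  is_log_branch f L -> disk z -> log_branch f z = L z.
Proof.
  intros HL Hz.
  assert (H : is_log_branch f (log_branch f)).
  { unfold log_branch. apply epsilon_spec. exists L. exact HL. }
  destruct HL as [A [B E]]. destruct H as [A' [B' E']].
  apply log_unique_on_disc with 1%R; auto.
  - intros w Hw. rewrite E, E'; auto.
  - rewrite B, B'. reflexivity.
Qed.

Lemma is_log_branch_derive (f L : C -> C) (z : C) :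
  holomorphic f -> is_log_branch f L -> disk z ->
  is_Cderive L z (C_derive f z / f z).
Proof.
  intros Hf [A [_ E]] Hz.
  assert (N : f z <> 0) by (rewrite <- E by auto; apply Cexp_neq_0).
  assert (HL := holomorphic_is_Cderive L z A Hz).
  destruct (disk_open z Hz) as [d [Hd D]].
  assert (K := log_derivative L f z _ d Hd (fun w Hw => E w (D w Hw)) HL).
  rewrite (is_C_derive_unique _ _ _ K).
  replace (C_derive L z * f z / f z) with (C_derive L z) by (field; auto).
  exact HL.
Qed.

Lemma Cmod_le_sq (a b : C) : (Cmod a ^ 2 <= Cmod b ^ 2)%R -> (Cmod a <= Cmod b)%R.
Proof.
  intros H. apply Rsqr_incr_0; [|apply Cmod_ge_0|apply Cmod_ge_0].
  rewrite !Rsqr_pow2. exact H.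
Qed.

Lemma Re_minus (a b : C) : Re (a - b) = (Re a - Re b)%R.
Proof. unfold Cminus. rewrite re_plus, re_opp. reflexivity. Qed.

Lemma Im_minus (a b : C) : Im (a - b) = (Im a - Im b)%R.
Proof. unfold Cminus. rewrite im_plus, im_opp. reflexivity. Qed.

(** * Functions with Re (z F') > -1/2 *)

Lemma schwarz_factor (g : C -> C) :
  holomorphic g -> (forall z, disk z -> (Cmod (z * g z) <= 1)%R) ->
  forall z, disk z -> (Cmod (g z) <= 1)%R.
Proof.
  intros Hg Hb z Hz.
  assert (D : forall w, disk w ->
    is_Cderive (fun w => w * g w) w (1 * g w + w * C_derive g w)).
  { intros w Hw. apply (is_Cderive_mult (fun w => w)); [apply is_Cderive_id|].
    apply holomorphic_is_Cderive; auto. }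
  assert (Q := schwarz_quotient (fun w => w * g w)).
  replace (g z) with (div_by_z (fun w => w * g w) z).
  - apply Q; auto; [|ring]. intros w Hw. eexists. apply D; auto.
  - unfold div_by_z. destruct Ceq_dec as [->|N].
    + rewrite (is_C_derive_unique _ _ _ (D 0 disk_0)). ring.
    + field. exact N.
Qed.

(** The condition says that w = z F' is closer to 0 than to -1, so w / (1 + w) is
    bounded by 1. It vanishes at 0, and Schwarz's lemma lets the factor z be
    removed. *)
Lemma derivative_representation (F : C -> C) :
  holomorphic F ->
  (forall z, disk z -> (- (1 / 2) < Re (z * C_derive F z))%R) ->
  exists phi, holomorphic phi /\ forall z, disk z ->
    (Cmod (phi z) <= 1)%R /\ 1 - z * phi z <> 0 /\
    C_derive F z = phi z / (1 - z * phi z).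
Proof.
  intros HF HR.
  set (den := fun z => 1 + z * C_derive F z).
  assert (Nd : forall z, disk z -> den z <> 0).
  { intros z Hz. apply Re_pos_neq_0. unfold den.
    rewrite re_plus, re_RtoC. specialize (HR z Hz). lra. }
  assert (HF' := derivative_holomorphic F HF).
  set (phi := fun z => C_derive F z / den z).
  assert (Hphi : holomorphic phi).
  { intros z Hz. eexists. apply is_Cderive_div; [apply Nd; auto| |].
    - apply holomorphic_is_Cderive; auto.
    - apply is_Cderive_plus; [apply is_Cderive_const|].
      apply (is_Cderive_mult (fun w => w)); [apply is_Cderive_id|].
      apply holomorphic_is_Cderive; auto. }
  exists phi. split; [exact Hphi|]. intros z Hz. split; [|split].
  - apply schwarz_factor; auto. intros w Hw.
    replace (w * phi w) with (w * C_derive F w / den w) by (unfold phi; field; auto).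
    rewrite Cmod_div by auto. apply Rle_div_l; [apply Cmod_gt_0; auto|].
    rewrite Rmult_1_l. apply Cmod_le_sq.
    specialize (HR w Hw). unfold den. set (a := w * C_derive F w) in *.
    rewrite !Cmod2_alt, re_plus, im_plus, re_RtoC, im_RtoC. nra.
  - replace (1 - z * phi z) with (/ den z); [|unfold phi, den; field; apply Nd; auto].
    apply Cmod_gt_0. rewrite Cmod_inv by auto.
    apply Rinv_0_lt_compat, Cmod_gt_0; auto.
  - replace (1 - z * phi z) with (/ den z); [|unfold phi, den; field; apply Nd; auto].
    unfold phi. field. auto.
Qed.

(** With k = conj (G 1) l, comparing |G (1 + t v)| with |1 + t v| for small t > 0
    gives Re (k v) <= Re v for every v pointing into the disc. The directions
    v = -1 + i y force k to be real and at least 1. *)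
Lemma boundary_derivative (G : C -> C) (l : C) :
  is_Cderive G 1 l -> (forall p, disk p -> (Cmod (G p) <= Cmod p)%R) ->
  Cmod (G 1) = 1%R ->
  Im (Cconj (G 1) * l) = 0%R /\ (1 <= Re (Cconj (G 1) * l))%R.
Proof.
  intros HD Hle H1. set (k := Cconj (G 1) * l).
  assert (Key : forall v, (Re v < 0)%R -> (Re (k * v) <= Re v)%R).
  { intros v Hv.
    assert (Pv : (0 < Cmod v)%R).
    { apply Cmod_gt_0. intros ->. rewrite re_RtoC in Hv. lra. }
    apply le_epsilon. intros eps He.
    destruct (proj1 (is_Cderive_eps G 1 l) HD (eps / 2 / Cmod v)%R) as [d [Hd H]].
    { repeat apply Rdiv_lt_0_compat; lra. }
    set (m := Cmod v) in *.
    (* t is small enough for 1 + t v to lie in the disc and for the quadratic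
       term of its modulus to be at most eps t / 2 *)
    set (t := Rmin (d / (2 * m)) (Rmin (- Re v / (m * m)) (Rmin (eps / (m * m)) (1 / (2 * m))))).
    assert (Ht : (0 < t)%R).
    { assert (0 < m * m)%R by nra. unfold t.
      repeat apply Rmin_pos; apply Rdiv_lt_0_compat; lra. }
    assert (T1 : (t <= d / (2 * m))%R) by apply Rmin_l.
    assert (T2 : (t <= - Re v / (m * m))%R).
    { eapply Rle_trans; [apply Rmin_r|apply Rmin_l]. }
    assert (T3 : (t <= eps / (m * m))%R).
    { eapply Rle_trans; [apply Rmin_r|]. eapply Rle_trans; [apply Rmin_r|apply Rmin_l]. }
    assert (T4 : (t <= 1 / (2 * m))%R).
    { eapply Rle_trans; [apply Rmin_r|]. eapply Rle_trans; [apply Rmin_r|apply Rmin_r]. }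
    clearbody t.
    apply Rle_div_r in T1; [|lra]. apply Rle_div_r in T2; [|nra].
    apply Rle_div_r in T3; [|nra]. apply Rle_div_r in T4; [|lra].
    set (p := 1 + t * v).
    assert (Ep : (Cmod p ^ 2 = 1 + 2 * t * Re v + t * t * (m * m))%R).
    { unfold p. rewrite Cmod2_alt, re_plus, im_plus, re_RtoC, im_RtoC, re_scal_l, im_scal_l.
      replace (m * m)%R with (Cmod v ^ 2)%R by (unfold m; ring).
      rewrite Cmod2_alt. ring. }
    assert (Rv : (- m <= Re v)%R).
    { assert (Q := re_le_Cmod v). fold m in Q. apply Rabs_le_between in Q. lra. }
    assert (Pp := Cmod_ge_0 p).
    assert (Dp : disk p) by (unfold disk; nra).
    assert (Bp : (Cmod p <= 1 + t * Re v + t * eps / 2)%R).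
    { apply Rsqr_incr_0; [|auto|nra]. rewrite !Rsqr_pow2, Ep.
      assert (X : (t * t * (m * m) <= t * eps)%R) by nra.
      set (y := (t * Re v + t * eps / 2)%R).
      replace (1 + t * Re v + t * eps / 2)%R with (1 + y)%R by (unfold y; ring).
      assert (0 <= y * y)%R by nra. unfold y in *. nra. }
    assert (Hp := H p). replace (p - 1) with (RtoC t * v) in Hp by (unfold p; ring).
    rewrite Cmod_mult, Cmod_R, Rabs_right in Hp by lra. fold m in Hp.
    assert (Hp' : (Cmod (G p - G 1 - l * (t * v)) <= eps / 2 * t)%R).
    { eapply Rle_trans; [apply Hp; nra|]. apply Req_le. field. lra. }
    assert (E : Cconj (G 1) * G p = 1 + t * (k * v) + Cconj (G 1) * (G p - G 1 - l * (t * v))).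
    { assert (U : Cconj (G 1) * G 1 = 1).
      { rewrite Cmult_comm, <- Cmod2_conj, H1. f_equal. ring. }
      transitivity (Cconj (G 1) * G 1 + t * (k * v) + Cconj (G 1) * (G p - G 1 - l * (t * v)));
        [unfold k; ring|rewrite U; reflexivity]. }
    assert (A1 : (Re (Cconj (G 1) * G p) <= Cmod p)%R).
    { eapply Rle_trans; [apply Rle_abs|]. eapply Rle_trans; [apply re_le_Cmod|].
      rewrite Cmod_mult, Cmod_conj, H1, Rmult_1_l. apply Hle; auto. }
    assert (A2 := re_le_Cmod (Cconj (G 1) * (G p - G 1 - l * (t * v)))).
    rewrite Cmod_mult, Cmod_conj, H1, Rmult_1_l in A2.
    apply Rabs_le_between in A2.
    rewrite E, !re_plus, re_RtoC, re_scal_l in A1.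
    assert (t * Re (k * v) <= t * (Re v + eps))%R by lra.
    apply Rmult_le_reg_l with t; auto. }
  assert (K : forall y : R, (- Re k - Im k * y <= -1)%R).
  { intros y. specialize (Key (-1, y)%R). rewrite re_mult in Key.
    change (Re (-1, y)%R) with (-1)%R in Key. change (Im (-1, y)%R) with y in Key.
    specialize (Key ltac:(lra)). lra. }
  split.
  - destruct (Req_dec (Im k) 0) as [E|N]; [exact E|exfalso].
    specialize (K (- Rabs (Re k) / Im k)%R).
    replace (Im k * (- Rabs (Re k) / Im k))%R with (- Rabs (Re k))%R in K by (field; auto).
    assert (Q := Rle_abs (Re k)). lra.
  - specialize (K 0%R). lra.
Qed.

Lemma ray_into_disk (G : C -> C) (l : C) :
  is_Cderive G 1 l -> (forall p, disk p -> (Cmod (G p) <= 1)%R) -> (Cmod (G 1) <= 1)%R.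
Proof.
  intros HD Hle. apply le_epsilon. intros eps He.
  destruct (is_Cderive_continuous G 1 l HD eps He) as [d [Hd H]].
  set (t := Rmin (d / 2) (1 / 2)).
  assert (Ht : (0 < t)%R) by (apply Rmin_pos; lra).
  assert (T1 : (t <= d / 2)%R) by apply Rmin_l.
  assert (T2 : (t <= 1 / 2)%R) by apply Rmin_r.
  specialize (H (RtoC (1 - t))). rewrite RtoC_minus in H.
  replace (1 - t - 1) with (- RtoC t) in H by ring.
  rewrite Cmod_opp, Cmod_R, Rabs_right in H by lra. specialize (H ltac:(lra)).
  assert (D : (Cmod (G (1 - t)%C) <= 1)%R).
  { apply Hle. unfold disk. rewrite <- RtoC_minus, Cmod_R, Rabs_right; lra. }
  replace (G 1) with (G (1 - t) + - (G (1 - t) - G 1)) by ring.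
  eapply Rle_trans; [apply Cmod_triangle|]. rewrite Cmod_opp. lra.
Qed.

(** The radii r with |s| < 1 on the open disc of radius r have a supremum r0. If
    |s| < 1 held on the closed disc of radius r0 as well, compactness would extend
    it to a larger disc. *)
Lemma first_exit (s : C -> C) (z1 : C) :
  holomorphic s -> disk z1 -> (1 <= Cmod (s z1))%R ->
  exists z0, disk z0 /\ (1 <= Cmod (s z0))%R /\
    forall z, (Cmod z < Cmod z0)%R -> (Cmod (s z) < 1)%R.
Proof.
  intros Hs Hz1 H1.
  set (S := fun r : R => forall z, (Cmod z < r)%R -> (Cmod (s z) < 1)%R).
  assert (Ub : is_upper_bound S (Cmod z1)).
  { intros r Hr. apply Rnot_lt_le. intros L. specialize (Hr z1 L). lra. }
  destruct (completeness S) as [r0 [R1 R2]].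
  - exists (Cmod z1). exact Ub.
  - exists 0%R. intros z Hz. assert (P := Cmod_ge_0 z). lra.
  - assert (Hr0 : S r0).
    { intros z Hz. apply NNPP. intros N.
      assert (r0 <= Cmod z)%R; [|lra]. apply R2. intros r Hr.
      apply Rnot_lt_le. intros L. apply N, Hr, L. }
    assert (L0 : (r0 <= Cmod z1)%R) by (apply R2, Ub).
    assert (P0 : (0 <= r0)%R).
    { apply R1. intros z Hz. assert (P := Cmod_ge_0 z). lra. }
    unfold disk in Hz1.
    destruct (classic (exists z0, (Cmod z0 <= r0)%R /\ (1 <= Cmod (s z0))%R)) as [[z0 [A B]]|N].
    + exists z0. repeat split; [unfold disk; lra|auto|].
      intros z Hz. apply Hr0. lra.
    + exfalso.
      destruct (closed_disc_lebesgue r0 (fun u d => forall z, (Cmod (z - u) < 2 * d)%R ->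
        (Cmod (s z) < 1)%R)) as [d [Hd K]].
      { intros u Hu. assert (Du : disk u) by (unfold disk; lra).
        assert (Lu : (Cmod (s u) < 1)%R).
        { apply Rnot_le_lt. intros Q. apply N. exists u. auto. }
        destruct (is_Cderive_continuous s u _ (holomorphic_is_Cderive s u Hs Du) (1 - Cmod (s u)))
          as [d [Hd H]]; [lra|].
        exists (d / 2)%R. split; [lra|]. intros z Hz.
        specialize (H z ltac:(lra)).
        replace (s z) with ((s z - s u) + s u) by ring.
        eapply Rle_lt_trans; [apply Cmod_triangle|]. lra. }
      assert (r0 + d <= r0)%R; [|lra]. apply R1. intros w Hw.
      destruct (Rlt_le_dec (Cmod w) r0) as [L|L]; [apply Hr0; auto|].
      (* the radial projection of w to the closed disc of radius r0 *)
      assert (Pick : exists z, (Cmod z <= r0)%R /\ (Cmod (w - z) < d)%R).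
      { destruct (Ceq_dec w 0) as [->|Nw].
        - exists 0. rewrite Cmod_0 in *. replace (0 - 0) with (RtoC 0) by ring.
          rewrite Cmod_0. lra.
        - assert (Pw : (0 < Cmod w)%R) by (apply Cmod_gt_0; auto).
          assert (B : (0 <= r0 / Cmod w <= 1)%R).
          { split; [apply Rdiv_le_0_compat; lra|apply Rle_div_l; lra]. }
          exists (RtoC (r0 / Cmod w) * w). split.
          + rewrite Cmod_mult, Cmod_R, Rabs_right by lra. apply Req_le. field. lra.
          + replace (w - RtoC (r0 / Cmod w) * w) with (RtoC (1 - r0 / Cmod w) * w)
              by (rewrite RtoC_minus; ring).
            rewrite Cmod_mult, Cmod_R, Rabs_right by lra.
            replace ((1 - r0 / Cmod w) * Cmod w)%R with (Cmod w - r0)%R by (field; lra). lra. }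
      destruct Pick as [z [Z1 Z2]]. destruct (K z Z1) as [u [d' [_ [K1 [K2 K3]]]]].
      apply K1. replace (w - u) with ((w - z) + (z - u)) by ring.
      eapply Rle_lt_trans; [apply Cmod_triangle|]. lra.
Qed.

Lemma Re_div_one_minus (u : C) : Cmod u = 1%R -> u <> 1 -> Re (u / (1 - u)) = (- (1 / 2))%R.
Proof.
  intros H N.
  assert (N' : 1 - u <> 0) by (apply Cminus_eq_contra; auto).
  assert (E := Cmod2_alt u). rewrite H in E.
  assert (Q : ((1 - Re u) ^ 2 + Im u ^ 2 <> 0)%R).
  { intros K. apply N'. apply Cmod_eq_0. apply Rsqr_0_uniq.
    rewrite Rsqr_pow2, Cmod2_alt, Re_minus, Im_minus, re_RtoC, im_RtoC.
    transitivity ((1 - Re u) ^ 2 + Im u ^ 2)%R; [ring|exact K]. }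
  assert (X : Re (u / (1 - u)) =
    ((Re u * (1 - Re u) - Im u ^ 2) / ((1 - Re u) ^ 2 + Im u ^ 2))%R).
  { destruct u as [a b]. unfold Re, Im in *; simpl in *. field.
    intros Z. apply Q. rewrite <- Z. ring. }
  rewrite X. apply Rmult_eq_reg_r with ((1 - Re u) ^ 2 + Im u ^ 2)%R; [|exact Q].
  field_simplify; [|exact Q]. nra.
Qed.

(** Let s = 1 - exp (-F). If |s| reached 1, it would do so first at some z0, and
    |s| < 1 for |z| < |z0| gives |s (z0 p)| <= |p| by Schwarz's lemma. Then
    [boundary_derivative] yields z0 s'(z0) = k s(z0) with k >= 1, that is
    z0 F'(z0) = k u / (1 - u) with |u| = 1, whose real part is -k/2 <= -1/2. *)
Lemma one_minus_exp_bounded (F : C -> C) :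
  holomorphic F -> F 0 = 0 ->
  (forall z, disk z -> (- (1 / 2) < Re (z * C_derive F z))%R) ->
  forall z, disk z -> (Cmod (1 - Cexp (- F z)) < 1)%R.
Proof.
  intros HF F0 HR z1 Hz1. apply Rnot_le_lt. intros L.
  set (s := fun z => 1 - Cexp (- F z)).
  assert (Ds : forall z, disk z -> is_Cderive s z (C_derive F z * (1 - s z))).
  { intros z Hz. apply is_Cderive_eq with (0 - (- C_derive F z) * Cexp (- F z)).
    - unfold s. ring.
    - apply is_Cderive_minus; [apply is_Cderive_const|].
      apply (is_Cderive_Cexp_comp (fun z => - F z)).
      apply is_Cderive_opp, holomorphic_is_Cderive; auto. }
  assert (Hs : holomorphic s) by (intros z Hz; eexists; apply Ds; auto).
  assert (s0 : s 0 = 0).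
  { unfold s. rewrite F0. replace (- (0)) with (RtoC 0) by ring. rewrite Cexp_0. ring. }
  destruct (first_exit s z1 Hs Hz1 L) as [z0 [Hz0 [E1 Hlt]]].
  assert (P0 : (0 < Cmod z0)%R).
  { apply Cmod_gt_0. intros ->. rewrite s0, Cmod_0 in E1. lra. }
  set (G := fun p => s (z0 * p)).
  assert (In : forall p, (Cmod p <= 1)%R -> disk (z0 * p)).
  { intros p Hp. unfold disk in *. rewrite Cmod_mult. assert (Q := Cmod_ge_0 p). nra. }
  assert (DG : forall p, (Cmod p <= 1)%R ->
    is_Cderive G p (z0 * 1 * (C_derive F (z0 * p) * (1 - s (z0 * p))))).
  { intros p Hp. apply (is_Cderive_comp s (fun p => z0 * p)).
    - apply Ds, In, Hp.
    - apply is_Cderive_scal, is_Cderive_id. }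
  assert (HG : holomorphic G).
  { intros p Hp. eexists. apply DG. apply Rlt_le, Hp. }
  assert (G0 : G 0 = 0) by (unfold G; rewrite Cmult_0_r; exact s0).
  assert (G1 : G 1 = s z0) by (unfold G; f_equal; ring).
  assert (Gb : forall p, disk p -> (Cmod (G p) <= 1)%R).
  { intros p Hp. apply Rlt_le, Hlt. rewrite Cmod_mult. unfold disk in Hp. nra. }
  assert (D1 := DG 1 ltac:(rewrite Cmod_1; lra)). rewrite !Cmult_1_r in D1.
  destruct (schwarz G HG G0 Gb) as [Sch _].
  assert (M1 : Cmod (G 1) = 1%R).
  { apply Rle_antisym; [|rewrite G1; exact E1].
    apply (ray_into_disk G _ D1 Gb). }
  destruct (boundary_derivative G _ D1 Sch M1) as [B1 B2].
  rewrite G1 in *. set (u := s z0) in *.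
  assert (Nu : u <> 1).
  { intros K. unfold u, s in K. apply (Cexp_neq_0 (- F z0)).
    replace (Cexp (- F z0)) with (1 - (1 - Cexp (- F z0))) by ring. rewrite K. ring. }
  set (k := Cconj u * (z0 * (C_derive F z0 * (1 - u)))) in *.
  assert (N1 : 1 - u <> 0) by (apply Cminus_eq_contra; auto).
  assert (Uu : u * Cconj u = 1).
  { rewrite <- Cmod2_conj, M1. f_equal. ring. }
  assert (Ez : z0 * C_derive F z0 = RtoC (Re k) * (u / (1 - u))).
  { replace (RtoC (Re k)) with k by (apply C_ext; [reflexivity|rewrite im_RtoC; exact B1]).
    unfold k. replace (z0 * C_derive F z0) with ((u * Cconj u) * (z0 * C_derive F z0))
      by (rewrite Uu; ring). field. auto. }
  specialize (HR z0 Hz0). rewrite Ez, re_scal_l, Re_div_one_minus in HR by auto. lra.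
Qed.

(** F is subordinate to -log (1 - z). The values of 1 - s lie in the right
    half-plane, so -F and Clog (1 - s) are two branches of the same logarithm. *)
Lemma subordination_log (F : C -> C) :
  holomorphic F -> F 0 = 0 ->
  (forall z, disk z -> (- (1 / 2) < Re (z * C_derive F z))%R) ->
  exists s, (forall z, disk z -> F z = - Clog (1 - s z)) /\
    (forall z, disk z -> (Cmod (s z) <= Cmod z)%R) /\
    (forall a, disk a -> a <> 0 -> Cmod (s a) = Cmod a ->
       exists c, Cmod c = 1%R /\ forall z, disk z -> s z = c * z).
Proof.
  intros HF F0 HR. assert (B := one_minus_exp_bounded F HF F0 HR).
  set (s := fun z => 1 - Cexp (- F z)). exists s.
  assert (Hs : holomorphic s).
  { intros z Hz. eexists. apply is_Cderive_minus; [apply is_Cderive_const|].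
    apply (is_Cderive_Cexp_comp (fun z => - F z)).
    apply is_Cderive_opp, holomorphic_is_Cderive; auto. }
  assert (s0 : s 0 = 0).
  { unfold s. rewrite F0. replace (- (0)) with (RtoC 0) by ring. rewrite Cexp_0. ring. }
  destruct (schwarz s Hs s0 (fun z Hz => Rlt_le _ _ (B z Hz))) as [S1 [_ S3]].
  split; [|split; auto].
  assert (Rp : forall z, disk z -> (0 < Re (1 - s z))%R).
  { intros z Hz. specialize (B z Hz). fold (s z) in B.
    assert (Q := re_le_Cmod (s z)). apply Rabs_le_between in Q.
    rewrite Re_minus, re_RtoC. lra. }
  intros z Hz.
  assert (E : - F z = Clog (1 - s z)).
  { apply (log_unique_on_disc (fun z => - F z) (fun z => Clog (1 - s z)) 1); [| | | |exact Hz].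
    - intros w Hw. eexists. apply is_Cderive_opp, holomorphic_is_Cderive; auto.
    - intros w Hw. eexists. apply (is_Cderive_comp Clog (fun z => 1 - s z)).
      + apply is_Cderive_Clog, Rp, Hw.
      + apply is_Cderive_minus; [apply is_Cderive_const|].
        apply holomorphic_is_Cderive; auto.
    - intros w Hw. rewrite Cexp_Clog by (apply Re_pos_neq_0, Rp, Hw).
      unfold s. ring.
    - rewrite F0, s0. replace (1 - 0) with (RtoC 1) by ring. rewrite Clog_1. ring. }
  rewrite <- E. ring.
Qed.

Lemma Re_inv (z : C) : z <> 0 -> Re (/ z) = (Re z / Cmod z ^ 2)%R.
Proof.
  intros N. assert (P : (0 < Cmod z ^ 2)%R) by (apply pow_lt, Cmod_gt_0; auto).
  rewrite Cmod2_alt in *. destruct z as [a b]. unfold Re, Im in *; simpl in *.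
  field. lra.
Qed.

Lemma Re_inv_pos (z : C) : (0 < Re z)%R -> (0 < Re (/ z))%R.
Proof.
  intros H. assert (N := Re_pos_neq_0 z H). rewrite Re_inv by auto.
  apply Rdiv_lt_0_compat; auto. apply pow_lt, Cmod_gt_0; auto.
Qed.

Lemma Clog_inv (a : C) : (0 < Re a)%R -> Clog (/ a) = - Clog a.
Proof.
  intros H. assert (N := Re_pos_neq_0 a H).
  assert (E := Clog_mult a (/ a) H (Re_inv_pos a H)).
  rewrite Cinv_r, Clog_1 in E by auto.
  replace (Clog (/ a)) with ((Clog a + Clog (/ a)) - Clog a) by ring.
  rewrite <- E. ring.
Qed.

(** The derivative 1/w of the logarithm has positive real part on the convex right
    half-plane; this is the Noshiro-Warschawski criterion for injectivity. *)
Lemma Clog_monotone (a b : C) : (0 < Re a)%R -> (0 < Re b)%R -> a <> b ->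
  (0 < Re ((Clog a - Clog b) * Cconj (a - b)))%R.
Proof.
  intros Ha Hb N.
  assert (Sg : forall s : R, (0 <= s <= 1)%R -> (0 < Re (b + s * (a - b)))%R).
  { intros s Hs. rewrite re_plus, re_scal_l, Re_minus.
    destruct (Rle_lt_dec s (1 / 2)); nra. }
  destruct (Re_mean_value (fun w => Cconj (a - b) * Clog w)
    (fun w => Cconj (a - b) * / w) b a) as [s [Hs E]].
  { intros s Hs. apply is_Cderive_scal, is_Cderive_Clog, Sg, Hs. }
  replace ((Clog a - Clog b) * Cconj (a - b)) with
    (Cconj (a - b) * Clog a - Cconj (a - b) * Clog b) by ring.
  rewrite E. specialize (Sg s Hs). set (w := b + s * (a - b)) in *.
  assert (M : (0 < Cmod (a - b) ^ 2)%R).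
  { apply pow_lt, Cmod_gt_0, Cminus_eq_contra, N. }
  replace (Cconj (a - b) * / w * (a - b)) with
    (((a - b) * Cconj (a - b)) * / w) by ring.
  rewrite <- Cmod2_conj, re_scal_l.
  apply Rmult_lt_0_compat; [exact M|apply Re_inv_pos, Sg].
Qed.

Lemma Re_one_minus_pos (z : C) : disk z -> (0 < Re (1 - z))%R.
Proof.
  intros H. unfold disk in H. assert (Q := re_le_Cmod z).
  apply Rabs_le_between in Q. rewrite Re_minus, re_RtoC. lra.
Qed.

Lemma disk_mult (c z : C) : (Cmod c <= 1)%R -> disk z -> disk (c * z).
Proof.
  unfold disk. intros Hc Hz. rewrite Cmod_mult.
  assert (P := Cmod_ge_0 z). assert (Q := Cmod_ge_0 c). nra.
Qed.

Lemma Re_inv_one_minus (c : C) : (Cmod c <= 1)%R -> c <> 1 ->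
  (1 / 2 <= Re (/ (1 - c)))%R.
Proof.
  intros H N. assert (N' : 1 - c <> 0) by (apply Cminus_eq_contra; auto).
  rewrite Re_inv by auto.
  assert (P : (0 < Cmod (1 - c) ^ 2)%R) by (apply pow_lt, Cmod_gt_0; auto).
  apply (Rle_div_r (1 / 2) _ _ P). rewrite Cmod2_alt, Re_minus, Im_minus, re_RtoC, im_RtoC.
  assert (E := Cmod2_alt c). assert (Pc := Cmod_ge_0 c). nra.
Qed.

Lemma Re_inv_one_minus_disk (z : C) : disk z -> (1 / 2 < Re (/ (1 - z)))%R.
Proof.
  intros H. assert (N' := Re_pos_neq_0 _ (Re_one_minus_pos z H)).
  rewrite Re_inv by auto.
  assert (P : (0 < Cmod (1 - z) ^ 2)%R) by (apply pow_lt, Cmod_gt_0; auto).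
  apply (Rlt_div_r (1 / 2) _ _ P). rewrite Cmod2_alt, Re_minus, Im_minus, re_RtoC, im_RtoC.
  assert (E := Cmod2_alt z). assert (Pc := Cmod_ge_0 z). unfold disk in H. nra.
Qed.

Lemma Omega_Re_inv (mu : C) : Omega mu -> (1 / 2 <= Re (/ mu))%R.
Proof.
  intros [H N].
  replace (/ mu) with (/ (1 - (1 - mu))) by (f_equal; ring).
  apply Re_inv_one_minus.
  - replace (1 - mu) with (- (mu - 1)) by ring. rewrite Cmod_opp. exact H.
  - intros E. apply N. replace mu with (1 - (1 - mu)) by ring. rewrite E. ring.
Qed.

(** * The extremal functions *)

(** The branch of the logarithm of (1 - z) / (1 - c z) ^ (1 - beta). *)
Definition extremal_log (beta : R) (c z : C) : C :=
  Clog (1 - z) - RtoC (1 - beta) * Clog (1 - c * z).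

Definition extremal_fun (mu : C) (beta : R) (c z : C) : C :=
  Cexp (mu * extremal_log beta c z).

Lemma is_Cderive_Clog_one_minus (c z : C) : (Cmod c <= 1)%R -> disk z ->
  is_Cderive (fun w => Clog (1 - c * w)) z (- (c / (1 - c * z))).
Proof.
  intros Hc Hz.
  assert (Rp := Re_one_minus_pos _ (disk_mult c z Hc Hz)).
  apply is_Cderive_eq with ((0 - c * 1) * / (1 - c * z)).
  - field. apply Re_pos_neq_0, Rp.
  - apply (is_Cderive_comp Clog (fun w => 1 - c * w)).
    + apply is_Cderive_Clog, Rp.
    + apply is_Cderive_minus; [apply is_Cderive_const|].
      apply is_Cderive_scal, is_Cderive_id.
Qed.

Lemma is_Cderive_Clog_one_minus_id (z : C) : disk z ->
  is_Cderive (fun w => Clog (1 - w)) z (- (1 / (1 - z))).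
Proof.
  intros Hz.
  assert (D := is_Cderive_Clog_one_minus 1 z ltac:(rewrite Cmod_1; lra) Hz).
  rewrite Cmult_1_l in D.
  apply is_Cderive_ext_near with (fun w => Clog (1 - 1 * w)) 1%R; [lra| |exact D].
  intros w _. rewrite Cmult_1_l. reflexivity.
Qed.

Lemma is_Cderive_extremal_log (beta : R) (c z : C) : (Cmod c <= 1)%R -> disk z ->
  is_Cderive (extremal_log beta c) z (RtoC (1 - beta) * (c / (1 - c * z)) - 1 / (1 - z)).
Proof.
  intros Hc Hz.
  apply is_Cderive_eq with
    (- (1 / (1 - z)) - RtoC (1 - beta) * (- (c / (1 - c * z)))); [ring|].
  apply is_Cderive_minus; [apply is_Cderive_Clog_one_minus_id; auto|].
  apply is_Cderive_scal, is_Cderive_Clog_one_minus; auto.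
Qed.

Lemma extremal_log_0 (beta : R) (c : C) : extremal_log beta c 0 = 0.
Proof.
  unfold extremal_log. rewrite Cmult_0_r. replace (1 - 0) with (RtoC 1) by ring.
  rewrite Clog_1. ring.
Qed.

Lemma is_Cderive_extremal_fun (mu : C) (beta : R) (c z : C) : (Cmod c <= 1)%R -> disk z ->
  is_Cderive (extremal_fun mu beta c) z
    (mu * (RtoC (1 - beta) * (c / (1 - c * z)) - 1 / (1 - z)) * extremal_fun mu beta c z).
Proof.
  intros Hc Hz. apply (is_Cderive_Cexp_comp (fun z => mu * extremal_log beta c z)).
  apply is_Cderive_scal, is_Cderive_extremal_log; auto.
Qed.

Lemma extremal_fun_log_branch (mu : C) (beta : R) (c : C) : (Cmod c <= 1)%R ->
  is_log_branch (extremal_fun mu beta c) (fun z => mu * extremal_log beta c z).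
Proof.
  intros Hc. repeat split.
  - intros z Hz. eexists. apply is_Cderive_scal, is_Cderive_extremal_log; auto.
  - rewrite extremal_log_0. ring.
Qed.

Lemma quotient_value_ext (mu : C) (beta : R) (c z : C) :
  mu <> 0 -> (Cmod c <= 1)%R -> disk z ->
  quotient_value mu (extremal_fun mu beta c) z = princ_pow (1 - c * z) (RtoC (1 - beta)).
Proof.
  intros Nm Hc Hz. unfold quotient_value, pow_branch, princ_pow.
  rewrite (log_branch_eq _ _ z (extremal_fun_log_branch mu beta c Hc) Hz).
  rewrite <- (Cexp_Clog (1 - z)) at 1 by (apply Re_pos_neq_0, Re_one_minus_pos, Hz).
  rewrite <- Cexp_minus. f_equal. unfold extremal_log. field. exact Nm.
Qed.

Lemma derivative_value_ext (mu : C) (beta : R) (c z : C) :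
  mu <> 0 -> (Cmod c <= 1)%R -> disk z ->
  derivative_value mu (extremal_fun mu beta c) z = RtoC (1 - beta) * (c / (1 - c * z)).
Proof.
  intros Nm Hc Hz. unfold derivative_value.
  rewrite (is_C_derive_unique _ _ _ (is_Cderive_extremal_fun mu beta c z Hc Hz)).
  assert (N1 := Re_pos_neq_0 _ (Re_one_minus_pos z Hz)).
  assert (N2 := Re_pos_neq_0 _ (Re_one_minus_pos _ (disk_mult c z Hc Hz))).
  assert (N3 : extremal_fun mu beta c z <> 0) by apply Cexp_neq_0.
  field. auto.
Qed.

(** The bracket D has Im D in (-pi, pi), because all four arguments lie in
    (-pi/2, pi/2). If exp (mu D) = 1 then D = 2 pi i k / mu, and
    |Im D| = 2 pi |k| Re (1 / mu) >= pi |k| since mu is in Omega; so k = 0 and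
    D = 0. By [Clog_monotone], D = 0 is impossible for distinct u and u'. *)
Lemma exponent_injective (mu u u' v v' : C) (beta : R) :
  Omega mu -> (0 <= beta < 1)%R ->
  (0 < Re u)%R -> (0 < Re u')%R -> (0 < Re v)%R -> (0 < Re v')%R ->
  (v - v' = u - u' \/ (0 < beta)%R /\ v = v') ->
  Cexp (mu * (RtoC beta * (Clog u - Clog u') + RtoC (1 - beta) * (Clog v - Clog v'))) = 1 ->
  u = u'.
Proof.
  intros Hm Hb Hu Hu' Hv Hv' Hd HE.
  set (D := RtoC beta * (Clog u - Clog u') + RtoC (1 - beta) * (Clog v - Clog v')) in *.
  assert (Nm : mu <> 0) by apply Hm.
  assert (PP := PI_RGT_0).
  destruct (Cexp_eq_1 _ HE) as [k [K1 K2]].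
  assert (ID : (- PI < Im D < PI)%R).
  { assert (A1 := Im_Clog_right_half_plane u Hu).
    assert (A2 := Im_Clog_right_half_plane u' Hu').
    assert (A3 := Im_Clog_right_half_plane v Hv).
    assert (A4 := Im_Clog_right_half_plane v' Hv').
    unfold D. rewrite im_plus, !im_scal_l, !Im_minus.
    split; nra. }
  assert (ED : D = / mu * (mu * D)) by (field; auto).
  assert (IE : Im D = (2 * IZR k * PI * Re (/ mu))%R).
  { rewrite ED, im_mult, K1, K2. ring. }
  assert (Hr := Omega_Re_inv mu Hm).
  assert (k0 : k = 0%Z).
  { destruct (Z.lt_trichotomy k 0) as [L|[E|L]]; [|exact E|]; exfalso.
    - assert (Q : (IZR k <= -1)%R) by (apply (IZR_le k (-1)); lia).
      assert (IZR k * Re (/ mu) <= - (1 / 2))%R by nra. nra.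
    - assert (Q : (1 <= IZR k)%R) by (apply (IZR_le 1 k); lia).
      assert (1 / 2 <= IZR k * Re (/ mu))%R by nra. nra. }
  subst k.
  assert (D0 : D = 0).
  { rewrite ED. replace (mu * D) with (RtoC 0); [ring|].
    symmetry. apply C_ext; [rewrite K1|rewrite K2]; simpl; ring. }
  destruct (Ceq_dec u u') as [E|N]; [exact E|exfalso].
  assert (Mu := Clog_monotone u u' Hu Hu' N).
  assert (Z : Re (D * Cconj (u - u')) = 0%R) by (rewrite D0, Cmult_0_l; apply re_RtoC).
  unfold D in Z. rewrite Cmult_plus_distr_r, re_plus, <- !Cmult_assoc, !re_scal_l in Z.
  destruct Hd as [Hd|[Hbp Hd]].
  - assert (Nv : v <> v').
    { intros E. apply N. apply Ceq_minus. rewrite <- Hd, E. ring. }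
    assert (Mv := Clog_monotone v v' Hv Hv' Nv). rewrite Hd in Mv. nra.
  - rewrite Hd in Z. replace (Clog v' - Clog v') with (RtoC 0) in Z by ring.
    rewrite Cmult_0_l, re_RtoC in Z. nra.
Qed.

(** In the variable u = 1 / (1 - z), which ranges over Re u > 1/2, one has
    1 - c z = (1 - c) v / u with v = u + c / (1 - c), and v stays in the right
    half-plane because Re (1 / (1 - c)) >= 1/2. This puts the exponent in the form
    of [exponent_injective]. For c = 1 one has 1 - c z = 1 / u, and v = 1. *)
Lemma extremal_log_change (beta : R) (c : C) : (Cmod c <= 1)%R ->
  let u := fun z => / (1 - z) in
  exists (v : C -> C) (k : C),
    (forall z, disk z -> (0 < Re (u z))%R) /\
    (forall z, disk z -> (0 < Re (v z))%R) /\
    (c <> 1 -> forall z w, v z - v w = u z - u w) /\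
    (c = 1 -> forall z w, v z = v w) /\
    forall z, disk z ->
      extremal_log beta c z = - (RtoC beta * Clog (u z) + RtoC (1 - beta) * Clog (v z)) + k.
Proof.
  intros Hc u.
  assert (Ru : forall z, disk z -> (0 < Re (u z))%R).
  { intros z Hz. apply Re_inv_pos, Re_one_minus_pos, Hz. }
  assert (Lu : forall z, disk z -> Clog (1 - z) = - Clog (u z)).
  { intros z Hz. unfold u. rewrite Clog_inv by (apply Re_one_minus_pos, Hz). ring. }
  destruct (Ceq_dec c 1) as [->|N].
  - exists (fun _ => 1), 0. repeat split; auto.
    + intros z _. rewrite re_RtoC. lra.
    + intros K. contradiction.
    + intros z Hz. unfold extremal_log. rewrite Cmult_1_l, Lu, Clog_1 by auto.
      rewrite RtoC_minus. ring.
  - assert (N' : 1 - c <> 0) by (apply Cminus_eq_contra; auto).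
    set (v := fun z => u z + c / (1 - c)).
    assert (Rv : forall z, disk z -> (0 < Re (v z))%R).
    { intros z Hz. unfold v. rewrite re_plus.
      replace (c / (1 - c)) with (/ (1 - c) - 1) by (field; auto).
      rewrite Re_minus, re_RtoC.
      assert (A := Re_inv_one_minus c Hc N).
      assert (B := Re_inv_one_minus_disk z Hz). fold (u z) in B. lra. }
    assert (Dsk1 : forall z, disk z -> 1 - z <> 0)
      by (intros; apply Re_pos_neq_0, Re_one_minus_pos; auto).
    assert (u0 : u 0 = 1) by (unfold u; field).
    assert (v0 : v 0 = / (1 - c)) by (unfold v; rewrite u0; field; auto).
    assert (Du : forall z, disk z -> exists l, is_Cderive u z l).
    { intros z Hz. eexists. apply is_Cderive_inv; [apply Dsk1; auto|].
      apply is_Cderive_minus; [apply is_Cderive_const|apply is_Cderive_id]. }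
    (* Both sides are logarithms of 1 - c z vanishing at 0; pointwise, the sum of
       arguments on the right could be off by a multiple of 2 pi. *)
    assert (Lv : forall z, disk z -> Clog (1 - c * z) = Clog (v z) - Clog (u z) - Clog (v 0)).
    { apply (log_unique_on_disc (fun z => Clog (1 - c * z))
        (fun z => Clog (v z) - Clog (u z) - Clog (v 0)) 1).
      - intros z Hz. eexists. apply is_Cderive_Clog_one_minus; auto.
      - intros z Hz. destruct (Du z Hz) as [l Hl]. eexists.
        apply is_Cderive_minus; [|apply is_Cderive_const].
        apply is_Cderive_minus.
        + apply (is_Cderive_comp Clog v); [apply is_Cderive_Clog, Rv, Hz|].
          apply is_Cderive_plus; [exact Hl|apply is_Cderive_const].
        + apply (is_Cderive_comp Clog u); [apply is_Cderive_Clog, Ru, Hz|exact Hl].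
      - intros z Hz.
        rewrite !Cexp_minus, !Cexp_Clog;
          try (apply Re_pos_neq_0; auto using disk_0; fail).
        + rewrite v0. unfold v, u. field. auto.
        + apply Re_pos_neq_0, Re_one_minus_pos, disk_mult; auto.
      - rewrite Cmult_0_r, u0. replace (1 - 0) with (RtoC 1) by ring.
        rewrite Clog_1. ring. }
    exists v, (RtoC (1 - beta) * Clog (v 0)). repeat split; auto.
    + intros _ z w. unfold v. ring.
    + intros E. contradiction.
    + intros z Hz. unfold extremal_log. rewrite Lu, Lv by auto. rewrite RtoC_minus. ring.
Qed.

Lemma extremal_fun_univalent (mu : C) (beta : R) (c : C) :
  Omega mu -> (0 <= beta < 1)%R -> (Cmod c <= 1)%R -> (c <> 1 \/ (0 < beta)%R) ->
  univalent (extremal_fun mu beta c).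
Proof.
  intros Hm Hb Hc Hd. split.
  { intros z Hz. eexists. apply is_Cderive_extremal_fun; auto. }
  intros z w Hz Hw E.
  assert (LC := extremal_log_change beta c Hc). cbv zeta in LC.
  destruct LC as [v [k [Ru [Rv [V1 [V2 L]]]]]].
  assert (Eu : / (1 - z) = / (1 - w)).
  { apply (exponent_injective mu (/ (1 - z)) (/ (1 - w)) (v z) (v w) beta);
      try (apply Hb); auto.
    - destruct (Ceq_dec c 1) as [C1|C1]; [|left; apply V1; auto].
      right. split; [|apply V2; auto]. destruct Hd; [contradiction|auto].
    - unfold extremal_fun in E. rewrite !L in E by auto.
      match goal with |- Cexp ?a = _ => replace a with
        (mu * (- (RtoC beta * Clog (/ (1 - w)) + RtoC (1 - beta) * Clog (v w)) + k)
         - mu * (- (RtoC beta * Clog (/ (1 - z)) + RtoC (1 - beta) * Clog (v z)) + k)) by ring end.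
      rewrite Cexp_minus, <- E. field. apply Cexp_neq_0. }
  assert (N1 := Re_pos_neq_0 _ (Re_one_minus_pos z Hz)).
  assert (N2 := Re_pos_neq_0 _ (Re_one_minus_pos w Hw)).
  replace z with (1 - / (/ (1 - z))) by (field; auto). rewrite Eu. field. auto.
Qed.

Lemma Re_div_one_minus_disk (q : C) : disk q -> (- (1 / 2) < Re (q / (1 - q)))%R.
Proof.
  intros Hq. assert (N := Re_pos_neq_0 _ (Re_one_minus_pos q Hq)).
  replace (q / (1 - q)) with (/ (1 - q) - 1) by (field; auto).
  rewrite Re_minus, re_RtoC. assert (B := Re_inv_one_minus_disk q Hq). lra.
Qed.

Lemma G_condition_derivative_value (mu : C) (f : C -> C) (z : C) : mu <> 0 -> f z <> 0 -> disk z ->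
  2 / mu * (z * C_derive f z / f z) + (1 + z) / (1 - z) =
  1 + 2 * (z * derivative_value mu f z).
Proof.
  intros Nm Nf Hz. assert (N := Re_pos_neq_0 _ (Re_one_minus_pos z Hz)).
  unfold derivative_value. field. auto.
Qed.

(** Twice z times the derivative value is 2 (1 - beta) q / (1 - q) with q = c z in
    the disc, whose real part exceeds -(1 - beta). For beta = 0 and c = 1 the
    function is the constant 1. *)
Theorem extremal_fun_in_G (mu : C) (beta : R) (c : C) :
  Omega mu -> (0 <= beta < 1)%R -> (Cmod c <= 1)%R -> G mu beta (extremal_fun mu beta c).
Proof.
  intros Hm Hb Hc. assert (Nm : mu <> 0) by apply Hm. split; [|split].
  - destruct (classic (c <> 1 \/ (0 < beta)%R)) as [H|H].
    + left. apply extremal_fun_univalent; auto.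
    + right. apply not_or_and in H. destruct H as [H1 H2].
      apply NNPP in H1. assert (b0 : beta = 0%R) by lra. subst.
      intros z Hz. unfold extremal_fun, extremal_log. rewrite Cmult_1_l.
      replace (RtoC (1 - 0)) with (RtoC 1) by (f_equal; ring).
      replace (mu * (Clog (1 - z) - 1 * Clog (1 - z))) with (RtoC 0) by ring.
      apply Cexp_0.
  - unfold extremal_fun. rewrite extremal_log_0, Cmult_0_r. apply Cexp_0.
  - intros z Hz. assert (Nf : extremal_fun mu beta c z <> 0) by apply Cexp_neq_0.
    split; [exact Nf|].
    rewrite G_condition_derivative_value, derivative_value_ext by auto.
    assert (Hcz := disk_mult c z Hc Hz).
    assert (N := Re_pos_neq_0 _ (Re_one_minus_pos _ Hcz)).
    replace (1 + 2 * (z * (RtoC (1 - beta) * (c / (1 - c * z))))) with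
      (1 + RtoC (2 * (1 - beta)) * ((c * z) / (1 - c * z)))
      by (rewrite RtoC_mult; field; auto).
    rewrite re_plus, re_RtoC, re_scal_l.
    assert (B := Re_div_one_minus_disk (c * z) Hcz). nra.
Qed.

(** * Members of the class in terms of F *)

Lemma Copp_opp (z : C) : - - z = z.
Proof. ring. Qed.

(** An exponent in (0, 1] keeps the arguments inside (-pi/2, pi/2), where the
    exponential can be undone by the principal logarithm. *)
Lemma princ_pow_inj (a b : C) (r : R) :
  (0 < Re a)%R -> (0 < Re b)%R -> (0 < r <= 1)%R ->
  princ_pow a (RtoC r) = princ_pow b (RtoC r) -> a = b.
Proof.
  intros Ha Hb Hr E. unfold princ_pow in E. apply (f_equal Clog) in E.
  assert (PP := PI_RGT_0).
  assert (A := Im_Clog_right_half_plane a Ha).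
  assert (B := Im_Clog_right_half_plane b Hb).
  rewrite !Clog_Cexp in E by (rewrite im_scal_l; split; nra).
  assert (N : RtoC r <> 0) by (intros K; apply RtoC_inj in K; lra).
  rewrite <- (Cexp_Clog a), <- (Cexp_Clog b) by (apply Re_pos_neq_0; auto).
  f_equal. replace (Clog a) with (RtoC r * Clog a / RtoC r) by (field; auto).
  rewrite E. field. auto.
Qed.

Lemma G_holomorphic (mu : C) (beta : R) (f : C -> C) : G mu beta f -> holomorphic f.
Proof.
  intros [[[H _]|H] _]; [exact H|]. intros z Hz. exists (RtoC 0).
  apply (is_Cderive_ext_disk (fun _ => 1)); auto using is_Cderive_const.
  intros w Hw. symmetry. auto.
Qed.

(** F is (log f / mu - log (1 - z)) / (1 - beta). Both functionals and f itself are
    expressed by F, and the inequality defining the class becomes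
    Re (z F') > -1/2. *)
Lemma G_normal_form (mu : C) (beta : R) (f : C -> C) :
  Omega mu -> (0 <= beta < 1)%R -> G mu beta f ->
  exists F : C -> C, holomorphic F /\ F 0 = 0 /\
    (forall z, disk z -> (- (1 / 2) < Re (z * C_derive F z))%R) /\
    forall z, disk z ->
      derivative_value mu f z = RtoC (1 - beta) * C_derive F z /\
      quotient_value mu f z = Cexp (RtoC (1 - beta) * - F z) /\
      f z = Cexp (mu * (Clog (1 - z) + RtoC (1 - beta) * F z)).
Proof.
  intros Hm Hb HG. assert (Nm : mu <> 0) by apply Hm.
  assert (Hf := G_holomorphic mu beta f HG).
  destruct HG as [_ [f0 HG]].
  assert (Nf : forall z, disk z -> f z <> 0) by (intros z Hz; apply HG, Hz).
  assert (HL := log_branch_spec f Hf Nf f0).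
  set (L := log_branch f) in *.
  assert (Nb : RtoC (1 - beta) <> 0) by (intros K; apply RtoC_inj in K; lra).
  set (F := fun z => (L z * / mu - Clog (1 - z)) * / RtoC (1 - beta)).
  assert (DF : forall z, disk z -> is_Cderive F z (derivative_value mu f z / RtoC (1 - beta))).
  { intros z Hz. assert (N1 := Re_pos_neq_0 _ (Re_one_minus_pos z Hz)).
    apply is_Cderive_eq with
      (/ RtoC (1 - beta) * (/ mu * (C_derive f z / f z) - - (1 / (1 - z)))).
    - unfold derivative_value. field. auto.
    - apply (is_Cderive_ext_near
        (fun z => / RtoC (1 - beta) * (/ mu * L z - Clog (1 - z))) F z _ 1 Rlt_0_1).
      { intros w _. unfold F. ring. }
      apply is_Cderive_scal, is_Cderive_minus.
      + apply is_Cderive_scal, is_log_branch_derive; auto.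
      + apply is_Cderive_Clog_one_minus_id; auto. }
  assert (EF : forall z, disk z -> derivative_value mu f z = RtoC (1 - beta) * C_derive F z).
  { intros z Hz. rewrite (is_C_derive_unique _ _ _ (DF z Hz)). field. auto. }
  exists F. split; [|split; [|split]].
  - intros z Hz. eexists. apply DF; auto.
  - unfold F. destruct HL as [_ [L0 _]]. rewrite L0. replace (1 - 0) with (RtoC 1) by ring.
    rewrite Clog_1. ring.
  - intros z Hz. destruct (HG z Hz) as [_ HR].
    rewrite (G_condition_derivative_value mu f z Nm (Nf z Hz) Hz), (EF z Hz) in HR.
    replace (1 + 2 * (z * (RtoC (1 - beta) * C_derive F z))) with
      (1 + RtoC (2 * (1 - beta)) * (z * C_derive F z)) in HR
      by (rewrite RtoC_mult; ring).
    rewrite re_plus, re_RtoC, re_scal_l in HR.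
    apply Rmult_lt_reg_l with (2 * (1 - beta))%R; lra.
  - intros z Hz. split; [apply EF; auto|]. destruct HL as [_ [_ EL]]. split.
    + unfold quotient_value, pow_branch. fold L.
      rewrite <- (Cexp_Clog (1 - z)) at 1 by (apply Re_pos_neq_0, Re_one_minus_pos, Hz).
      rewrite <- Cexp_minus. f_equal. unfold F. field. auto.
    + rewrite <- EL by auto. f_equal. unfold F. field. auto.
Qed.

(** * The disc of derivative values *)

Lemma RtoC_neq_0 (r : R) : r <> 0%R -> RtoC r <> 0.
Proof. intros H E. apply H, RtoC_inj, E. Qed.

Lemma one_minus_Cmod2 (z : C) : disk z -> (0 < 1 - Cmod z ^ 2)%R.
Proof. unfold disk. intros H. assert (P := Cmod_ge_0 z). nra. Qed.

Lemma RtoC_one_minus_Cmod2 (z : C) : RtoC (1 - Cmod z ^ 2) = 1 - z * Cconj z.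
Proof. rewrite RtoC_minus, Cmod2_conj. reflexivity. Qed.

(** The identity behind the disc automorphisms: q and conj z are at pseudohyperbolic
    distance less than, equal to or greater than 1 as |q| is to 1. *)
Lemma Cmod2_diff (q z : C) :
  (Cmod (1 - z * q) ^ 2 - Cmod (q - Cconj z) ^ 2 =
   (1 - Cmod z ^ 2) * (1 - Cmod q ^ 2))%R.
Proof.
  rewrite !Cmod2_alt. destruct q, z. unfold Re, Im; simpl. ring.
Qed.

(** As 1 - |z|^2 = 1 - z conj z, the difference is
    (1 - beta) (q - conj z) / ((1 - z q) (1 - |z|^2)). *)
Lemma disc_distance (beta : R) (z q : C) :
  (0 <= beta < 1)%R -> disk z -> 1 - z * q <> 0 ->
  Cmod (RtoC (1 - beta) * (q / (1 - z * q)) - center beta z) =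
  (radius beta z * (Cmod (q - Cconj z) / Cmod (1 - z * q)))%R.
Proof.
  intros Hb Hz N. assert (P := one_minus_Cmod2 z Hz).
  assert (N2 : RtoC (1 - Cmod z ^ 2) <> 0) by (apply RtoC_neq_0; lra).
  unfold center, radius.
  replace (RtoC (1 - beta) * (q / (1 - z * q)) -
           RtoC (1 - beta) * Cconj z / RtoC (1 - Cmod z ^ 2)) with
    (RtoC ((1 - beta) / (1 - Cmod z ^ 2)) * ((q - Cconj z) / (1 - z * q))).
  - rewrite Cmod_mult, Cmod_R, Cmod_div by auto.
    rewrite Rabs_right; [reflexivity|]. apply Rle_ge, Rdiv_le_0_compat; lra.
  - rewrite RtoC_div by lra. rewrite RtoC_one_minus_Cmod2 in *.
    field. auto.
Qed.

Lemma radius_pos (beta : R) (z : C) : (0 <= beta < 1)%R -> disk z -> (0 < radius beta z)%R.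
Proof.
  intros Hb Hz. unfold radius. apply Rdiv_lt_0_compat; [lra|apply one_minus_Cmod2; auto].
Qed.

Lemma disc_distance_le (beta : R) (z q : C) :
  (0 <= beta < 1)%R -> disk z -> 1 - z * q <> 0 ->
  (Cmod (RtoC (1 - beta) * (q / (1 - z * q)) - center beta z) <= radius beta z)%R <->
  (Cmod q <= 1)%R.
Proof.
  intros Hb Hz N. rewrite disc_distance by auto.
  assert (Pr := radius_pos beta z Hb Hz). assert (P := one_minus_Cmod2 z Hz).
  assert (E := Cmod2_diff q z).
  assert (Pd : (0 < Cmod (1 - z * q))%R) by (apply Cmod_gt_0; auto).
  assert (Pn := Cmod_ge_0 (q - Cconj z)). assert (Pq := Cmod_ge_0 q).
  split; intros H.
  - assert (K : (Cmod (q - Cconj z) / Cmod (1 - z * q) <= 1)%R).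
    { apply Rmult_le_reg_l with (radius beta z); lra. }
    apply Rle_div_l in K; [|auto]. rewrite Rmult_1_l in K.
    apply Rnot_lt_le. intros L.
    assert (K2 := pow_incr _ _ 2 (conj Pn K)).
    assert (Q : (0 < (1 - Cmod z ^ 2) * (Cmod q ^ 2 - 1))%R)
      by (apply Rmult_lt_0_compat; nra). lra.
  - rewrite <- (Rmult_1_r (radius beta z)) at 2. apply Rmult_le_compat_l; [lra|].
    apply Rle_div_l; [auto|]. rewrite Rmult_1_l. apply Cmod_le_sq.
    assert (0 <= (1 - Cmod z ^ 2) * (1 - Cmod q ^ 2))%R by (apply Rmult_le_pos; nra). lra.
Qed.

Lemma disc_distance_eq (beta : R) (z q : C) :
  (0 <= beta < 1)%R -> disk z -> 1 - z * q <> 0 ->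
  Cmod (RtoC (1 - beta) * (q / (1 - z * q)) - center beta z) = radius beta z ->
  Cmod q = 1%R.
Proof.
  intros Hb Hz N H. rewrite disc_distance in H by auto.
  assert (Pr := radius_pos beta z Hb Hz). assert (P := one_minus_Cmod2 z Hz).
  assert (E := Cmod2_diff q z).
  assert (Pd : (0 < Cmod (1 - z * q))%R) by (apply Cmod_gt_0; auto).
  assert (Pq := Cmod_ge_0 q).
  assert (K : Cmod (q - Cconj z) = Cmod (1 - z * q)).
  { apply Rmult_eq_reg_r with (/ Cmod (1 - z * q))%R; [|apply Rinv_neq_0_compat; lra].
    rewrite Rinv_r by lra.
    apply Rmult_eq_reg_l with (radius beta z); [unfold Rdiv in H; lra|lra]. }
  rewrite K in E.
  assert ((1 - Cmod z ^ 2) * (1 - Cmod q ^ 2) = 0)%R by lra.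
  apply Rmult_integral in H0. nra.
Qed.

(** The inverse of q |-> q / (1 - z q) is y |-> y / (1 + z y). *)
Lemma disc_parameter (beta : R) (z w : C) :
  (0 <= beta < 1)%R -> disk z -> (Cmod (w - center beta z) <= radius beta z)%R ->
  exists q, (Cmod q <= 1)%R /\ w = RtoC (1 - beta) * (q / (1 - z * q)).
Proof.
  intros Hb Hz H.
  assert (Nb : RtoC (1 - beta) <> 0) by (apply RtoC_neq_0; lra).
  set (y := w / RtoC (1 - beta)).
  assert (Ew : w = RtoC (1 - beta) * y) by (unfold y; field; auto).
  assert (P := one_minus_Cmod2 z Hz).
  assert (N2 : RtoC (1 - Cmod z ^ 2) <> 0) by (apply RtoC_neq_0; lra).
  assert (N : 1 + z * y <> 0).
  { (* Otherwise z (w - center) = - radius, although |z| < 1 and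
       |w - center| <= radius. *)
    intros E. assert (Pr := radius_pos beta z Hb Hz).
    assert (K : z * (w - center beta z) = - RtoC (radius beta z)).
    { unfold center, radius. rewrite Ew, RtoC_div by lra.
      replace (z * (RtoC (1 - beta) * y - RtoC (1 - beta) * Cconj z / RtoC (1 - Cmod z ^ 2)))
        with (RtoC (1 - beta) * ((1 + z * y) - 1 - z * Cconj z / RtoC (1 - Cmod z ^ 2)))
        by (field; auto).
      rewrite E. rewrite RtoC_one_minus_Cmod2 in *. field. auto. }
    apply (f_equal Cmod) in K. rewrite Cmod_mult, Cmod_opp, Cmod_R, Rabs_right in K by lra.
    unfold disk in Hz. assert (Pz := Cmod_ge_0 z).
    assert (Pw := Cmod_ge_0 (w - center beta z)). nra. }
  assert (Nq : 1 - z * (y / (1 + z * y)) <> 0).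
  { replace (1 - z * (y / (1 + z * y))) with (/ (1 + z * y)) by (field; auto).
    apply Cmod_gt_0. rewrite Cmod_inv by auto. apply Rinv_0_lt_compat, Cmod_gt_0; auto. }
  assert (Eq : w = RtoC (1 - beta) * ((y / (1 + z * y)) / (1 - z * (y / (1 + z * y))))).
  { rewrite Ew at 1. f_equal.
    replace (1 - z * (y / (1 + z * y))) with (/ (1 + z * y)) by (field; auto).
    field. auto. }
  exists (y / (1 + z * y)). split; [|exact Eq].
  apply (disc_distance_le beta z _ Hb Hz Nq). rewrite <- Eq. exact H.
Qed.

(** With conj xi = c, the exponent mu (log (1 - z) - (1 - beta) log (1 - c z)) is
    the difference of the exponents of the two power branches. *)
Lemma extremal_form (mu : C) (beta : R) (f F : C -> C) (c : C) :
  Cmod c = 1%R ->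
  (forall z, disk z -> f z = Cexp (mu * (Clog (1 - z) + RtoC (1 - beta) * F z))) ->
  (forall z, disk z -> F z = - Clog (1 - c * z)) ->
  exists xi : C, Cmod xi = 1%R /\
    forall zeta : C, disk zeta ->
      f zeta = pow_branch (fun u => 1 - u) mu zeta /
               pow_branch (fun u => 1 - u * Cconj xi) (RtoC (1 - beta) * mu) zeta.
Proof.
  intros Hc Ef EF. exists (Cconj c). rewrite Cmod_conj, Cconj_conj. split; [exact Hc|].
  intros z Hz. unfold pow_branch.
  rewrite (log_branch_eq (fun u => 1 - u) (fun u => Clog (1 - u)) z), 
    (log_branch_eq (fun u => 1 - u * c) (fun u => Clog (1 - c * u)) z); auto.
  - rewrite <- Cexp_minus, Ef, EF by auto. f_equal. ring.
  - repeat split.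
    + intros w Hw. eexists. apply is_Cderive_Clog_one_minus; auto. lra.
    + rewrite Cmult_0_r. replace (1 - 0) with (RtoC 1) by ring. apply Clog_1.
    + intros w Hw. rewrite Cexp_Clog; [ring|].
      apply Re_pos_neq_0, Re_one_minus_pos, disk_mult; auto. lra.
  - repeat split.
    + intros w Hw. eexists. apply is_Cderive_Clog_one_minus_id; auto.
    + replace (1 - 0) with (RtoC 1) by ring. apply Clog_1.
    + intros w Hw. apply Cexp_Clog, Re_pos_neq_0, Re_one_minus_pos; auto.
Qed.

Theorem theorem2p1 :
  forall (mu : C) (beta : R), Omega mu -> (0 <= beta < 1)%R ->
  (forall z : C, disk z ->
     (forall w : C,
        (exists f : C -> C, G mu beta f /\ w = quotient_value mu f z) <->
        (exists lambda : C, (Cmod lambda <= 1)%R /\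
           w = princ_pow (1 + lambda * z) (RtoC (1 - beta)))) /\
     (forall w : C,
        (exists f : C -> C, G mu beta f /\ w = derivative_value mu f z) <->
        (Cmod (w - center beta z) <= radius beta z)%R)) /\
  (forall (f : C -> C) (z : C), G mu beta f -> disk z -> z <> 0 ->
     ((exists lambda : C, Cmod lambda = 1%R /\
         quotient_value mu f z = princ_pow (1 + lambda * z) (RtoC (1 - beta))) \/
      Cmod (derivative_value mu f z - center beta z) = radius beta z) ->
     exists xi : C, Cmod xi = 1%R /\
       forall zeta : C, disk zeta ->
         f zeta = pow_branch (fun u => 1 - u) mu zeta /
                  pow_branch (fun u => 1 - u * Cconj xi)
                             (RtoC (1 - beta) * mu) zeta).
Proof.
  intros mu beta Hm Hb. assert (Nm : mu <> 0) by apply Hm.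
  split; [intros z Hz; split; intros w; split|].
  - intros [f [HG ->]].
    destruct (G_normal_form mu beta f Hm Hb HG) as [F [HF [F0 [HR HV]]]].
    destruct (subordination_log F HF F0 HR) as [s [Es [Bs _]]].
    assert (Eq : quotient_value mu f z = princ_pow (1 - s z) (RtoC (1 - beta))).
    { destruct (HV z Hz) as [_ [Q _]]. rewrite Q, (Es z Hz), Copp_opp. reflexivity. }
    destruct (Ceq_dec z 0) as [->|N].
    + exists 0. split; [rewrite Cmod_0; lra|]. rewrite Eq. f_equal.
      specialize (Bs 0 disk_0). rewrite Cmod_0 in Bs.
      replace (s 0) with (RtoC 0); [ring|]. symmetry. apply Cmod_eq_0.
      apply Rle_antisym; [exact Bs|apply Cmod_ge_0].
    + exists (- (s z / z)). split.
      * rewrite Cmod_opp, Cmod_div by auto. apply Rle_div_l; [apply Cmod_gt_0; auto|].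
        rewrite Rmult_1_l. apply Bs, Hz.
      * rewrite Eq. f_equal. field. exact N.
  - intros [lambda [Hl ->]].
    assert (Hc : (Cmod (- lambda) <= 1)%R) by (rewrite Cmod_opp; exact Hl).
    exists (extremal_fun mu beta (- lambda)). split; [apply extremal_fun_in_G; auto|].
    rewrite quotient_value_ext by auto. f_equal. ring.
  - intros [f [HG ->]].
    destruct (G_normal_form mu beta f Hm Hb HG) as [F [HF [F0 [HR HV]]]].
    destruct (derivative_representation F HF HR) as [phi [_ Hphi]].
    destruct (Hphi z Hz) as [B [N E]]. destruct (HV z Hz) as [D _].
    rewrite D, E. apply disc_distance_le; auto.
  - intros H. destruct (disc_parameter beta z w Hb Hz H) as [q [Hq ->]].
    exists (extremal_fun mu beta q). split; [apply extremal_fun_in_G; auto|].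
    rewrite derivative_value_ext by auto. rewrite (Cmult_comm q z). reflexivity.
  - intros f z HG Hz Nz Heq.
    destruct (G_normal_form mu beta f Hm Hb HG) as [F [HF [F0 [HR HV]]]].
    assert (Ef : forall z, disk z -> f z = Cexp (mu * (Clog (1 - z) + RtoC (1 - beta) * F z)))
      by (intros w Hw; apply (HV w Hw)).
    destruct Heq as [[lambda [Hl Hq]]|Hq].
    + destruct (subordination_log F HF F0 HR) as [s [Es [Bs Ss]]].
      destruct (HV z Hz) as [_ [Q _]].
      rewrite Q, (Es z Hz), Copp_opp in Hq.
      assert (Esz : 1 - s z = 1 + lambda * z).
      { apply (princ_pow_inj _ _ (1 - beta)); [| |lra|exact Hq].
        - apply Re_one_minus_pos. specialize (Bs z Hz). unfold disk in *. lra.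
        - replace (1 + lambda * z) with (1 - (- lambda * z)) by ring.
          apply Re_one_minus_pos, disk_mult; auto. rewrite Cmod_opp. lra. }
      destruct (Ss z Hz Nz) as [c [Hc Sc]].
      { replace (s z) with (- (lambda * z)).
        - rewrite Cmod_opp, Cmod_mult, Hl. ring.
        - replace (s z) with (1 - (1 - s z)) by ring. rewrite Esz. ring. }
      apply (extremal_form mu beta f F c Hc Ef).
      intros u Hu. rewrite (Es u Hu), (Sc u Hu). reflexivity.
    + destruct (derivative_representation F HF HR) as [phi [Hp Hphi]].
      destruct (Hphi z Hz) as [B [N E]]. destruct (HV z Hz) as [D _].
      rewrite D, E in Hq. assert (M := disc_distance_eq beta z _ Hb Hz N Hq).
      assert (Cst := max_modulus phi z Hp (fun w Hw => proj1 (Hphi w Hw)) Hz M).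
      set (c := phi z) in *.
      apply (extremal_form mu beta f F c M Ef).
      intros u Hu.
      assert (K : F u + Clog (1 - c * u) = F 0 + Clog (1 - c * 0)).
      { apply (zero_derivative_const (fun u => F u + Clog (1 - c * u)) 1); [|exact Hu].
        intros v Hv. destruct (Hphi v Hv) as [_ [_ Ev]].
        apply is_Cderive_eq with (C_derive F v + - (c / (1 - c * v))).
        - rewrite Ev, (Cst v Hv), (Cmult_comm v c). ring.
        - apply is_Cderive_plus; [apply holomorphic_is_Cderive; auto|].
          apply is_Cderive_Clog_one_minus; auto; lra. }
      rewrite F0, Cmult_0_r in K. replace (1 - 0) with (RtoC 1) in K by ring.
      rewrite Clog_1 in K.
      replace (F u) with ((F u + Clog (1 - c * u)) - Clog (1 - c * u)) by ring.
      rewrite K. ring.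
Qed.
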